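(* Let $r\ge1$ and $\mathcal{C}=\{1,2,\dots,r\}$. For each $u\in\mathcal{C}$ let $\{d_{u,n}\}_{n\ge1}$ and $\{b_{u,n}\}_{n\ge1}$ be real random variables, let $\alpha_u>0$, and suppose that there is a real sequence $\{m_{u,k}\}_{k\ge0}$ with $m_{u,0}=1$ such that $$\lim_{n\to\infty}\mathbb{E}\left[(b_{u,n}/n^{\alpha_u})^k\right]=m_{u,k}\quad\text{and}\quad\sup_{n\ge1}\mathbb{E}\left[|d_{u,n}|^k\right]<\infty\qquad\text{for every integer }k\ge0.$$ Assume that all the random variables $d_{u,n},b_{u,n}$ ($u\in\mathcal{C}$, $n\ge1$) are independent of one another. Assume in addition that for each $u\in\mathcal{C}$ there is $0\le\epsilon_u\le\alpha_u$ such that, with $\epsilon=\min_{u=1,\dots,r}\epsilon_u$: $$\lim_{n\to\infty}n^{2\epsilon_u}\,\mathrm{cov}\left((b_{u,n}/n^{\alpha_u})^k,(b_{u,n}/n^{\alpha_u})^l\right)=C_u(k,l)\quad\text{exists in }\mathbb{R}\text{ for all }k,l\ge1,$$ $$\sup_{n\ge1}\mathbb{E}\left[\left|n^{\epsilon}\left((b_{u,n}/n^{\alpha_u})^k-\mathbb{E}[(b_{u,n}/n^{\alpha_u})^k]\right)\right|^m\right]<\infty\quad\text{for all }k,m\ge1,$$ $$\lim_{n\to\infty}\mathrm{var}(d_{u,n})=\sigma_u^2 .$$ Let $A_{u,n}$ be the symmetric tridiagonal matrix built from $\{d_{u,n}\},\{b_{u,n}\}$ as in the context, $X_{u,n}=n^{-\alpha_u}A_{u,n}$,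 and set $$S_n(i_1,i_2,\dots,i_k)=n^{\epsilon+1/2}\left(\mathrm{tr}_n(X_{i_1,n}X_{i_2,n}\cdots X_{i_k,n})-\mathbb{E}[\mathrm{tr}_n(X_{i_1,n}X_{i_2,n}\cdots X_{i_k,n})]\right).$$ Then, as $n\to\infty$, the family $\{S_n(i_1,\dots,i_k):k\ge1,\ 1\le i_1,\dots,i_k\le r\}$ converges in (joint) moments to a Gaussian family.
   Context: Matrix model: $A_{u,n}$ is the $n\times n$ symmetric tridiagonal matrix whose diagonal entries, from top to bottom, are $d_{u,n},d_{u,n-1},\dots,d_{u,1}$ and whose off-diagonal entries, from top to bottom, are $b_{u,n-1},\dots,b_{u,1}$; all other entries are $0$. All moments of the variables are understood to be finite. $\mathrm{tr}_n(Y)=\frac1n\sum_{i=1}^n y_{i,i}$. Convergence in moments to a Gaussian family means that all joint moments of finitely many members of the family converge to the corresponding joint moments of a (possibly degenerate) jointly Gaussian family. *)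

(* Defs.v *)
From HB Require Import structures.
From mathcomp Require Import all_boot all_order all_algebra.
From mathcomp Require Import all_classical all_reals all_analysis.

Set Implicit Arguments.
Unset Strict Implicit.
Unset Printing Implicit Defensive.

Import Order.TTheory GRing.Theory Num.Theory.
Import numFieldNormedType.Exports.

Local Open Scope classical_set_scope.
Local Open Scope ring_scope.

Section probabilistic_notions.
Context {disp : measure_display} {T : measurableType disp} {R : realType}.
Variable P : probability T R.

Definition finite_moments (X : T -> R) :=
  forall k : nat, P.-integrable setT (fun w => (X w ^+ k)%:E).

Definition centered (X : T -> R) : T -> R := fun w => X w - fine ('E_P[X])%E.

Definition mutually_independent (I : eqType) (D : set I)
    (X : I -> {RV P >-> R}) :=
  forall (s : seq I) (B : I -> set R),
    uniq s -> (forall i, i \in s -> D i) -> (forall i, measurable (B i)) ->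
    P (\bigcap_(i in [set` s]) (X i @^-1` B i)) =
    (\prod_(i <- s) P (X i @^-1` B i))%E.

(* [normal_prob m 0] is the uniform law on [0, 1] in the library, so that the
   degenerate Gaussian laws, i.e., the point masses, are listed apart. *)
Definition gaussian (X : T -> R) :=
  (exists m : R, forall A : set R, measurable A ->
     pushforward P X A = (\d_m A)%E) \/
  (exists m s : R, 0 < s /\ forall A : set R, measurable A ->
     pushforward P X A = normal_prob m s A).

Definition jointly_gaussian (I : Type) (G : I -> {RV P >-> R}) :=
  forall (s : seq I) (a : I -> R),
    gaussian (fun w => \sum_(i <- s) a i * G i w).

End probabilistic_notions.

(* Members of the family may be repeated in the list [s]. *)
Definition cvg_moments_to_gaussian_family {disp : measure_display}
    {T : measurableType disp} {R : realType} (P : probability T R)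
    (I : Type) (S : nat -> I -> T -> R) :=
  exists (disp' : measure_display) (T' : measurableType disp')
         (P' : probability T' R) (G : I -> {RV P' >-> R}),
    jointly_gaussian G /\
    forall s : seq I,
      'E_P[fun w => (\prod_(i <- s) S n i w)%R]%E @[n --> \oo] -->
      'E_P'[fun w => (\prod_(i <- s) G i w)%R]%E.

Section matrix_model.
Context {R : realType}.

(* Row [i] counted from 0 has diagonal entry [d (n - i)], and the off-diagonal
   pair in rows [i] and [i.+1] is [b (n - i.+1)]. *)
Definition tridiagonal (n : nat) (d b : nat -> R) : 'M[R]_n :=
  \matrix_(i < n, j < n)
    if i == j :> nat then d (n - i)%N
    else if j == i.+1 :> nat then b (n - j)%N
    else if i == j.+1 :> nat then b (n - i)%N
    else 0.

Definition ntrace (n : nat) (Y : 'M[R]_n) : R := n%:R^-1 * \tr Y.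

(* [Ordinal hr] is the seed of the iterated minimum and itself an index. *)
Definition min_over (r : nat) (hr : (0 < r)%N) (f : 'I_r -> R) : R :=
  \big[Num.min/f (Ordinal hr)]_(u < r) f u.

Definition normalized {T : Type} (alpha : R) (Z : nat -> T -> R) (n : nat) :
  T -> R := fun w => Z n w / n%:R `^ alpha.

Section random_matrices.
Context {T : Type} {r : nat}.
Variables (alpha : 'I_r -> R) (d b : 'I_r -> nat -> T -> R).

Definition A_mx (u : 'I_r) (n : nat) (w : T) : 'M[R]_n :=
  tridiagonal n (fun k => d u k w) (fun k => b u k w).

Definition X_mx (u : 'I_r) (n : nat) (w : T) : 'M[R]_n :=
  n%:R `^ (- alpha u) *: A_mx u n w.

Definition tr_word (n : nat) (i : seq 'I_r) (w : T) : R :=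
  ntrace (\big[mulmx/1%:M]_(u <- i) X_mx u n w).
End random_matrices.
End matrix_model.

Definition word (r : nat) := {i : seq 'I_r | (1 <= size i)%N}.

Definition S_stat {disp : measure_display} {T : measurableType disp}
    {R : realType} (P : probability T R) {r : nat} (alpha : 'I_r -> R)
    (d b : 'I_r -> nat -> T -> R) (eps : R) (n : nat) (i : word r) : T -> R :=
  fun w => n%:R `^ (eps + 2^-1) *
           centered P (tr_word alpha d b n (val i)) w.

(* [inl (u, n)] and [inr (u, n)] index [d u n] and [b u n]. *)
Definition entries {disp : measure_display} {T : measurableType disp}
    {R : realType} {P : probability T R} {r : nat}
    (d b : 'I_r -> nat -> {RV P >-> R}) (x : 'I_r * nat + 'I_r * nat) :
    {RV P >-> R} :=
  match x with inl (u, n) => d u n | inr (u, n) => b u n end.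

Definition entry_index (r : nat) : set ('I_r * nat + 'I_r * nat) :=
  fun x => match x with inl (_, n) | inr (_, n) => (1 <= n)%N end.

(* Main.v *)
Require Import Defs.
From HB Require Import structures.
From mathcomp Require Import all_boot all_order all_algebra.
From mathcomp Require Import all_classical all_reals all_analysis.
From mathcomp Require Import measurable_realfun ess_sup_inf simple_functions.
From mathcomp Require Import ring lra zify.

Set Implicit Arguments.
Unset Strict Implicit.
Unset Printing Implicit Defensive.

Import Order.TTheory GRing.Theory Num.Theory.
Import numFieldNormedType.Exports.

Local Open Scope classical_set_scope.
Local Open Scope ring_scope.

(** The trace of a product of the matrices [X_mx] along a word is a sum over the
    closed lattice walks that the word allows: the factor for a letter is a
    diagonal entry (the walk stays) or an off-diagonal entry (the walk moves to
    a neighbouring row). A walk that starts at row [i] only meets entries whose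
    index is within the length [M] of the word, so, by independence of the
    entries, the centered diagonal terms [fluctuation] form a triangular array
    with finite-range dependence. A finite sum of statistics [S_stat] is
    [n^-1/2] times the row sum of such an array ([sum_S_stat]), and the theorem
    is a central limit theorem for it, in the sense of moments.

    The proof of that central limit theorem is Stein's method on moments. Write
    [L] for the normalized sum, and replace [L] by [L] minus the terms near [i]
    in the summand [V i * L ^+ k.+1] of [L ^+ k.+2]. By independence and
    centering the zeroth-order term vanishes, and the first-order term factors
    into [k.+1 * Var L * Ex (L ^+ k)] up to an error of order [n^-1/2]
    ([stein_recursion]). This is the recursion of the moments of a centered
    normal law, so the moments converge as soon as the variance does
    ([moment_clt]). The error terms need all moments of [L] to be bounded, which
    is the same expansion closed up by Young's inequality
    ([bm_normalized_sum]).

    The variance is the mean over the rows of a covariance between a term and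
    its neighbours. Such a covariance is a finite sum of products of entry
    moments, and each of them behaves like [(t / n) ^ q * g t] at level [t] of
    size [n], with [q >= 0] and [g] convergent. The functions with this shape
    ([regular]) are closed under the operations that occur, in particular
    telescoping of a difference of products, where the rate [n ^ (2 * e)] is
    absorbed by the covariance of a single entry ([regular_site_cov]); their
    means converge because power sums do ([mean_regular_cvg]). The scaling
    [n ^ e] keeps the moments bounded: the class [tame] is an algebra that
    contains the entries.

    It remains to go from sums to joint moments. The limit covariance is
    positive semidefinite, as a limit of second moments. A product of [n]
    variables is a signed combination of [n]-th powers of partial sums
    ([polarization]), so that joint moments are determined by the moments of
    sums ([cvg_moments_gaussian]). A Gaussian family with a prescribed positive
    semidefinite covariance on a countable index set is built on the unit
    interval: binary digits at even and at odd places split one uniform variable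
    into two independent ones, the quantile function turns uniform into normal,
    and successive pivoting of the covariance gives the coefficients
    ([gaussian_family]). *)

(** * Families with bounded moments *)

Lemma normrD_exp_le (R : realDomainType) (x y : R) k :
  `|x + y| ^+ k <= 2 ^+ k * (`|x| ^+ k + `|y| ^+ k).
Proof.
have h a b : `|a| <= `|b| -> `|a + b| ^+ k <= 2 ^+ k * (`|a| ^+ k + `|b| ^+ k) :> R.
  move=> ab; apply: (@le_trans _ _ (2 ^+ k * `|b| ^+ k)).
    rewrite -exprMn; apply: lerXn2r; rewrite ?nnegrE ?mulr_ge0//.
    by apply: (le_trans (ler_normD _ _)); rewrite mulr_natl mulr2n lerD2r.
  by rewrite ler_pM2l ?exprn_gt0// lerDr exprn_ge0.
case: (leP `|x| `|y|) => [/h//|/ltW /h].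
by rewrite addrC [X in _ * X]addrC.
Qed.

Lemma normrM_exp_le (R : realDomainType) (x y : R) k :
  `|x * y| ^+ k <= `|x| ^+ (k * 2) + `|y| ^+ (k * 2).
Proof.
rewrite normrM exprMn !exprM.
set a := _ ^+ k; set b := `|y| ^+ k.
have a0 : 0 <= a by rewrite exprn_ge0.
have b0 : 0 <= b by rewrite exprn_ge0.
by nra.
Qed.

Section bounded_moments.
Context {disp : measure_display} {T : measurableType disp} {R : realType}.
Variable P : probability T R.

(** A real-valued expectation, so that identities between moments can be handled
    by ring tactics. *)
Definition Ex (X : T -> R) : R := \int[P]_w X w.

(** The bound is stated on the extended integral, so that it contains
    integrability; it is uniform in the index, which plays the role of [n]. *)
Definition bounded_moments (J : Type) (X : J -> T -> R) :=
  (forall j, measurable_fun setT (X j)) /\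
  forall k : nat, exists K : R, forall j,
    (\int[P]_w (`|X j w| ^+ k)%:E <= K%:E)%E.

Lemma eq_Ex (X Y : T -> R) : X =1 Y -> Ex X = Ex Y.
Proof. by move=> XY; apply: eq_Rintegral => w _. Qed.

Lemma measurable_normX (X : T -> R) k : measurable_fun setT X ->
  measurable_fun setT (EFin \o (fun w => `|X w| ^+ k : R)).
Proof.
move=> mX; apply/measurable_EFinP; apply: measurable_funX.
exact: measurableT_comp.
Qed.

Section closure.
Context {J : Type}.
Implicit Types X Y : J -> T -> R.

Lemma bm_measurable X j : bounded_moments X -> measurable_fun setT (X j).
Proof. by case. Qed.

Lemma bm_le X Y : (forall j, measurable_fun setT (X j)) ->
  (forall j w, `|X j w| <= `|Y j w|) -> bounded_moments Y -> bounded_moments X.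
Proof.
move=> mX XY [mY bY]; split=> // k; have [K hK] := bY k; exists K => j.
apply: le_trans (hK j); apply: ge0_le_integral => //.
- exact: measurable_normX.
- exact: measurable_normX.
- by move=> w _; rewrite lee_fin lerXn2r ?nnegrE.
Qed.

Lemma bm_ext X Y : (forall j, X j =1 Y j) -> bounded_moments X -> bounded_moments Y.
Proof.
move=> XY; suff <- : X = Y by [].
by apply/funext => j; apply/funext => w; rewrite XY.
Qed.

Lemma bmD X Y : bounded_moments X -> bounded_moments Y ->
  bounded_moments (fun j w => X j w + Y j w).
Proof.
move=> [mX bX] [mY bY]; split=> [j|k]; first exact: measurable_funD.
have [K hK] := bX k; have [K' hK'] := bY k.
exists (2 ^+ k * (K + K')) => j.
apply: (@le_trans _ _ (\int[P]_w ((2 ^+ k)%:E * ((`|X j w| ^+ k)%:E + (`|Y j w| ^+ k)%:E)))%E).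
  apply: ge0_le_integral => //.
  - by apply: measurable_normX; exact: measurable_funD.
  - exact: measurable_funeM (emeasurable_funD (measurable_normX k (mX j)) (measurable_normX k (mY j))).
  - by move=> w _; rewrite -EFinD -EFinM lee_fin normrD_exp_le.
rewrite ge0_integralZl//; last 2 first.
- exact: emeasurable_funD (measurable_normX k (mX j)) (measurable_normX k (mY j)).
- by move=> w _; rewrite -EFinD lee_fin addr_ge0// exprn_ge0.
rewrite EFinM lee_pmul2l ?lte_fin ?exprn_gt0//.
rewrite ge0_integralD//; last 2 first.
- exact: measurable_normX.
- exact: measurable_normX.
by rewrite EFinD leeD.
Qed.

Lemma bmM X Y : bounded_moments X -> bounded_moments Y ->
  bounded_moments (fun j w => X j w * Y j w).
Proof.
move=> [mX bX] [mY bY]; split=> [j|k]; first exact: measurable_funM.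
have [K hK] := bX (k * 2)%N; have [K' hK'] := bY (k * 2)%N.
exists (K + K') => j.
apply: (@le_trans _ _ (\int[P]_w ((`|X j w| ^+ (k * 2))%:E + (`|Y j w| ^+ (k * 2))%:E))%E).
  apply: ge0_le_integral => //.
  - by apply: measurable_normX; exact: measurable_funM.
  - exact: emeasurable_funD (measurable_normX _ (mX j)) (measurable_normX _ (mY j)).
  - by move=> w _; rewrite -EFinD lee_fin normrM_exp_le.
rewrite ge0_integralD//; last 2 first.
- exact: measurable_normX.
- exact: measurable_normX.
by rewrite EFinD leeD.
Qed.

Lemma bm_cst (c : J -> R) (K : R) : (forall j, `|c j| <= K) ->
  bounded_moments (fun j _ => c j).
Proof.
move=> cK; split=> [j|k]; first exact: measurable_cst.
exists (K ^+ k) => j.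
rewrite integral_cst//= probability_setT mule1 lee_fin lerXn2r ?nnegrE//.
exact: le_trans (cK j).
Qed.

Lemma bm_const (c : R) : bounded_moments (fun (_ : J) _ => c).
Proof. exact: (@bm_cst (fun=> c) `|c|). Qed.

Lemma bmZ X (c : J -> R) (K : R) : (forall j, `|c j| <= K) ->
  bounded_moments X -> bounded_moments (fun j w => c j * X j w).
Proof. by move=> /bm_cst; exact: bmM. Qed.

Lemma bmN X : bounded_moments X -> bounded_moments (fun j w => - X j w).
Proof.
move=> bX; apply: (bm_ext _ (bmZ (c := fun=> -1) (K := 1) _ bX)).
  by move=> j w /=; rewrite mulN1r.
by move=> j; rewrite normrN normr1.
Qed.

Lemma bmB X Y : bounded_moments X -> bounded_moments Y ->
  bounded_moments (fun j w => X j w - Y j w).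
Proof. by move=> bX /bmN; exact: bmD. Qed.

Lemma bmX X k : bounded_moments X -> bounded_moments (fun j w => X j w ^+ k).
Proof.
move=> bX; elim: k => [|k IH]; first exact: (bm_ext _ (bm_const 1)).
by apply: (bm_ext _ (bmM bX IH)) => j w /=; rewrite exprS.
Qed.

Lemma bm_norm X : bounded_moments X -> bounded_moments (fun j w => `|X j w|).
Proof.
move=> bX; apply: (bm_le _ _ bX) => [j|j w]; last by rewrite normr_id.
by apply: measurableT_comp => //; exact: bm_measurable.
Qed.

Lemma bm_sum (I : Type) (s : seq I) (X : I -> J -> T -> R) :
  (forall i, bounded_moments (X i)) ->
  bounded_moments (fun j w => \sum_(i <- s) X i j w).
Proof.
move=> bX; elim: s => [|i s IH].
  by apply: (bm_ext _ (bm_const 0)) => j w; rewrite big_nil.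
by apply: (bm_ext _ (bmD (bX i) IH)) => j w /=; rewrite big_cons.
Qed.

Lemma bm_sumP (I : Type) (s : seq I) (p : pred I) (X : I -> J -> T -> R) :
  (forall i, bounded_moments (X i)) ->
  bounded_moments (fun j w => \sum_(i <- s | p i) X i j w).
Proof.
move=> bX; apply: (bm_ext _ (bm_sum [seq i <- s | p i] bX)) => j w.
by rewrite big_filter.
Qed.

Lemma bm_if X Y (b : J -> bool) : bounded_moments X -> bounded_moments Y ->
  bounded_moments (fun j => if b j then X j else Y j).
Proof.
move=> [mX bX] [mY bY]; split=> [j|k]; first by case: ifP.
have [K hK] := bX k; have [K' hK'] := bY k.
exists (Num.max K K') => j; case: ifP => _; [apply: (le_trans (hK j))|apply: (le_trans (hK' j))].
  by rewrite lee_fin le_max lexx.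
by rewrite lee_fin le_max lexx orbT.
Qed.

Lemma bm_comp (J' : Type) (f : J' -> J) X : bounded_moments X ->
  bounded_moments (fun j => X (f j)).
Proof.
move=> [mX bX]; split=> [j|k]; first exact: mX.
by have [K hK] := bX k; exists K => j; exact: hK.
Qed.

Lemma bm_integrable X j : bounded_moments X ->
  P.-integrable setT (EFin \o X j).
Proof.
move=> [mX bX]; apply/integrableP; split; first exact/measurable_EFinP.
have [K hK] := bX 1%N.
by apply: (le_lt_trans (hK j)); rewrite ltry.
Qed.

(** The converse of the definition, through real expectations. *)
Lemma bm_Ex_norm X k : bounded_moments X ->
  exists2 K : R, 0 <= K & forall j, Ex (fun w => `|X j w| ^+ k) <= K.
Proof.
move=> bX; have [K hK] := bX.2 k; exists `|K| => // j.
apply: (@le_trans _ _ K); last exact: ler_norm.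
rewrite -lee_fin /Ex /Rintegral fineK//.
exact/integrable_fin_num/(bm_integrable j (bmX k (bm_norm bX))).
Qed.

End closure.

(** Even moments control all absolute moments, as [a <= 1 + a ^ 2]. *)
Lemma bm_of_Ex (J : Type) (X : J -> T -> R) :
  (forall j k, P.-integrable setT (fun w => (X j w ^+ k)%:E)) ->
  (forall k, exists K, forall j, Ex (fun w => X j w ^+ (k * 2)) <= K) ->
  bounded_moments X.
Proof.
move=> iX bX.
have mX j : measurable_fun setT (X j).
  by have /(measurable_int P)/measurable_EFinP := iX j 1%N.
split=> // k; have [K hK] := bX k; exists (1 + K) => j.
apply: (@le_trans _ _ (\int[P]_w (1%:E + (X j w ^+ (k * 2))%:E))%E).
  apply: ge0_le_integral => //.
  - exact: measurable_normX.
  - by apply: emeasurable_funD => //; exact: (measurable_int P).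
  - move=> w _; rewrite -EFinD lee_fin.
    have -> : X j w ^+ (k * 2) = (`|X j w| ^+ k) ^+ 2.
      by rewrite -exprM mulnC !exprM real_normK ?num_real.
    have : 0 <= `|X j w| ^+ k by rewrite exprn_ge0.
    by set a := _ ^+ k => a0; nra.
rewrite integralD//; last first.
  by apply: finite_measure_integrable_cst.
rewrite integral_cst//= probability_setT mule1 EFinD leeD2l//.
rewrite -[leLHS]fineK; first by rewrite lee_fin; exact: hK.
exact: integrable_fin_num.
Qed.

(** The case of a single variable, which inherits all closure properties. *)
Definition all_moments (X : T -> R) := bounded_moments (fun _ : unit => X).

Lemma bm_all_moments (J : Type) (X : J -> T -> R) j :
  bounded_moments X -> all_moments (X j).
Proof. exact: (bm_comp (fun=> j)). Qed.

Section expectation.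
Implicit Types X Y : T -> R.

Lemma am_integrable X : all_moments X -> P.-integrable setT (EFin \o X).
Proof. exact: (bm_integrable tt). Qed.

Lemma amD X Y : all_moments X -> all_moments Y -> all_moments (fun w => X w + Y w).
Proof. exact: bmD. Qed.

Lemma amB X Y : all_moments X -> all_moments Y -> all_moments (fun w => X w - Y w).
Proof. exact: bmB. Qed.

Lemma amM X Y : all_moments X -> all_moments Y -> all_moments (fun w => X w * Y w).
Proof. exact: bmM. Qed.

Lemma amX X k : all_moments X -> all_moments (fun w => X w ^+ k).
Proof. exact: bmX. Qed.

Lemma am_cst c : all_moments (fun=> c).
Proof. exact: bm_const. Qed.

Lemma amZ X c : all_moments X -> all_moments (fun w => c * X w).
Proof. exact/amM/am_cst. Qed.

Lemma am_sum (I : Type) (s : seq I) (p : pred I) (X : I -> T -> R) :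
  (forall i, all_moments (X i)) ->
  all_moments (fun w => \sum_(i <- s | p i) X i w).
Proof. exact: (@bm_sumP unit I s p (fun i _ => X i)). Qed.

Lemma am_prod (I : Type) (s : seq I) (X : I -> T -> R) :
  (forall i, all_moments (X i)) -> all_moments (fun w => \prod_(i <- s) X i w).
Proof.
move=> aX; elim: s => [|i s IH].
  by apply: (bm_ext _ (am_cst 1)) => _ w; rewrite big_nil.
by apply: (bm_ext _ (amM (aX i) IH)) => _ w /=; rewrite big_cons.
Qed.

Lemma ExD X Y : all_moments X -> all_moments Y ->
  Ex (fun w => X w + Y w) = Ex X + Ex Y.
Proof. by move=> bX bY; rewrite /Ex RintegralD//; exact: am_integrable. Qed.

Lemma ExB X Y : all_moments X -> all_moments Y ->
  Ex (fun w => X w - Y w) = Ex X - Ex Y.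
Proof. by move=> bX bY; rewrite /Ex RintegralB//; exact: am_integrable. Qed.

Lemma ExZ X c : all_moments X -> Ex (fun w => c * X w) = c * Ex X.
Proof. by move=> bX; rewrite /Ex RintegralZl//; exact: am_integrable. Qed.

Lemma Ex_cst c : Ex (fun=> c) = c.
Proof. by rewrite /Ex /Rintegral integral_cst//= probability_setT mule1. Qed.

Lemma Ex_sum (I : Type) (s : seq I) (p : pred I) (X : I -> T -> R) :
  (forall i, all_moments (X i)) ->
  Ex (fun w => \sum_(i <- s | p i) X i w) = \sum_(i <- s | p i) Ex (X i).
Proof.
move=> bX; elim: s => [|i s IH].
  by rewrite big_nil (eq_Ex (Y := fun=> 0)) ?Ex_cst// => w; rewrite big_nil.
rewrite big_cons -IH; case: (boolP (p i)) => pi; last first.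
  by apply: eq_Ex => w; rewrite big_cons (negbTE pi).
rewrite -(ExD (bX i) (am_sum s p bX)).
by apply: eq_Ex => w; rewrite big_cons pi.
Qed.

Lemma Ex_le X Y : all_moments X -> all_moments Y ->
  (forall w, X w <= Y w) -> Ex X <= Ex Y.
Proof.
by move=> bX bY XY; apply: le_Rintegral => //; exact: am_integrable.
Qed.

Lemma Ex_ge0 X : (forall w, 0 <= X w) -> 0 <= Ex X.
Proof. by move=> X0; apply: Rintegral_ge0 => w _. Qed.

Lemma norm_Ex_le X : all_moments X -> `|Ex X| <= Ex (fun w => `|X w|).
Proof. by move=> bX; apply: le_normr_Rintegral => //; exact: am_integrable. Qed.

End expectation.

Lemma bm_Ex (J : Type) (X : J -> T -> R) :
  bounded_moments X -> exists2 K, 0 <= K & forall j, `|Ex (X j)| <= K.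
Proof.
move=> bX; have [K K0 hK] := bm_Ex_norm 1 bX; exists K => // j.
by apply: (le_trans (norm_Ex_le (bm_all_moments j bX))); exact: hK.
Qed.

Lemma bm_center (J : Type) (X : J -> T -> R) : bounded_moments X ->
  bounded_moments (fun j w => X j w - Ex (X j)).
Proof.
move=> bX; apply: bmB => //.
by have [K _ hK] := bm_Ex bX; exact: bm_cst hK.
Qed.

End bounded_moments.

(** * Independence of blocks of variables *)

Section pair_law.
Context {disp : measure_display} {T : measurableType disp} {R : realType}.
Variable P : probability T R.
Context {d1 d2 : measure_display} {T1 : measurableType d1}
  {T2 : measurableType d2}.
Variables (U : {RV P >-> T1}) (V : {RV P >-> T2}).

Hypothesis indepUV : forall A B, measurable A -> measurable B ->
  P (U @^-1` A `&` V @^-1` B) = (P (U @^-1` A) * P (V @^-1` B))%E.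

Let mUV : measurable_fun setT (fun w => (U w, V w)).
Proof. exact: measurable_fun_pair. Qed.

(** A product rule on rectangles determines the joint law, by uniqueness of the
    product measure. *)
Lemma pair_lawE (X : set (T1 * T2)) : measurable X ->
  (distribution P U \x distribution P V)%E X = P ((fun w => (U w, V w)) @^-1` X).
Proof.
move=> mX; pose UV : {RV P >-> (T1 * T2)%type} := mfun_Sub (mem_set mUV).
rewrite (product_measure_unique _ _ (m' := distribution P UV))//.
Qed.

(** The joint law is a product, so Fubini's theorem applies. The two variables
    may take values in any measurable spaces: below they are the identity, seen
    as a map to the sample space with a smaller sigma-algebra. *)
Lemma ExM_pair (f : T1 -> R) (g : T2 -> R) :
  measurable_fun setT f -> measurable_fun setT g ->
  P.-integrable setT (EFin \o (f \o U)) ->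
  P.-integrable setT (EFin \o (g \o V)) ->
  P.-integrable setT (fun w => (f (U w) * g (V w))%:E) ->
  Ex P (fun w => f (U w) * g (V w)) = Ex P (f \o U) * Ex P (g \o V).
Proof.
move=> mf mg iF iG iFG.
pose UV : {RV P >-> (T1 * T2)%type} := mfun_Sub (mem_set mUV).
pose h (z : T1 * T2) : \bar R := (f z.1 * g z.2)%:E.
have mh : measurable_fun setT h.
  by apply/measurable_EFinP; apply: measurable_funM; exact: measurableT_comp.
have eq_law (D : set (T1 * T2)) : measurable D ->
    (distribution P U \x distribution P V)%E D = distribution P UV D.
  exact: pair_lawE.
have ih : (distribution P U \x distribution P V)%E.-integrable setT h.
  apply/integrableP; split=> //.
  rewrite (eq_measure_integral (distribution P UV)); last by move=> A mA _; exact: eq_law.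
  have := @integrable_pushforward _ _ _ _ _ _ mUV P setT h mh.
  by move=> /(_ iFG measurableT) /integrableP[].
have -> : Ex P (fun w => f (U w) * g (V w)) =
    fine (\int[(distribution P U \x distribution P V)%E]_z h z)%E.
  rewrite (eq_measure_integral (distribution P UV)); last by move=> A mA _; exact: eq_law.
  by rewrite integral_distribution.
rewrite -integral12_prod_meas1//=.
have iF' : (distribution P U).-integrable setT (EFin \o f).
  apply: (@integrable_pushforward _ _ _ _ _ _ _ P setT) => //.
  exact/measurable_EFinP.
have iG' : (distribution P V).-integrable setT (EFin \o g).
  apply: (@integrable_pushforward _ _ _ _ _ _ _ P setT) => //.
  exact/measurable_EFinP.
have EU : (\int[distribution P U]_x (f x)%:E = (Ex P (f \o U))%:E)%E.
  rewrite integral_distribution//; last exact/measurable_EFinP.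
  by rewrite /Ex /Rintegral fineK//; exact: integrable_fin_num.
have EV : (\int[distribution P V]_x (g x)%:E = (Ex P (g \o V))%:E)%E.
  rewrite integral_distribution//; last exact/measurable_EFinP.
  by rewrite /Ex /Rintegral fineK//; exact: integrable_fin_num.
have -> : (\int[distribution P U]_x \int[distribution P V]_y (f x * g y)%:E =
    \int[distribution P U]_x ((f x)%:E * (Ex P (g \o V))%:E))%E.
  apply: eq_integral => x _; rewrite -EV -integralZl//.
by rewrite integralZr// EU.
Qed.

End pair_law.

Section blocks.
Context {disp : measure_display} {T : measurableType disp} {R : realType}.
Variables (P : probability T R) (I : eqType) (D0 : set I) (X : I -> {RV P >-> R}).
Hypothesis indepX : mutually_independent D0 X.

(** The events that constrain finitely many variables with index in [D]; they
    form a pi-system that generates the sigma-algebra of the block. *)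
Definition cylinder (D : set I) : set (set T) :=
  [set A | exists (s : seq I) (B : I -> set R),
    [/\ uniq s, forall i, i \in s -> D i, forall i, measurable (B i) &
        A = \bigcap_(i in [set` s]) (X i @^-1` B i)]].

(** Measurability with respect to the sigma-algebra generated by a block of
    variables. Unlike an explicit function of these variables, it needs no bound
    on the size of the block. *)
Definition block_measurable (D : set I) (f : T -> R) :=
  measurable_fun setT (f : g_sigma_algebraType (cylinder D) -> R).

Lemma cylinder_setT (D : set I) : cylinder D setT.
Proof.
exists [::], (fun=> setT); split => //.
by apply/esym; rewrite -subTset => w _ i.
Qed.

Lemma cylinder_measurable (D : set I) : cylinder D `<=` measurable.
Proof.
move=> A [s [B [_ _ mB ->]]].
apply: fin_bigcap_measurable => // i _.
by rewrite -[X in measurable X]setTI; exact: measurable_funPT.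
Qed.

Lemma cylinder_setI (D : set I) : setI_closed (cylinder D).
Proof.
move=> _ _ [s [B [us sD mB ->]]] [s' [B' [us' sD' mB' ->]]].
exists (undup (s ++ s')), (fun i => (if i \in s then B i else setT) `&`
                          (if i \in s' then B' i else setT)); split.
- exact: undup_uniq.
- by move=> i; rewrite mem_undup mem_cat => /orP[/sD|/sD'].
- by move=> i; apply: measurableI; case: ifP.
- apply/seteqP; split=> [w [h h'] i /= _|w h]; last first.
    split=> i /= si; have := h i; rewrite /= mem_undup mem_cat si ?orbT => /(_ isT) [];
    by rewrite ?si.
  by split; case: ifPn => // si; [exact: h|exact: h'].
Qed.

Lemma cylinder_indep (D D' : set I) : D `<=` D0 -> D' `<=` D0 ->
  (forall i, D i -> ~ D' i) -> forall A B, cylinder D A -> cylinder D' B ->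
  P (A `&` B) = (P A * P B)%E.
Proof.
move=> DD0 D'D0 DD' _ _ [s [B [us sD mB ->]]] [s' [B' [us' sD' mB' ->]]].
have Dn i : i \in s' -> i \notin s.
  by move=> /sD' D'i; apply/negP => /sD /DD'; exact.
pose C i := if i \in s then B i else B' i.
have -> : \bigcap_(i in [set` s]) (X i @^-1` B i) `&`
          \bigcap_(i in [set` s']) (X i @^-1` B' i) =
          \bigcap_(i in [set` s ++ s']) (X i @^-1` C i).
  apply/seteqP; split=> [w [h h'] i /=|w h].
    rewrite mem_cat /C; case: ifPn => [si _|_ /= si]; first exact: h.
    exact: h'.
  split=> i /= si; have := h i; rewrite /= mem_cat si ?orbT => /(_ isT); rewrite /C.
    by rewrite si.
  by rewrite (negbTE (Dn _ si)).
rewrite (indepX (s := s ++ s')); last 3 first.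
- rewrite cat_uniq us us' andbT/=; apply/hasPn => i /Dn; exact.
- by move=> i; rewrite mem_cat => /orP[/sD/DD0|/sD'/D'D0].
- by move=> i; rewrite /C; case: ifP.
rewrite big_cat/= (indepX (s := s))//; last by move=> i /sD/DD0.
rewrite (indepX (s := s'))//; last by move=> i /sD'/D'D0.
congr (_ * _)%E; rewrite big_seq [RHS]big_seq; apply: eq_bigr => i si; rewrite /C.
  by rewrite si.
by rewrite (negbTE (Dn _ si)).
Qed.

(** Both sides are finite measures of the event [A] that agree on a pi-system. *)
Lemma product_rule_sigma (G : set (set T)) (B : set T) :
  G `<=` measurable -> setI_closed G -> G setT -> measurable B ->
  (forall A, G A -> P (A `&` B) = (P A * P B)%E) ->
  forall A, <<s G >> A -> P (A `&` B) = (P A * P B)%E.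
Proof.
move=> mG GI GT mB PG A sA.
have r0 : 0 <= fine (P B) by apply: fine_ge0.
have PB : P B = (fine (P B))%:E by rewrite fineK// fin_num_measure.
have E C : mscale (NngNum r0) P C = (P C * P B)%E.
  by rewrite /mscale/= -PB muleC.
rewrite -E -/(mrestr P mB A).
apply: (@g_sigma_algebra_measure_unique _ _ _ G mG (fun=> setT)) => //.
- by rewrite -subTset => w _; exists 0%N.
- by move=> C /PG PC; rewrite [RHS]E.
- by move=> _; rewrite /= /mrestr setTI -ge0_fin_numE// fin_num_measure.
Qed.

(** The product rule is extended from cylinders to sigma-algebras one factor at a
    time. *)
Lemma sigma_cylinder_indep (D D' : set I) : D `<=` D0 -> D' `<=` D0 ->
  (forall i, D i -> ~ D' i) -> forall A B,
  <<s cylinder D >> A -> <<s cylinder D' >> B -> P (A `&` B) = (P A * P B)%E.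
Proof.
move=> DD0 D'D0 DD' A B sA sB.
have mA : measurable A.
  exact: (smallest_sub (@sigma_algebra_measurable _ T) (@cylinder_measurable D)).
rewrite setIC muleC; apply: (@product_rule_sigma (cylinder D')) => //.
- exact: cylinder_measurable.
- exact: cylinder_setI.
- exact: cylinder_setT.
move=> {sB} {}B cB; rewrite setIC muleC.
apply: (@product_rule_sigma (cylinder D)) => //.
- exact: cylinder_measurable.
- exact: cylinder_setI.
- exact: cylinder_setT.
- exact: cylinder_measurable cB.
- by move=> {sA mA} {}A cA; exact: cylinder_indep cA cB.
Qed.

Let measurable_id_cylinder (D : set I) :
  measurable_fun [set: T] (id : T -> g_sigma_algebraType (cylinder D)).
Proof.
move=> _ A mA; rewrite setTI preimage_id.
exact: (smallest_sub (@sigma_algebra_measurable _ T) (@cylinder_measurable D)).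
Qed.

(** The two sigma-algebras are independent, and [ExM_pair] applies to the identity
    map of the sample space, equipped with the one and with the other. *)
Lemma ExM_blocks (D D' : set I) (f g : T -> R) : D `<=` D0 -> D' `<=` D0 ->
  (forall i, D i -> ~ D' i) -> block_measurable D f -> block_measurable D' g ->
  P.-integrable setT (EFin \o f) -> P.-integrable setT (EFin \o g) ->
  P.-integrable setT (fun w => (f w * g w)%:E) ->
  Ex P (fun w => f w * g w) = Ex P f * Ex P g.
Proof.
move=> DD0 D'D0 DD' mf mg.
pose U : {RV P >-> g_sigma_algebraType (cylinder D)} :=
  mfun_Sub (mem_set (@measurable_id_cylinder D)).
pose V : {RV P >-> g_sigma_algebraType (cylinder D')} :=
  mfun_Sub (mem_set (@measurable_id_cylinder D')).
apply: (@ExM_pair _ T R P _ _ _ _ U V) => // A B mA mB.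
exact: sigma_cylinder_indep mA mB.
Qed.

Section closure.
Variable D : set I.
Implicit Types f g : T -> R.

Lemma block_measurable_RV i : D i -> block_measurable D (X i).
Proof.
move=> Di _ B mB; rewrite setTI; apply: sub_sigma_algebra.
exists [:: i], (fun=> B); split=> //.
- by move=> j; rewrite inE => /eqP ->.
- apply/seteqP; split=> [w h j /=|w]; first by rewrite inE => /eqP ->.
  by move=> /(_ i); apply; rewrite /= inE.
Qed.

Lemma eq_block_measurable f g : f =1 g -> block_measurable D f -> block_measurable D g.
Proof. by move=> /funext ->. Qed.

Lemma block_measurable_cst c : block_measurable D (fun=> c).
Proof. exact: measurable_cst. Qed.

Lemma block_measurableD f g : block_measurable D f -> block_measurable D g ->
  block_measurable D (fun w => f w + g w).
Proof. exact: measurable_funD. Qed.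

Lemma block_measurableM f g : block_measurable D f -> block_measurable D g ->
  block_measurable D (fun w => f w * g w).
Proof. exact: measurable_funM. Qed.

Lemma block_measurableX f k : block_measurable D f ->
  block_measurable D (fun w => f w ^+ k).
Proof. exact: measurable_funX. Qed.

Lemma block_measurable_sum J (s : seq J) (p : pred J) (f : J -> T -> R) :
  (forall j, p j -> block_measurable D (f j)) ->
  block_measurable D (fun w => \sum_(j <- s | p j) f j w).
Proof.
move=> mf; elim: s => [|j s IH].
  by apply: (eq_block_measurable _ (block_measurable_cst 0)) => w; rewrite big_nil.
case: (boolP (p j)) => pj.
  apply: (eq_block_measurable _ (block_measurableD (mf _ pj) IH)) => w.
  by rewrite big_cons pj.
by apply: (eq_block_measurable _ IH) => w; rewrite big_cons (negbTE pj).
Qed.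

Lemma block_measurable_prod (J : eqType) (s : seq J) (f : J -> T -> R) :
  {in s, forall j, block_measurable D (f j)} ->
  block_measurable D (fun w => \prod_(j <- s) f j w).
Proof.
elim: s => [|j s IH] mf.
  by apply: (eq_block_measurable _ (block_measurable_cst 1)) => w; rewrite big_nil.
have mj := mf j (mem_head _ _).
have ms : block_measurable D (fun w => \prod_(j <- s) f j w).
  by apply: IH => k ks; apply: mf; rewrite inE ks orbT.
by apply: (eq_block_measurable _ (block_measurableM mj ms)) => w; rewrite big_cons.
Qed.

End closure.

Lemma block_measurable_sub (D D' : set I) f : D `<=` D' ->
  block_measurable D f -> block_measurable D' f.
Proof.
move=> DD' mf _ B mB; have := mf measurableT B mB; rewrite !setTI.
apply: sub_smallest2r; first exact: smallest_sigma_algebra.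
move=> _ [s [C [us sD mC ->]]]; exists s, C; split=> //.
by move=> i /sD/DD'.
Qed.

End blocks.

(** * A central limit theorem for moments under finite-range dependence *)

Section real_bounds.
Context {R : realFieldType}.
Implicit Types x y a v s : R.

Lemma normB_exp_le x y B k : `|x| <= B -> `|y| <= B ->
  `|x ^+ k.+1 - y ^+ k.+1| <= `|x - y| * (k.+1%:R * B ^+ k).
Proof.
move=> xB yB; rewrite subrXX normrM ler_wpM2l//.
apply: (le_trans (ler_norm_sum _ _ _)).
rewrite -[X in X%:R]card_ord -sumr_const mulr_suml; apply: ler_sum => i _.
rewrite mul1r normrM !normrX.
have -> : B ^+ k = B ^+ (k.+1.-1 - i) * B ^+ i.
  by rewrite -exprD subnK// -ltnS.
by apply: ler_pM; rewrite ?exprn_ge0//; apply: lerXn2r; rewrite ?nnegrE// (le_trans _ xB).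
Qed.

(** One step of the moment bound: the increment of a power is of order [s], and by
    Young's inequality half of the highest power of [x] suffices, with all the
    rest paid by [v] and [a]. The constant [2^-1] lets the highest power be
    absorbed later. *)
Lemma increment_young k : exists C, forall v a x s, 0 <= s <= 1 ->
  `|v * (x ^+ k.+1 - (x - s * a) ^+ k.+1)| <=
  s * (2^-1 * `|x| ^+ k.+2 + C * (`|v| + `|a|) ^+ k.+2).
Proof.
pose m : R := k.+1%:R.
(* If [u <= e * `|x|] the increment is at most [2^-1 * `|x| ^+ k.+2], by the choice
   of [e]; otherwise [`|x| <= e^-1 * u], which gives the constant. *)
pose e : R := (m * 2 ^+ k.+1)^-1.
have m1 : 1 <= m by rewrite ler1n.
have p1 : 1 <= (2 : R) ^+ k by rewrite exprn_ege1// ler1n.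
have e0 : 0 < e by rewrite invr_gt0 mulr_gt0// ?exprn_gt0//; lra.
have e1 : e <= 1.
  by rewrite invf_le1 ?mulr_gt0// ?exprn_gt0//; rewrite ?exprS; nra.
have ee : m * 2 ^+ k * e = 2^-1.
  rewrite /e exprS; field; rewrite expf_eq0 pnatr_eq0 andbF/=.
  by rewrite /m; lra.
exists (m * (e^-1 + 1) ^+ k) => v a x s /andP[s0 s1].
pose u : R := `|v| + `|a|; rewrite -/u.
have u0 : 0 <= u by rewrite addr_ge0.
have vu : `|v| <= u by rewrite lerDl.
have au : `|a| <= u by rewrite lerDr.
have step : `|v * (x ^+ k.+1 - (x - s * a) ^+ k.+1)| <=
    s * (m * (u ^+ 2 * (`|x| + u) ^+ k)).
  rewrite normrM.
  have h : `|x ^+ k.+1 - (x - s * a) ^+ k.+1| <= (s * u) * (m * (`|x| + u) ^+ k).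
    apply: (le_trans (@normB_exp_le _ _ (`|x| + u) k _ _)).
    - by rewrite lerDl.
    - apply: (le_trans (ler_normB _ _)); rewrite lerD2l normrM (ger0_norm s0).
      by have := normr_ge0 a; nra.
    - apply: ler_wpM2r; first by rewrite mulr_ge0// exprn_ge0// addr_ge0.
      by rewrite opprB addrCA subrr addr0 normrM (ger0_norm s0) ler_wpM2l.
  have h' : `|v| * `|x ^+ k.+1 - (x - s * a) ^+ k.+1| <=
      u * ((s * u) * (m * (`|x| + u) ^+ k)) by apply: ler_pM.
  by apply: (le_trans h'); rewrite le_eqVlt; apply/orP; left; apply/eqP; ring.
apply: (le_trans step); apply: ler_wpM2l => //.
have [ux|ux] := leP u (e * `|x|).
  apply: (@le_trans _ _ (2^-1 * `|x| ^+ k.+2)); last first.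
    have m0 : 0 <= m by lra.
    rewrite lerDl; apply: mulr_ge0; last exact: exprn_ge0.
    apply: mulr_ge0 => //; apply: exprn_ge0; apply: addr_ge0 => //.
    by rewrite invr_ge0 ltW.
  have x0 := normr_ge0 x.
  have ux1 : u <= `|x| by nra.
  have -> : 2^-1 * `|x| ^+ k.+2 = m * ((e * (`|x| ^+ 2)) * (2 ^+ k * `|x| ^+ k)).
    by rewrite -ee !exprS; ring.
  apply: ler_wpM2l; first lra.
  apply: ler_pM; rewrite ?exprn_ge0// ?addr_ge0//.
    by rewrite expr2 (le_trans (ler_pM _ _ ux ux1))// expr2 mulrA.
  by rewrite -exprMn; apply: lerXn2r; rewrite ?nnegrE ?addr_ge0 ?mulr_ge0//; lra.
apply: (@le_trans _ _ (m * (e^-1 + 1) ^+ k * u ^+ k.+2)); last first.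
  by rewrite lerDr mulr_ge0// exprn_ge0.
have xu : `|x| <= e^-1 * u.
  by rewrite mulrC ler_pdivlMr// mulrC ltW.
have -> : m * (e^-1 + 1) ^+ k * u ^+ k.+2 = m * (u ^+ 2 * (((e^-1 + 1) * u) ^+ k)).
  by rewrite exprMn !exprS; ring.
apply: ler_wpM2l; first lra.
apply: ler_wpM2l; first by rewrite exprn_ge0.
apply: lerXn2r; rewrite ?nnegrE ?addr_ge0//.
  by rewrite mulr_ge0// addr_ge0// invr_ge0 ltW.
by rewrite mulrDl mul1r lerD2r.
Qed.

End real_bounds.

(** Moments of the centered normal law of variance [v]. *)
Fixpoint gaussian_moment {R : realType} (v : R) (k : nat) : R :=
  match k with
  | 0 => 1
  | 1 => 0
  | k'.+2 => k'.+1%:R * v * gaussian_moment v k'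
  end.

Section expansions.
Context {disp : measure_display} {T : measurableType disp} {R : realType}.
Variables (P : probability T R) (J : Type) (s : J -> R).
Hypothesis s1 : forall j, `|s j| <= 1.
Implicit Types X A B : J -> T -> R.
Local Notation bm := (bounded_moments P).

Let bms X A : bm X -> bm A -> bm (fun j w => X j w - s j * A j w).
Proof. by move=> bX bA; apply: bmB => //; exact: bmZ s1 bA. Qed.

(** First-order Taylor formula: the quotient by [s] keeps bounded moments. *)
Lemma increment1 X A k : bm X -> bm A -> exists2 Q, bm Q &
  forall j w, X j w ^+ k - (X j w - s j * A j w) ^+ k = s j * Q j w.
Proof.
move=> bX bA; elim: k => [|k [Q bQ IH]].
  by exists (fun _ _ => 0) => [|j w]; [exact: bm_const|rewrite subrr mulr0].
exists (fun j w => X j w * Q j w + A j w * (X j w - s j * A j w) ^+ k).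
  by apply: bmD; apply: bmM => //; apply: bmX; exact: bms.
move=> j w; rewrite mulrDr (mulrCA (s j) (X j w)) -IH.
by rewrite !exprS; ring.
Qed.

(** Second-order Taylor formula for the increment [A], whose main term is taken
    at the point [X - s * B]. When [B] is the sum over a larger neighbourhood than
    that of [A], this point is independent of [A]. *)
Lemma increment2 X A B k : bm X -> bm A -> bm B -> exists2 Q, bm Q &
  forall j w, X j w ^+ k.+1 - (X j w - s j * A j w) ^+ k.+1 -
    k.+1%:R * (s j * A j w) * (X j w - s j * B j w) ^+ k = s j ^+ 2 * Q j w.
Proof.
move=> bX bA bB; elim: k => [|k [Q bQ IH]].
  exists (fun _ _ => 0) => [|j w]; first exact: bm_const.
  by rewrite !expr1 expr0; ring.
have [Q1 bQ1 E1] := increment1 k.+1 bX bA.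
have [Q2 bQ2 E2] := increment1 k.+1 bX bB.
exists (fun j w => X j w * Q j w +
    k.+1%:R * (A j w * (B j w * (X j w - s j * B j w) ^+ k)) +
    A j w * (Q2 j w - Q1 j w)).
  apply: bmD; last by apply: bmM => //; exact: bmB.
  apply: bmD; first exact: bmM.
  apply: bmM; first exact: bm_const.
  by do 2 apply: bmM => //; apply: bmX; exact: bms.
move=> j w; have := IH j w; have := E1 j w; have := E2 j w.
rewrite -[k.+2%:R]natr1 -[X in X%:R + 1]/(k.+1).
set x := X j w; set a := s j * A j w; set b := s j * B j w.
move=> e2 e1 e.
have -> : s j ^+ 2 * (x * Q j w + k.+1%:R * (A j w * (B j w * (x - b) ^+ k)) +
    A j w * (Q2 j w - Q1 j w)) =
  x * (s j ^+ 2 * Q j w) + k.+1%:R * (a * (b * (x - b) ^+ k)) +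
  a * (s j * Q2 j w - s j * Q1 j w) by rewrite /a /b; ring.
rewrite -e -e1 -e2 !exprS; ring.
Qed.

End expansions.

Section moment_clt.
Context {disp : measure_display} {T : measurableType disp} {R : realType}.
Variables (P : probability T R) (V : nat * nat -> T -> R).
Variables (near1 near2 : rel nat) (K : nat).
Local Notation bm := (bounded_moments P).
Local Notation Ex := (Ex P).
Local Notation am := (all_moments P).

(** The neighbours of [x.2] in the row [x.1]; [far] is the rest of the row. *)
Definition window (near : rel nat) (x : nat * nat) (w : T) : R :=
  \sum_(j < x.1 | near x.2 j) V (x.1, val j) w.

Definition far (near : rel nat) (x : nat * nat) (w : T) : R :=
  \sum_(j < x.1 | ~~ near x.2 j) V (x.1, val j) w.

Hypothesis bV : bm V.
Hypothesis near1K : forall n i, (\sum_(j < n | near1 i j) 1 <= K)%N.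
Hypothesis near2K : forall n i, (\sum_(j < n | near2 i j) 1 <= K)%N.
Hypothesis far1 : forall n i k, (i < n)%N ->
  Ex (fun w => V (n, i) w * far near1 (n, i) w ^+ k) = 0.
Hypothesis far2 : forall n i j k, (i < n)%N -> (j < n)%N -> near1 i j ->
  Ex (fun w => V (n, i) w * V (n, j) w * far near2 (n, i) w ^+ k) =
  Ex (fun w => V (n, i) w * V (n, j) w) * Ex (fun w => far near2 (n, i) w ^+ k).

Definition scale (n : nat) : R := (Num.sqrt n%:R)^-1.

Definition normalized_sum (n : nat) (w : T) : R :=
  scale n * \sum_(j < n) V (n, val j) w.

Local Notation L := normalized_sum.

Lemma window_split (near : rel nat) n i w :
  L n w = scale n * window near (n, i) w + scale n * far near (n, i) w.
Proof.
rewrite -mulrDr; congr (_ * _).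
by rewrite (bigID (fun j : 'I_n => near i j)).
Qed.

Lemma scale_ge0 n : 0 <= scale n. Proof. by rewrite invr_ge0. Qed.

Lemma scale_le1 n : scale n <= 1.
Proof.
case: n => [|n]; first by rewrite /scale sqrtr0 invr0.
rewrite invf_le1; last by rewrite sqrtr_gt0 ltr0n.
by rewrite -{1}sqrtr1 ler_sqrt// ler1n.
Qed.

Lemma norm_scale_le1 n : `|scale n| <= 1.
Proof. by rewrite ger0_norm ?scale_ge0// scale_le1. Qed.

Lemma scale2 n : n%:R * scale n ^+ 2 <= 1.
Proof.
case: n => [|n]; first by rewrite mul0r.
by rewrite exprVn sqr_sqrtr// divff// pnatr_eq0.
Qed.

Lemma scale_cvg0 : scale n @[n --> \oo] --> 0.
Proof.
apply/cvgrPdist_lt => e e0; near=> n.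
rewrite sub0r normrN ger0_norm ?scale_ge0// /scale.
have n0 : (0 < n)%N by near: n; exists 1%N.
rewrite -[e]invrK ltf_pV2 ?posrE ?invr_gt0// ?sqrtr_gt0 ?ltr0n//.
rewrite -(@ger0_norm _ e^-1) ?invr_ge0 ?ltW// -sqrtr_sqr ltr_sqrt ?ltr0n//.
near: n; exact: nbhs_infty_gtr.
Unshelve. all: by end_near. Qed.

(** A window has at most [K] terms, so it is a sum of [K] families with bounded
    moments, padded by zeros. *)
Lemma bm_window (near : rel nat) : (forall n i, (\sum_(j < n | near i j) 1 <= K)%N) ->
  bm (window near).
Proof.
move=> hK.
pose t (x : nat * nat) := [seq j <- iota 0 x.1 | near x.2 j].
apply: (@bm_ext _ _ _ _ _ (fun x w => \sum_(c <- iota 0 K)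
    (if (c < size (t x))%N then V (x.1, nth 0%N (t x) c) else fun=> 0) w)).
  move=> [n i] w; rewrite /window.
  rewrite -(big_mkord (fun j => near i j) (fun j => V (n, j) w)).
  rewrite -big_filter /index_iota subn0 -/(t (n, i)).
  have tK : (size (t (n, i)) <= K)%N.
    have := hK n i; rewrite -(big_mkord (fun j => near i j) (fun j => 1%N)).
    by rewrite -big_filter sum1_size /index_iota subn0.
  rewrite -[K in iota _ K]subn0 -/(index_iota 0 K).
  rewrite (big_cat_nat (n := size (t (n, i))))//= [X in _ + X]big_nat_cond.
  rewrite [X in _ + X]big1 ?addr0 => [|c]; last first.
    by rewrite andbT => /andP[tc _]; rewrite ltnNge tc.
  rewrite [RHS](big_nth 0%N) [LHS]big_nat_cond [RHS]big_nat_cond.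
  by apply: eq_bigr => c; rewrite andbT => /andP[_ ->].
apply: bm_sum => c.
apply: bm_if; last exact: bm_const.
exact: (bm_comp (fun x => (x.1, nth 0%N (t x) c)) bV).
Qed.

Let bA := bm_window near1K.
Let bB := bm_window near2K.

Let bV1 n i : am (V (n, i)).
Proof. exact: bm_all_moments. Qed.

Let bmL1 n : am (L n).
Proof. by apply: amZ; apply: am_sum => i; exact: bV1. Qed.

Let power_expand n k : Ex (fun w => L n w ^+ k.+1) =
  \sum_(i < n) scale n * Ex (fun w => V (n, val i) w * L n w ^+ k).
Proof.
have aL (i : 'I_n) : am (fun w => V (n, val i) w * L n w ^+ k).
  by apply: amM; [exact: bV1|exact: amX].
under eq_bigr => i _ do rewrite -ExZ//.
rewrite -Ex_sum; last by move=> i; exact: amZ.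
by apply: eq_Ex => w; rewrite exprS {1}/normalized_sum -mulrA mulr_suml mulr_sumr.
Qed.

Let far_power (near : rel nat) n i k w :
  (L n w - scale n * window near (n, i) w) ^+ k =
  scale n ^+ k * far near (n, i) w ^+ k.
Proof. by rewrite (window_split near n i) addrAC subrr add0r exprMn. Qed.

Let bfar (near : rel nat) n i : am (far near (n, i)).
Proof. by apply: am_sum => j; exact: bV1. Qed.

(** Expand one factor of [Ex (L ^+ k)]; removing the window from the other factors
    costs nothing, since the far part gives [0], and [increment_young] bounds the
    difference by [scale n] times half of the moment itself plus a constant. Two
    factors [scale n] are summed over [n] terms, so that
    [X <= 2^-1 * X + C], where [X] is the moment. *)
Lemma bm_normalized_sum : bm L.
Proof.
apply: bm_of_Ex => [n k|k]; first exact: am_integrable (amX k (bmL1 n)).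
case: k => [|k].
  by exists 1 => n; rewrite (eq_Ex P (Y := fun=> 1)) ?Ex_cst// => w; rewrite expr0.
have [C hC] := @increment_young R k.*2.
have b : bm (fun x w => `|V x w| + `|window near1 x w|).
  by apply: bmD; apply: bm_norm => //; exact: bm_window.
have [M M0 hM] := bm_Ex_norm k.*2.+2 b.
exists (2 * (`|C| * M)) => n.
have -> : (k.+1 * 2 = k.*2.+2)%N by rewrite muln2 doubleS.
set X := Ex _.
suff : X <= 2^-1 * X + `|C| * M by lra.
rewrite {1}/X power_expand.
have bn i : am (fun w => V (n, i) w * L n w ^+ k.*2.+1) by apply: amM => //; exact: amX.
have bf i : am (fun w => V (n, i) w * far near1 (n, i) w ^+ k.*2.+1).
  by apply: amM => //; exact: amX.
have bw i : am (fun w => `|V (n, i) w| + `|window near1 (n, i) w|).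
  exact: (bm_all_moments (n, i) b).
have bL2 : am (fun w => 2^-1 * L n w ^+ k.*2.+2) by apply: amZ; exact: amX.
have bw2 i : am (fun w => `|C| * (`|V (n, i) w| + `|window near1 (n, i) w|) ^+ k.*2.+2).
  by apply: amZ; exact: amX (bw i).
have step (i : 'I_n) : Ex (fun w => V (n, val i) w * L n w ^+ k.*2.+1) <=
    scale n * (2^-1 * X + `|C| * M).
  (* subtracting the far part is free: it has expectation [0] by [far1] *)
  have -> : Ex (fun w => V (n, val i) w * L n w ^+ k.*2.+1) =
      Ex (fun w => V (n, val i) w * (L n w ^+ k.*2.+1 -
        (L n w - scale n * window near1 (n, val i) w) ^+ k.*2.+1)).
    rewrite -[LHS]subr0 -(mulr0 (scale n ^+ k.*2.+1)) -(far1 k.*2.+1 (ltn_ord i)).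
    rewrite -ExZ// -ExB//; last exact: amZ.
    by apply: eq_Ex => w; rewrite far_power; ring.
  apply: (@le_trans _ _ (Ex (fun w => scale n * (2^-1 * L n w ^+ k.*2.+2 +
      `|C| * (`|V (n, val i) w| + `|window near1 (n, val i) w|) ^+ k.*2.+2)))).
    apply: Ex_le.
    - apply: amM; first exact: bV1.
      apply: amB; first exact: amX.
      apply: (bm_ext (X := fun _ w => scale n ^+ k.*2.+1 * far near1 (n, val i) w ^+ k.*2.+1)).
        by move=> _ w; rewrite far_power.
      by apply: amZ; exact: amX.
    - by apply: amZ; exact: amD.
    - move=> w; apply: (le_trans (ler_norm _)).
      apply: (le_trans (hC _ _ _ _ _)); first by rewrite scale_ge0 scale_le1.
      apply: ler_wpM2l; first exact: scale_ge0.
      have -> : `|L n w| ^+ k.*2.+2 = L n w ^+ k.*2.+2.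
        by rewrite -[k.*2.+2]/(k.+1.*2) -mul2n !exprM real_normK ?num_real.
      by rewrite lerD2l ler_wpM2r ?ler_norm// exprn_ge0// addr_ge0.
  rewrite ExZ; last exact: amD.
  apply: ler_wpM2l; first exact: scale_ge0.
  rewrite ExD// ExZ; last exact: amX.
  rewrite lerD2l ExZ; last exact: amX (bw i).
  rewrite ler_wpM2l//.
  apply: le_trans (hM (n, val i)); rewrite le_eqVlt; apply/orP; left; apply/eqP.
  by apply: eq_Ex => w; rewrite (@ger0_norm _ (_ + _)) ?addr_ge0.
have Z0 : 0 <= 2^-1 * X + `|C| * M.
  rewrite addr_ge0 ?mulr_ge0// Ex_ge0// => w.
  by rewrite -[k.*2.+2]/(k.+1.*2) -mul2n exprM exprn_ge0// sqr_ge0.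
apply: (@le_trans _ _ (\sum_(i < n) scale n ^+ 2 * (2^-1 * X + `|C| * M))).
  apply: ler_sum => i _; rewrite expr2 -mulrA; apply: ler_wpM2l => //.
  exact: scale_ge0.
rewrite sumr_const card_ord -[leLHS]mulr_natl mulrA; apply: ler_piMl => //.
exact: scale2.
Qed.

Let bVA n i : am (fun w => V (n, i) w * window near1 (n, i) w).
Proof. by apply: amM (bV1 _ _) _; exact: (bm_all_moments (n, i) bA). Qed.

Lemma variance_normalized_sum n : Ex (fun w => L n w ^+ 2) =
  \sum_(i < n) scale n ^+ 2 * Ex (fun w => V (n, val i) w * window near1 (n, val i) w).
Proof.
rewrite power_expand; apply: eq_bigr => i _; rewrite expr2 -mulrA; congr (_ * _).
have bVF : am (fun w => V (n, val i) w * far near1 (n, val i) w ^+ 1).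
  by apply: amM => //; exact: amX.
rewrite -[RHS]addr0 -(mulr0 (scale n)) -(far1 1 (ltn_ord i)).
rewrite -!ExZ// -ExD; [|exact: amZ..].
by apply: eq_Ex => w; rewrite (window_split near1 n (val i)) !expr1; ring.
Qed.

(** Stein's identity with an error. In [V i * L ^+ k.+1] the far part alone
    contributes [0] ([far1]); the linear term in the near part factors by
    [far2]; the remainders carry a third factor [scale n], and there are [n] of
    them. *)
Lemma stein_recursion k : (fun n => Ex (fun w => L n w ^+ k.+2) -
  k.+1%:R * Ex (fun w => L n w ^+ 2) * Ex (fun w => L n w ^+ k)) @ \oo --> 0.
Proof.
have bL : bm (fun x : nat * nat => L x.1) := bm_comp fst bm_normalized_sum.
have s1 (x : nat * nat) : `|scale x.1| <= 1 by exact: norm_scale_le1.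
have [Q bQ EQ] := increment2 s1 k bL bA bB.
have [Q' bQ' EQ'] := increment1 s1 k bL bB.
have bVA2 : bm (fun x w => V x w * window near1 x w) by exact: bmM.
have bVQ : bm (fun x w => V x w * Q x w) by exact: bmM.
have [K1 K10 hK1] := bm_Ex bVA2.
have [K2 K20 hK2] := bm_Ex bQ'.
have [K3 K30 hK3] := bm_Ex bVQ.
have key n : Ex (fun w => L n w ^+ k.+2) -
    k.+1%:R * Ex (fun w => L n w ^+ 2) * Ex (fun w => L n w ^+ k) =
    \sum_(i < n) scale n ^+ 3 * (Ex (fun w => V (n, val i) w * Q (n, val i) w) -
      k.+1%:R * Ex (fun w => V (n, val i) w * window near1 (n, val i) w) *
      Ex (Q' (n, val i))).
  rewrite power_expand variance_normalized_sum mulr_sumr mulr_suml -sumrB.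
  apply: eq_bigr => i _; set x := (n, val i).
  have aVQ : am (fun w => V x w * Q x w) by exact: (bm_all_moments x bVQ).
  have aVA := bVA n (val i); rewrite -/x in aVA.
  have aF : am (fun w => far near2 x w ^+ k) by exact: amX (bfar _ _ _).
  have aV : am (V x) by exact: bV1.
  have aFV : am (fun w => V x w * far near1 x w ^+ k.+1).
    exact: amM aV (amX _ (bfar _ _ _)).
  (* [far2], summed over the neighbours *)
  have sum_far2 : Ex (fun w => V x w * window near1 x w * far near2 x w ^+ k) =
      Ex (fun w => V x w * window near1 x w) * Ex (fun w => far near2 x w ^+ k).
    rewrite (eq_Ex P (Y := fun w => \sum_(j < n | near1 (val i) j)
        V x w * V (n, val j) w * far near2 x w ^+ k)); last first.
      by move=> w; rewrite /window mulr_sumr mulr_suml.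
    rewrite Ex_sum; last by move=> j; apply: amM => //; exact: amM.
    rewrite (eq_Ex P (X := fun w => V x w * window near1 x w)
      (Y := fun w => \sum_(j < n | near1 (val i) j) V x w * V (n, val j) w)); last first.
      by move=> w; rewrite /window mulr_sumr.
    rewrite Ex_sum; last by move=> j; exact: amM.
    by rewrite mulr_suml; apply: eq_bigr => j ij; exact: (far2 k (ltn_ord i) (ltn_ord j) ij).
  have aVAF : am (fun w => V x w * window near1 x w * far near2 x w ^+ k) by exact: amM.
  (* the zeroth-order term is subtracted by [far1], the first-order one factors *)
  have EL : Ex (fun w => V x w * L n w ^+ k.+1) =
      k.+1%:R * scale n * (Ex (fun w => V x w * window near1 x w) *
        (scale n ^+ k * Ex (fun w => far near2 x w ^+ k))) +
      scale n ^+ 2 * Ex (fun w => V x w * Q x w).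
    rewrite (mulrCA _ (scale n ^+ k)) -sum_far2 mulrA.
    rewrite -[LHS]subr0 -(mulr0 (scale n ^+ k.+1)) -(far1 k.+1 (ltn_ord i)) -/x.
    rewrite -!ExZ// -ExB; [|by apply: amM => //; exact: amX|exact: amZ].
    rewrite -ExD; [|exact: amZ..].
    apply: eq_Ex => w; have := EQ x w; rewrite /= !far_power => e.
    rewrite (mulrCA _ (V x w) (Q x w)) -e; ring.
  have EF : scale n ^+ k * Ex (fun w => far near2 x w ^+ k) =
      Ex (fun w => L n w ^+ k) - scale n * Ex (Q' x).
    rewrite -!ExZ//; last exact: (bm_all_moments x bQ').
    rewrite -ExB; [|exact: amX|by apply: amZ; exact: (bm_all_moments x bQ')].
    apply: eq_Ex => w; have := EQ' x w; rewrite /= far_power => <-; ring.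
  by rewrite EL EF; ring.
pose Z := K3 + k.+1%:R * K1 * K2.
have bound n : `|Ex (fun w => L n w ^+ k.+2) -
    k.+1%:R * Ex (fun w => L n w ^+ 2) * Ex (fun w => L n w ^+ k)| <= scale n * Z.
  have Z0 : 0 <= Z by rewrite addr_ge0// !mulr_ge0.
  rewrite key; apply: (le_trans (ler_norm_sum _ _ _)).
  apply: (@le_trans _ _ (\sum_(i < n) scale n ^+ 2 * (scale n * Z))).
    apply: ler_sum => i _; rewrite normrM ger0_norm ?exprn_ge0 ?scale_ge0//.
    rewrite mulrA -exprSr; apply: ler_wpM2l; first by rewrite exprn_ge0 ?scale_ge0.
    apply: (le_trans (ler_normB _ _)); apply: lerD; first exact: hK3.
    rewrite !normrM normr_nat; apply: ler_pM => //.
    by apply: ler_wpM2l => //; exact: hK1.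
  rewrite sumr_const card_ord -[leLHS]mulr_natl mulrA; apply: ler_piMl; last exact: scale2.
  by rewrite mulr_ge0// scale_ge0.
apply/norm_cvg0P; apply: (@squeeze_cvgr _ _ _ _ (fun=> 0) (fun n => scale n * Z)).
- by apply: nearW => n; rewrite normr_ge0 bound.
- exact: cvg_cst.
- rewrite -[X in _ --> X](mul0r Z); apply: cvgM; [exact: scale_cvg0|exact: cvg_cst].
Qed.

Lemma moment_clt v : (fun n => Ex (fun w => L n w ^+ 2)) @ \oo --> v ->
  forall k, (fun n => Ex (fun w => L n w ^+ k)) @ \oo --> gaussian_moment v k.
Proof.
move=> Lv k; elim/ltn_ind: k => -[|[|k]] IH /=.
- rewrite (_ : (fun _ => _) = fun=> 1); first exact: cvg_cst.
  by apply/funext => n; rewrite (eq_Ex P (Y := fun=> 1)) ?Ex_cst// => w; rewrite expr0.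
- rewrite (_ : (fun _ => _) = fun=> 0); first exact: cvg_cst.
  apply/funext => n; rewrite power_expand big1// => i _.
  rewrite (eq_Ex P (Y := fun w => V (n, val i) w * far near1 (n, val i) w ^+ 0)).
    by rewrite (far1 0 (ltn_ord i)) ?mulr0.
  by move=> w; rewrite !expr0.
- have Lk : (fun n => k.+1%:R * Ex (fun w => L n w ^+ 2) * Ex (fun w => L n w ^+ k))
      @ \oo --> k.+1%:R * v * gaussian_moment v k.
    by apply: cvgM; [apply: cvgM => //; exact: cvg_cst|exact: IH].
  rewrite -[X in _ --> X]add0r.
  rewrite (_ : (fun _ => _) = fun n => (Ex (fun w => L n w ^+ k.+2) -
      k.+1%:R * Ex (fun w => L n w ^+ 2) * Ex (fun w => L n w ^+ k)) +
      k.+1%:R * Ex (fun w => L n w ^+ 2) * Ex (fun w => L n w ^+ k)).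
    exact: cvgD (stein_recursion k) Lk.
  by apply/funext => n; rewrite subrK.
Qed.

End moment_clt.

(** * Two independent uniform variables from the binary digits of one *)

Section rays.
Context {R : realType}.

(** Rays to the right form a pi-system that generates the Borel sets. *)
Lemma measure_rays_unique (m1 m2 : {measure set R -> \bar R}) :
  (m1 setT < +oo)%E ->
  (forall a : R, m1 `]a, +oo[%classic = m2 `]a, +oo[%classic) ->
  forall A : set R, measurable A -> m1 A = m2 A.
Proof.
move=> m1T m12 A mA.
apply: (@measure_unique _ R R (@RGenOInfty.G R)
  (fun n => `](- n%:R : R), +oo[%classic)) => //.
- exact: RGenOInfty.measurableE.
- move=> _ _ [x ->] [y ->]; exists (Num.max x y).
  apply/seteqP; split=> z; rewrite /= !in_itv/= !andbT gt_max; first by case=> -> ->.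
  by move=> /andP[].
- by move=> n; exists (- n%:R).
- rewrite -subTset => x _; exists (Num.truncn `|x|).+1 => //=.
  rewrite in_itv/= andbT ltrNl; apply: le_lt_trans (truncnS_gt `|x|).
  by rewrite -normrN ler_norm.
- by move=> _ [a ->]; exact: m12.
- by move=> n; apply: le_lt_trans m1T; apply: le_measure; rewrite ?inE.
Qed.

Context {disp : measure_display} {T : measurableType disp}.
Variable P : probability T R.

Lemma product_rule_rays (U : {RV P >-> R}) (C : set T) : measurable C ->
  (forall a, P (U @^-1` `]a, +oo[%classic `&` C) =
             (P (U @^-1` `]a, +oo[%classic) * P C)%E) ->
  forall A, measurable A -> P (U @^-1` A `&` C) = (P (U @^-1` A) * P C)%E.
Proof.
move=> mC UC A mA.
have r0 : 0 <= fine (P C) by apply: fine_ge0.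
have PC : P C = (fine (P C))%:E by rewrite fineK// fin_num_measure.
have mU : measurable_fun setT U by exact: measurable_funPT.
pose m1 : {measure set R -> \bar R} :=
  measure_function_pushforward__canonical__measure_function_Measure (mrestr P mC) mU.
pose m2 := mscale (NngNum r0) (distribution P U).
have m2E D : m2 D = (P (U @^-1` D) * P C)%E by rewrite /m2 /mscale/= -PC muleC.
rewrite -m2E; apply: (@measure_rays_unique m1 m2) => // [|a].
  by rewrite /= /pushforward /mrestr preimage_setT setTI -ge0_fin_numE// fin_num_measure.
by rewrite [RHS]m2E; exact: UC.
Qed.

Lemma indep_of_rays (U V : {RV P >-> R}) :
  (forall a b, P (U @^-1` `]a, +oo[%classic `&` V @^-1` `]b, +oo[%classic) =
    (P (U @^-1` `]a, +oo[%classic) * P (V @^-1` `]b, +oo[%classic))%E) ->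
  forall A B, measurable A -> measurable B ->
  P (U @^-1` A `&` V @^-1` B) = (P (U @^-1` A) * P (V @^-1` B))%E.
Proof.
move=> UV A B mA mB.
have mpre (W : {RV P >-> R}) (D : set R) : measurable D -> measurable (W @^-1` D).
  by move=> mD; rewrite -[X in measurable X]setTI; exact: measurable_funPT.
apply: product_rule_rays => // [|a]; first exact: mpre.
rewrite setIC muleC; apply: product_rule_rays => // [|b].
  by apply: mpre; exact: measurable_itv.
by rewrite setIC muleC UV.
Qed.

End rays.

Section binary_digits.
Context {R : realType}.

(* [R] and [measurableTypeR R] have the same measurable sets, on different
   structures. *)
Lemma idR_measurable : @measurable_fun _ _ (measurableTypeR R) R setT idfun.
Proof. by move=> _ A mA; rewrite setTI. Qed.

Definition on_R (P : probability (measurableTypeR R) R) : probability R R :=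
  distribution P (@mfun_Sub _ _ (measurableTypeR R) R idfun (mem_set idR_measurable)).

(** The uniform law lives on [measurableTypeR R]; [on_R] moves it to [R] itself,
    the space of values of random variables. *)
Definition unit_law : probability R R := on_R (uniform_prob (@ltr01 R)).
Local Notation mu := unit_law.

Lemma unit_law_ray (a : R) :
  mu `]a, +oo[%classic = (1 - Num.max 0 (Num.min a 1))%:E.
Proof.
rewrite (_ : mu _ = uniform_prob (@ltr01 R) `]a, +oo[%classic)//.
rewrite /uniform_prob integral_uniform_pdf.
rewrite (eq_integral (cst 1%:E)); last first.
  move=> x; rewrite inE/= => -[_]; rewrite /= in_itv/= /uniform_pdf => ->.
  by rewrite subr0 invr1.
rewrite integral_cst//=; last exact: measurableI.
rewrite mul1e.
have [a0|a0] := ltP a 0.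
  rewrite (_ : _ `&` _ = `[0, 1]%classic); last first.
    apply/seteqP; split=> x; rewrite /= !in_itv/= ?andbT; first by case.
    by move=> /[dup] h /andP[x0 _]; split=> //; exact: lt_le_trans x0.
  rewrite lebesgue_measure_itv/= lte01 oppr0 adde0.
  by rewrite min_l ?max_l ?subr0//; lra.
have [a1|a1] := ltP a 1.
  rewrite (_ : _ `&` _ = `]a, 1]%classic); last first.
    apply/seteqP; split=> x; rewrite /= !in_itv/= ?andbT; first by case=> -> /andP[].
    by move=> /andP[ax ->]; rewrite ax (le_trans a0 (ltW ax)).
  by rewrite lebesgue_measure_itv/= lte_fin a1 -EFinB (max_r a0).
rewrite (_ : _ `&` _ = set0) ?measure0 ?max_r// ?subrr//.
apply/seteqP; split=> x //; rewrite /= !in_itv/= ?andbT => -[ax /andP[_ x1]].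
by have := lt_le_trans ax x1; lra.
Qed.

Definition bit (x : R) : bool := 2^-1 < x.
Definition tail (x : R) : R := 2 * x - (bit x)%:R.

Let mlow : measurable [set x : R | x <= 2^-1].
Proof.
by rewrite (_ : [set _ | _] = `]-oo, 2^-1]%classic)//; apply/seteqP; split=> x; rewrite /= in_itv.
Qed.

Let mhigh : measurable [set x : R | 2^-1 < x].
Proof.
by rewrite (_ : [set _ | _] = `]2^-1, +oo[%classic)//; apply/seteqP; split=> x; rewrite /= in_itv/= andbT.
Qed.

Let half : {nonneg R} := (2^-1 : R)%:nng.

Let affine_measurable (c : R) : measurable_fun setT (fun x : R => 2 * x - c).
Proof. by apply: measurable_funB => //; exact: measurable_funM. Qed.

Let half_measure (C : set R) (c : R) (mC : measurable C) :
  (forall a, mu ([set x | a < 2 * x - c] `&` C) = ((2^-1)%:E * mu `]a, +oo[%classic)%E) ->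
  forall A, measurable A -> mu ((fun x => 2 * x - c) @^-1` A `&` C) = ((2^-1)%:E * mu A)%E.
Proof.
move=> h A mA.
pose m1 : {measure set R -> \bar R} :=
  measure_function_pushforward__canonical__measure_function_Measure (mrestr mu mC)
    (affine_measurable c).
pose m2 := mscale half mu.
apply: (@measure_rays_unique R m1 m2) => // [|a].
  by rewrite /= /pushforward /mrestr preimage_setT setTI -ge0_fin_numE// fin_num_measure.
transitivity (mu ([set x | a < 2 * x - c] `&` C)); last exact: h.
congr (mu (_ `&` _)); apply/seteqP; split=> x; by rewrite /= in_itv/= andbT.
Qed.

(** The first digit is fair and independent of the tail, which is again uniform. *)
Lemma bit_split (C : bool -> set R) : (forall b, measurable (C b)) ->
  mu [set x | C (bit x) (tail x)] =
  ((2^-1)%:E * mu (C false) + (2^-1)%:E * mu (C true))%E.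
Proof.
move=> mC.
rewrite -(half_measure (c := 0) mlow)//; last first.
  move=> a.
  have [a1|a1] := leP a 1; last first.
    rewrite (_ : _ `&` _ = set0); last first.
      by apply/seteqP; split=> x //= [] /=; lra.
    rewrite measure0 unit_law_ray; apply/esym; rewrite -EFinM; congr (_%:E).
    by rewrite (min_r (ltW a1)) max_r ?ler01// subrr mulr0.
  rewrite (_ : _ `&` _ = `]2^-1 * a, +oo[%classic `\` `]2^-1, +oo[%classic); last first.
    apply/seteqP; split=> x /=; rewrite !in_itv/= !andbT => -[h1 h2].
      by split; [lra|apply/negP; rewrite -leNgt].
    by split; [lra|rewrite leNgt; exact/negP].
  rewrite measureD//; last by rewrite -ge0_fin_numE// fin_num_measure.
  rewrite setIidr; last by move=> x /=; rewrite !in_itv/= !andbT; lra.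
  transitivity ((1 - Num.max 0 (Num.min (2^-1 * a) 1))%:E -
                (1 - Num.max 0 (Num.min 2^-1 1))%:E : \bar R)%E.
    by congr (_ - _)%E; exact: unit_law_ray.
  rewrite unit_law_ray -EFinB -EFinM; congr (_%:E).
  rewrite (@min_l _ _ (2^-1 * a)) ?(@min_l _ _ 2^-1) ?(min_l a1) ?(@max_r _ _ 0 2^-1); try lra.
  by have [a0|a0] := leP 0 a; [rewrite !max_r|rewrite !max_l]; lra.
rewrite -(half_measure (c := 1) mhigh)//; last first.
  move=> a.
  rewrite (_ : _ `&` _ = `]Num.max 2^-1 (2^-1 * (a + 1)), +oo[%classic); last first.
    apply/seteqP; split=> x /=; rewrite !in_itv/= !andbT gt_max.
      by move=> [h1 ->]; lra.
    by move=> /andP[-> h]; split=> //; lra.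
  rewrite !unit_law_ray -EFinM; congr (_%:E).
  have [a0|a0] := leP a 0.
    rewrite (@max_l _ _ 2^-1) ?(@max_l _ _ 0 (Num.min a 1)) ?(@min_l _ _ 2^-1) ?max_r ?ge_min ?a0//; lra.
  rewrite (@max_r _ _ 2^-1); last lra.
  have [a1|a1] := leP a 1.
    by rewrite (@min_l _ _ (2^-1 * _)) ?(min_l a1) ?max_r; lra.
  by rewrite (@min_r _ _ (2^-1 * _)) ?(min_r (ltW a1)) ?max_r; lra.
rewrite -measureU//.
- congr (mu _); apply/seteqP; split=> x /=.
    rewrite /tail; case E : (bit x) => Cx; [right|left]; split=> //.
    by move/negbT: E; rewrite /bit -leNgt.
  by rewrite /tail /bit => -[[Cx h]|[Cx h]]; [rewrite ltNge h|rewrite h].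
- apply: measurableI => //; rewrite -[X in measurable X]setTI; exact: affine_measurable.
- apply: measurableI => //; rewrite -[X in measurable X]setTI; exact: affine_measurable.
- by apply/seteqP; split=> x //= [[_ h] [_]]; rewrite ltNge h.
Qed.

Lemma bit_measurable : measurable_fun setT (fun x : R => (bit x)%:R : R).
Proof.
rewrite (_ : (fun _ => _) = fun x : R => if 2^-1 < x then 1 else 0).
  by apply: measurable_fun_ifT => //; exact: measurable_fun_ltr.
by apply/funext => x; rewrite /bit; case: ltP.
Qed.

Lemma tail_measurable : measurable_fun setT tail.
Proof. by apply: measurable_funB; [exact: measurable_funM|exact: bit_measurable]. Qed.

(** [trunc n x] keeps the first [n] binary digits of [x], and [evens n x] is the
    number whose first [n] digits are those of [x] at even places. *)
Fixpoint trunc (n : nat) (x : R) : R :=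
  if n is n'.+1 then 2^-1 * ((bit x)%:R + trunc n' (tail x)) else 0.

Fixpoint evens (n : nat) (x : R) : R :=
  if n is n'.+1 then 2^-1 * ((bit x)%:R + evens n' (tail (tail x))) else 0.

Lemma trunc_measurable n : measurable_fun setT (trunc n).
Proof.
elim: n => [|n IH]; first exact: measurable_cst.
apply: measurable_funM => //; apply: measurable_funD; first exact: bit_measurable.
exact: measurableT_comp tail_measurable.
Qed.

Lemma evens_measurable n : measurable_fun setT (evens n).
Proof.
elim: n => [|n IH]; first exact: measurable_cst.
apply: measurable_funM => //; apply: measurable_funD; first exact: bit_measurable.
by apply: measurableT_comp => //; exact: measurableT_comp tail_measurable tail_measurable.
Qed.

Let mpre (f : R -> R) (A : set R) : measurable_fun setT f -> measurable A ->
  measurable [set x | A (f x)].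
Proof. by move=> mf mA; rewrite -[X in measurable X]setTI; exact: mf. Qed.

Let p (A : set R) : R := fine (mu A).

Let pE A : measurable A -> mu A = (p A)%:E.
Proof. by move=> mA; rewrite /p fineK// fin_num_measure. Qed.

Let p_split (C : bool -> set R) : (forall b, measurable (C b)) ->
  p [set x | C (bit x) (tail x)] = 2^-1 * p (C false) + 2^-1 * p (C true).
Proof. by move=> mC; rewrite /p bit_split// !pE. Qed.

(** By induction, with [bit_split]: the first two digits of [x]
    are independent fair bits, one for each of the two numbers. *)
Lemma evens_trunc n (A B : set R) : measurable A -> measurable B ->
  mu [set x | A (evens n x) /\ B (evens n (tail x))] =
  (mu [set x | A (trunc n x)] * mu [set x | B (trunc n x)])%E.
Proof.
move=> mA mB.
have mEO k C D : measurable C -> measurable D ->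
    measurable [set x | C (evens k x) /\ D (evens k (tail x))].
  move=> mC mD; apply: (measurableI _ _ (mpre (evens_measurable k) mC)).
  exact: mpre (measurableT_comp (evens_measurable k) tail_measurable) mD.
have mT k C : measurable C -> measurable [set x | C (trunc k x)].
  by move=> mC; exact: mpre (trunc_measurable k) mC.
rewrite !pE//; try exact: mT; try exact: mEO.
rewrite -EFinM; congr (_%:E).
elim: n A B mA mB => [|n IH] A B mA mB.
  rewrite /=; have pc (Q : Prop) : p [set _ | Q] = (`[<Q>])%:R.
    rewrite /p; case: (pselect Q) => q.
      rewrite (_ : [set _ | Q] = setT); last by apply/seteqP; split.
      by rewrite asboolT// probability_setT.
    rewrite (_ : [set _ | Q] = set0); last by apply/seteqP; split.
    by rewrite asboolF// measure0.
  by rewrite !pc asbool_and; case: asboolP; case: asboolP; rewrite /= ?mulr1 ?mulr0 ?mul0r.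
pose sh (C : set R) (b : bool) := [set y : R | C (2^-1 * (b%:R + y))].
have msh C b : measurable C -> measurable (sh C b).
  move=> mC; apply: (mpre _ mC).
  by apply: measurable_funM => //; exact: measurable_funD.
have pT C : measurable C -> p [set x | C (trunc n.+1 x)] =
    2^-1 * p [set x | sh C false (trunc n x)] + 2^-1 * p [set x | sh C true (trunc n x)].
  by move=> mC; rewrite -(p_split (C := fun b => [set x | sh C b (trunc n x)]))// => b; apply: mT; exact: msh.
rewrite !pT//.
pose EO b b' := [set y | sh A b (evens n y) /\ sh B b' (evens n (tail y))].
have mEO' b b' : measurable (EO b b') by apply: mEO; exact: msh.
rewrite (p_split (C := fun b => [set x | EO b (bit x) (tail x)])); last first.
  move=> b; rewrite (_ : [set _ | _] =
    [set x | EO b true (tail x)] `&` [set x | bit x] `|`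
    [set x | EO b false (tail x)] `&` [set x | ~~ bit x]).
    apply: measurableU; apply: measurableI.
    - exact: mpre tail_measurable (mEO' _ _).
    - exact: mhigh.
    - exact: mpre tail_measurable (mEO' _ _).
    - rewrite (_ : [set x | ~~ bit x] = [set x : R | x <= 2^-1]); first exact: mlow.
      by apply/seteqP; split=> x /=; rewrite /bit -leNgt.
  apply/seteqP; split=> x /=; case: (bit x) => //.
  - by left.
  - by right.
  - by case=> [[]|[]].
  - by case=> [[]|[]].
rewrite !(p_split (C := fun b => EO _ b))//.
rewrite /EO !IH; try exact: msh.
ring.
Qed.

Lemma evens_nd x : nondecreasing_seq (evens ^~ x).
Proof.
apply/nondecreasing_seqP => n; elim: n x => [|n IH] x /=.
  by rewrite addr0 mulr_ge0.
by rewrite ler_pM2l// lerD2l; exact: IH.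
Qed.

Lemma trunc_nd x : nondecreasing_seq (trunc ^~ x).
Proof.
apply/nondecreasing_seqP => n; elim: n x => [|n IH] x /=.
  by rewrite addr0 mulr_ge0.
by rewrite ler_pM2l// lerD2l; exact: IH.
Qed.

Let evens_ub x : has_ubound (range (evens ^~ x)).
Proof.
exists 1 => _ [n _ <-]; elim: n x => [|n IH] x //=.
have := IH (tail (tail x)).
have : (bit x)%:R <= 1 :> R by case: (bit x); rewrite ?ler01.
lra.
Qed.

Definition even_digits (x : R) : R := sups (evens ^~ x) 0.

Lemma even_digits_measurable : measurable_fun setT even_digits.
Proof.
apply: (@measurable_fun_sups _ _ _ setT evens 0) => [x _|n]; first exact: evens_ub.
exact: evens_measurable.
Qed.

Lemma even_digits_gt a x : (a < even_digits x) <-> exists n, a < evens n x.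
Proof.
have := @sups_preimage _ _ setT a evens 0 (fun x _ => evens_ub x).
rewrite !setTI => h; split.
  move=> ax; have : ((fun x => sups (evens ^~ x) 0) @^-1` `]a, +oo[%classic) x.
    by rewrite /= in_itv/= andbT.
  by rewrite h => -[n _] /=; rewrite in_itv/= andbT; exists n.
move=> [n an]; have : (\bigcup_(k in [set k | (0 <= k)%N]) evens k @^-1` `]a, +oo[%classic) x.
  by exists n => //=; rewrite in_itv/= andbT.
by rewrite -h /= in_itv/= andbT.
Qed.

Let trunc_approx n x : 0 <= x <= 1 -> trunc n x <= x <= trunc n x + 2^-1 ^+ n.
Proof.
elim: n x => [|n IH] x x01 /=; first by rewrite expr0 add0r.
have /IH : 0 <= tail x <= 1.
  rewrite /tail /bit; case: ltP => /= h; rewrite ?subr0; lra.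
rewrite exprS /tail; lra.
Qed.

Let trunc_gt a x : 0 <= x <= 1 -> (a < x) <-> exists n, a < trunc n x.
Proof.
move=> x01; split=> [ax|[n an]]; last first.
  by apply: (lt_le_trans an); have /andP[] := trunc_approx n x01.
have [n hn] : exists n, 2^-1 ^+ n < x - a.
  have /cvgrPdist_lt/(_ (x - a)) : (fun n => 2^-1 ^+ n : R) @ \oo --> 0.
    by apply: cvg_expr; rewrite ger0_norm//; lra.
  rewrite subr_gt0 => /(_ ax) [n _ /(_ n (leqnn n))].
  by rewrite /= sub0r normrN ger0_norm ?exprn_ge0//; exists n.
exists n; have /andP[_] := trunc_approx n x01; lra.
Qed.

Lemma unit_lawI (A : set R) : mu A = mu (A `&` `[0, 1]%classic).
Proof.
transitivity (uniform_prob (@ltr01 R) A) => //.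
rewrite /uniform_prob integral_uniform_pdf.
by [].
Qed.

Let p_cvg (F : nat -> set R) : (forall n, measurable (F n)) ->
  nondecreasing_seq F -> (fun n => p (F n)) @ \oo --> p (\bigcup_n F n).
Proof.
move=> mF ndF; apply: fine_cvg; rewrite -/(p _) -pE; last exact: bigcupT_measurable.
by apply: nondecreasing_cvg_mu => //; exact: bigcupT_measurable.
Qed.

Let ray_measurable (f : R -> R) a : measurable_fun setT f -> measurable [set x | a < f x].
Proof.
move=> mf; rewrite (_ : [set _ | _] = [set x | `]a, +oo[%classic (f x)]).
  by apply: mpre => //; exact: measurable_itv.
by apply/seteqP; split=> x; rewrite /= in_itv/= andbT.
Qed.

Let p_trunc a : (fun n => p [set x | a < trunc n x]) @ \oo --> p `]a, +oo[%classic.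
Proof.
have -> : p `]a, +oo[%classic = p (\bigcup_n [set x | a < trunc n x]).
  rewrite /p (unit_lawI `]a, +oo[%classic) [in RHS]unit_lawI; congr (fine (mu _)).
  apply/seteqP; split=> x [/=]; rewrite !in_itv/= ?andbT.
    by move=> /[swap] x01 /(trunc_gt a x01)[n an]; split => //; exists n.
  by move=> [n _ an] x01; split=> //; apply/(trunc_gt a x01); exists n.
apply: p_cvg => [n|m n mn]; first exact: ray_measurable (trunc_measurable n).
apply/subsetPset => x /= /lt_le_trans; apply; exact: trunc_nd.
Qed.

(** The two truncations are independent with the law of [trunc n]; both sides pass to
    the limit along increasing events, because [trunc n] increases to the identity. *)
Lemma digits_rays a b :
  mu [set x | a < even_digits x /\ b < even_digits (tail x)] =
  (mu `]a, +oo[%classic * mu `]b, +oo[%classic)%E.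
Proof.
pose F n := [set x | a < evens n x /\ b < evens n (tail x)].
have mF n : measurable (F n).
  apply: (@measurableI _ _ [set x | a < evens n x] [set x | b < evens n (tail x)]).
    exact: ray_measurable (evens_measurable n).
  by apply: ray_measurable; exact: measurableT_comp (evens_measurable n) tail_measurable.
have -> : [set x | a < even_digits x /\ b < even_digits (tail x)] = \bigcup_n F n.
  apply/seteqP; split=> x /=.
    move=> [/even_digits_gt[m am] /even_digits_gt[n bn]]; exists (maxn m n) => //; split.
      by apply: (lt_le_trans am); apply: evens_nd; exact: leq_maxl.
    by apply: (lt_le_trans bn); apply: evens_nd; exact: leq_maxr.
  by move=> [n _ [an bn]]; split; apply/even_digits_gt; exists n.
rewrite !pE//; last exact: bigcupT_measurable.
rewrite -EFinM; congr (_%:E).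
have h1 : (fun n => p (F n)) @ \oo --> p (\bigcup_n F n).
  apply: p_cvg => // m n mn; apply/subsetPset => x [am bm]; split.
    by apply: (lt_le_trans am); exact: evens_nd.
  by apply: (lt_le_trans bm); exact: evens_nd.
have h2 := cvgM (@p_trunc a) (@p_trunc b).
suff E : (fun n => p (F n)) =
    (fun n => p [set x | a < trunc n x] * p [set x | b < trunc n x]).
  have h2' : (fun n => p (F n)) @ \oo --> p `]a, +oo[%classic * p `]b, +oo[%classic.
    by rewrite E; exact: h2.
  by apply: (cvg_unique _ h1).
apply/funext => n; have := @evens_trunc n _ _ (@measurable_itv R `]a, +oo[) (@measurable_itv R `]b, +oo[).
have e (f : R -> R) c : [set x | `]c, +oo[%classic (f x)] = [set x | c < f x].
  by apply/seteqP; split=> x; rewrite /= in_itv/= andbT.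
rewrite !e => h.
set A := [set x | a < trunc n x]; set B := [set x | b < trunc n x].
have {}h : p (F n) = fine (mu A * mu B)%E by exact: congr1 h.
rewrite h.
by rewrite fineM ?fin_num_measure//; exact: ray_measurable (trunc_measurable n).
Qed.

Definition digits0 : {RV mu >-> R} := mfun_Sub (mem_set even_digits_measurable).
Definition digits1 : {RV mu >-> R} :=
  mfun_Sub (mem_set (measurableT_comp even_digits_measurable tail_measurable)).

Let mu_ray_neg : mu `](-1), +oo[%classic = 1%E.
Proof. by rewrite unit_law_ray min_l ?max_l ?subr0//; lra. Qed.

(* It turns a joint event of the two numbers into an event of one of them. *)
Let even_digits_gtN1 x : -1 < even_digits x.
Proof. by apply/even_digits_gt; exists 0%N => /=; lra. Qed.

Let law_of_rays (X : {RV mu >-> R}) :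
  (forall a, mu [set x | a < X x] = mu `]a, +oo[%classic) ->
  forall A : set R, measurable A -> mu (X @^-1` A) = mu A.
Proof.
move=> h A mA; apply: (@measure_rays_unique R (distribution mu X) mu) => // [|a].
  by rewrite -ge0_fin_numE// fin_num_measure.
transitivity (mu [set x | a < X x]); last exact: h.
by congr (mu _); apply/seteqP; split=> x; rewrite /= in_itv/= andbT.
Qed.

Lemma digits0_law (A : set R) : measurable A -> mu (digits0 @^-1` A) = mu A.
Proof.
apply: law_of_rays => a; rewrite -[RHS]mule1 -mu_ray_neg -digits_rays.
by congr (mu _); apply/seteqP; split=> x //= [].
Qed.

Lemma digits1_law (A : set R) : measurable A -> mu (digits1 @^-1` A) = mu A.
Proof.
apply: law_of_rays => a; rewrite -[RHS]mul1e -mu_ray_neg -digits_rays.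
by congr (mu _); apply/seteqP; split=> x //= [].
Qed.

(** The rule on rays ([digits_rays]) extends to Borel sets. *)
Lemma digits_indep (A B : set R) : measurable A -> measurable B ->
  mu (digits0 @^-1` A `&` digits1 @^-1` B) = (mu (digits0 @^-1` A) * mu (digits1 @^-1` B))%E.
Proof.
apply: indep_of_rays => a b; rewrite digits0_law// digits1_law// -digits_rays.
by congr (mu _); apply/seteqP; split=> x; rewrite /= !in_itv/= !andbT.
Qed.

End binary_digits.

(** * Normal densities *)

Section lebesgue_affine.
Context {R : realType}.
Local Notation lambda := (@lebesgue_measure R).

Let affine_measurable (c d : R) :
  @measurable_fun _ _ (measurableTypeR R) (measurableTypeR R) setT (fun x => c * x + d).
Proof. by apply: measurable_funD => //; exact: measurable_funM. Qed.

Lemma lebesgue_measure_affine (c d : R) (A : set R) : c != 0 -> measurable A ->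
  lambda ((fun x => c * x + d) @^-1` A) = (`|c|^-1%:E * lambda A)%E.
Proof.
move=> c0 mA.
have cp : 0 < `|c| by rewrite normr_gt0.
pose m1 : {measure set (measurableTypeR R) -> \bar R} :=
  measure_function_pushforward__canonical__measure_function_Measure lambda
    (affine_measurable c d).
have r0 : 0 <= `|c| by [].
pose m2 := mscale (NngNum r0) m1.
have h : lambda A = m2 A.
  apply: (lebesgue_measure_unique (mu := m2)) => // _ [[a b] _ <-] /=.
  rewrite /m2 /mscale/= /m1/= /pushforward.
  have [c_gt0|c_lt0|/eqP] := ltgtP 0 c; last by rewrite eq_sym (negbTE c0).
    rewrite (_ : _ @^-1` _ = `](a - d) / c, (b - d) / c]%classic); last first.
      apply/seteqP; split=> x; rewrite /= !in_itv/= ltr_pdivrMr// ler_pdivlMr// ltrBlDr lerBrDr;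
      by rewrite (mulrC x).
    rewrite !lebesgue_measure_itv/= !lte_fin gtr0_norm//.
    rewrite ltr_pM2r ?invr_gt0// ltrD2r; case: ltP => ab; last by rewrite mule0.
    rewrite -!EFinB -EFinM; congr (_%:E); field; exact: lt0r_neq0.
  rewrite (_ : _ @^-1` _ = `[(b - d) / c, (a - d) / c[%classic); last first.
    apply/seteqP; split=> x; rewrite /= !in_itv/= ltr_ndivlMr// ler_ndivrMr// ltrBlDr lerBrDr;
    by rewrite (mulrC x) andbC.
  rewrite !lebesgue_measure_itv/= !lte_fin ltr0_norm//.
  rewrite ltr_nM2r ?invr_lt0// ltrD2r; case: ltP => ab; last by rewrite mule0.
  rewrite -!EFinB -EFinM; congr (_%:E); field; exact: ltr0_neq0.
rewrite h /m2 /mscale/= muleA -EFinM mulVf ?mul1e//.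
exact: lt0r_neq0.
Qed.

Lemma ge0_integral_affine (c d : R) (f : R -> \bar R) : c != 0 ->
  measurable_fun setT f -> (forall x, 0 <= f x)%E ->
  (\int[lambda]_x f (c * x + d)%R = `|c|^-1%:E * \int[lambda]_x f x)%E.
Proof.
move=> c0 mf f0.
have r0 : 0 <= `|c|^-1 by rewrite invr_ge0.
rewrite -(@ge0_integral_pushforward _ _ _ _ R _ (affine_measurable c d) lambda setT f)//.
rewrite (eq_measure_integral (mscale (NngNum r0) lambda)).
  by rewrite ge0_integral_mscale.
by move=> A mA _; exact: lebesgue_measure_affine.
Qed.

End lebesgue_affine.

Section normal_laws.
Context {R : realType}.
Local Notation lambda := (@lebesgue_measure R).

Lemma ge0_integral_normal_prob (m s : R) (f : R -> \bar R) :
  measurable_fun setT f -> (forall x, 0 <= f x)%E ->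
  (\int[normal_prob m s]_x f x = \int[lambda]_x (f x * (normal_pdf m s x)%:E))%E.
Proof.
move=> mf f0.
have dom := normal_prob_dominates m s.
rewrite -(Radon_Nikodym_SigmaFinite.change_of_variables dom f0 measurableT mf).
have mpdf : measurable_fun setT (fun x => (normal_pdf m s x)%:E).
  by apply/measurable_EFinP; exact: measurable_normal_pdf.
have iRN := Radon_Nikodym_SigmaFinite.f_integrable dom.
apply: ae_eq_integral => //.
- by apply: emeasurable_funM => //; exact: (measurable_int _ iRN).
- exact: emeasurable_funM.
- apply: ae_eqe_mul2l; apply: integral_ae_eq => //.
  by move=> E _ mE; rewrite -Radon_Nikodym_SigmaFinite.f_integral.
Qed.

Lemma normal_pdf_neq0 (m s x : R) : s != 0 ->
  normal_pdf m s x = normal_peak s * normal_fun m s x.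
Proof. by rewrite /normal_pdf => /negbTE ->. Qed.

(** Completing the square in [x]. *)
Lemma normal_pdf_convolution (t c x z : R) : 0 < t ->
  normal_pdf 0 t (z - c * x) * normal_pdf 0 1 x =
  normal_pdf 0 (Num.sqrt (t ^+ 2 + c ^+ 2)) z *
  normal_pdf (c * z / (t ^+ 2 + c ^+ 2)) (t / Num.sqrt (t ^+ 2 + c ^+ 2)) x.
Proof.
move=> t0; set q := t ^+ 2 + c ^+ 2.
have q0 : 0 < q by rewrite ltr_wpDr ?sqr_ge0 ?exprn_gt0.
have r0 : 0 < Num.sqrt q by rewrite sqrtr_gt0.
have r2 : Num.sqrt q ^+ 2 = q by rewrite sqr_sqrtr ?ltW.
rewrite !normal_pdf_neq0 ?lt0r_neq0 ?divr_gt0//.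
rewrite /normal_peak /normal_fun !expr_div_n !r2.
rewrite [LHS]mulrACA [RHS]mulrACA -!expRD; congr (_ * expR _).
  have hp (a : R) : 0 <= a -> 0 <= a * pi *+ 2.
    by move=> a0; rewrite pmulrn_lge0// mulr_ge0// pi_ge0.
  rewrite -!invfM -!sqrtrM ?hp ?sqr_ge0 ?ltW//.

  congr ((Num.sqrt _)^-1); field.
  exact: lt0r_neq0.
rewrite /q; field.
by rewrite !lt0r_neq0//.
Qed.

Lemma ge0_integral_normal_pdf m s (k : R) : 0 <= k ->
  (\int[lambda]_x (k%:E * (normal_pdf m s x)%:E) = k%:E)%E.
Proof.
move=> k0; rewrite ge0_integralZl//.
- by rewrite integral_normal_pdf mule1.
- by apply/measurable_EFinP; exact: measurable_normal_pdf.
- by move=> x _; rewrite lee_fin normal_pdf_ge0.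
Qed.

Lemma normal_prob_indic m s (A : set R) : measurable A ->
  normal_prob m s A = (\int[lambda]_x ((\1_A x)%:E * (normal_pdf m s x)%:E))%E.
Proof.
move=> mA; rewrite -ge0_integral_normal_prob//.
  by rewrite integral_indic// setIT.
exact/measurable_EFinP/measurable_indic.
Qed.

Lemma normal_prob_scale (c : R) (A : set R) : c != 0 -> measurable A ->
  normal_prob 0 1 ((fun x => c * x) @^-1` A) = normal_prob 0 `|c| A.
Proof.
move=> c0 mA.
have cp : 0 < `|c| by rewrite normr_gt0.
have mf : measurable_fun setT (fun z => ((\1_A z)%:E * (normal_pdf 0 `|c| z)%:E) : \bar R)%E.
  apply: emeasurable_funM; apply/measurable_EFinP; first exact: measurable_indic.
  exact: measurable_normal_pdf.
rewrite normal_prob_indic; last first.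
  rewrite -[X in measurable X]setTI.
  by apply: (measurable_funM (measurable_cst c) (@measurable_id _ _ setT)).
rewrite (normal_prob_indic _ _ mA).
have e : (\int[lambda]_x ((\1_A (c * x + 0))%:E * (normal_pdf 0 `|c| (c * x + 0))%:E) =
   `|c|^-1%:E * \int[lambda]_x ((\1_A x)%:E * (normal_pdf 0 `|c| x)%:E))%E.
  rewrite -(ge0_integral_affine 0 c0 mf)// => x.
  by rewrite -EFinM lee_fin mulr_ge0// normal_pdf_ge0.
set I := RHS; have -> : I = (`|c|%:E * (`|c|^-1%:E * I))%E.
  by rewrite muleA -EFinM divff ?mul1e// lt0r_neq0.
rewrite -e.
rewrite -ge0_integralZl//; last 2 first.
- by apply: (measurableT_comp mf); apply: measurable_funD => //; exact: measurable_funM.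
- by move=> x _; rewrite -EFinM lee_fin mulr_ge0// normal_pdf_ge0.
apply: eq_integral => x _; rewrite addr0 muleCA; congr (_ * _)%E.
rewrite -EFinM; congr (_%:E).
rewrite !normal_pdf_neq0 ?lt0r_neq0// /normal_peak /normal_fun !subr0.
rewrite !real_normK ?num_real// expr1n mul1r exprMn mulrA; congr (_ * expR _).
  rewrite -mulrnAr sqrtrM ?sqr_ge0// sqrtr_sqr invfM mulrA divff ?mul1r//.
  exact: lt0r_neq0.
by field.
Qed.

End normal_laws.

(** * Sums of independent normal variables *)

Section normal_convolution.
Context {R : realType}.
Local Notation lambda := (@lebesgue_measure R).
Context {disp : measure_display} {T : measurableType disp}.
Variable P : probability T R.

(** Convolution of centered normal laws: the joint density of [U] and
    [c * U + V] factors by completing the square. *)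
Lemma normal_sum (U V : {RV P >-> R}) (c t : R) : 0 < t ->
  (forall A B, measurable A -> measurable B ->
    P (U @^-1` A `&` V @^-1` B) = (P (U @^-1` A) * P (V @^-1` B))%E) ->
  (forall A, measurable A -> P (U @^-1` A) = normal_prob 0 1 A) ->
  (forall A, measurable A -> P (V @^-1` A) = normal_prob 0 t A) ->
  forall A, measurable A -> P ((fun w => c * U w + V w) @^-1` A) =
    normal_prob 0 (Num.sqrt (t ^+ 2 + c ^+ 2)) A.
Proof.
move=> t0 UV lawU lawV A mA; set r := Num.sqrt _.
pose S : set (R * R) := [set z | A (c * z.1 + z.2)].
have mS : measurable S.
  rewrite -[X in measurable X]setTI.
  apply: (@measurable_funD _ _ R setT (fun z : R * R => c * z.1) snd) => //.
  by apply: measurable_funM => //; exact: measurable_fst.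
transitivity ((distribution P U \x distribution P V)%E S).
  by rewrite pair_lawE.
rewrite /product_measure1.
pose f (z : R * R) : \bar R := ((\1_A z.2)%:E * ((normal_pdf 0 t (z.2 - c * z.1))%:E * (normal_pdf 0 1 z.1)%:E))%E.
have mf : measurable_fun setT f.
  apply: emeasurable_funM; last apply: emeasurable_funM; apply/measurable_EFinP.
  - by apply: measurableT_comp => //; exact: measurable_indic.
  - apply: measurableT_comp; first exact: measurable_normal_pdf.
    by apply: measurable_funB => //; exact: measurable_funM.
  - by apply: measurableT_comp => //; exact: measurable_normal_pdf.
have f0 z : (0 <= f z)%E.
  by rewrite /f -!EFinM lee_fin !mulr_ge0// normal_pdf_ge0.
transitivity (\int[lambda]_x \int[lambda]_z f (x, z))%E.
  transitivity (\int[on_R (normal_prob 0 1)]_x (distribution P V \o xsection S) x)%E.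
    by apply: eq_measure_integral => B mB _; exact: lawU.
  rewrite ge0_integral_distribution//; last exact: measurable_fun_xsection.
  rewrite ge0_integral_normal_prob//; last exact: measurable_fun_xsection.
  apply: eq_integral => x _.
  have mSx : measurable (xsection S x) by exact: measurable_xsection.
  rewrite [X in (X * _)%E](_ : _ = normal_prob 0 t (xsection S x)); last exact: lawV.
  have mg : measurable_fun setT
      (fun y : R => ((\1_(xsection S x) y)%:E * (normal_pdf 0 t y)%:E : \bar R)%E).
    apply: emeasurable_funM; apply/measurable_EFinP; first exact: measurable_indic.
    exact: measurable_normal_pdf.
  have g0 (y : R) : setT y ->
      (0 <= (\1_(xsection S x) y)%:E * (normal_pdf 0 t y)%:E :> \bar R)%E.
    by move=> _; rewrite -EFinM lee_fin mulr_ge0// normal_pdf_ge0.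
  have p0 : (0 <= (normal_pdf 0 1 x)%:E :> \bar R)%E by rewrite lee_fin normal_pdf_ge0.
  rewrite (normal_prob_indic 0 t mSx).
  rewrite -(ge0_integralZr lambda measurableT mg g0 p0).
  pose h (z : R) : \bar R := f (x, z).
  have mh : measurable_fun setT h by exact: measurableT_comp.
  have := @ge0_integral_affine R 1 (c * x) h (oner_neq0 _) mh (fun z => f0 (x, z)).
  rewrite normr1 invr1 mul1e => <-.
  apply: eq_integral => y _; rewrite /h /f/= mul1r addrK.
  rewrite -muleA; congr (_ * _)%E; rewrite !indicE; congr ((nat_of_bool _)%:R%:E).
  by rewrite mem_xsection addrC; apply/idP/idP; rewrite !inE.
rewrite (@fubini_tonelli _ _ (measurableTypeR R) (measurableTypeR R) R lambda lambda f mf f0).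
rewrite (normal_prob_indic _ _ mA); apply: eq_integral => z _.
transitivity (\int[lambda]_x (((\1_A z) * normal_pdf 0 r z)%:E *
    (normal_pdf (c * z / (t ^+ 2 + c ^+ 2)) (t / r) x)%:E))%E.
  apply: eq_integral => x _; rewrite /f/= -!EFinM; congr (_%:E).
  by rewrite -[RHS]mulrA normal_pdf_convolution.
by rewrite ge0_integral_normal_pdf// mulr_ge0// normal_pdf_ge0.
Qed.

End normal_convolution.

(** * Moments of the normal law *)

Section vanishing_integral.
Context {R : realType}.
Local Notation lambda := (@lebesgue_measure R).

(** The fundamental theorem of calculus on [[-n, n]] and dominated convergence. *)
Lemma integral_derivative_eq0 (f F : R -> R) :
  continuous f -> (forall x : R^o, is_derive x 1 F (f x : R^o)) ->
  lambda.-integrable setT (EFin \o f) ->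
  (fun n => F n%:R) @ \oo --> 0 -> (fun n => F (- n%:R)) @ \oo --> 0 ->
  (\int[lambda]_x (f x)%:E)%E = 0%E.
Proof.
move=> cf dF iF Fy FNy.
pose D n : set R := `[(- n%:R), n%:R]%classic.
pose f_ n (x : R) : \bar R := (f x * \1_(D n) x)%:E.
have mf : measurable_fun setT f by exact: continuous_measurable_fun.
have mf_ n : measurable_fun setT (f_ n).
  by apply/measurable_EFinP; apply: measurable_funM => //; apply: measurable_indic; exact: measurable_itv.
have f_f x : (f_ ^~ x) @ \oo --> (f x)%:E.
  apply: cvg_near_cst; exists (Num.truncn `|x|).+1 => // n /= xn.
  suff xD : D n x by rewrite /f_ /= indicE mem_set// mulr1.
  rewrite /D/= in_itv/= -ler_norml.
  apply: (le_trans (ltW (truncnS_gt _))); rewrite ler_nat; exact: xn.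
have h : (fun n => \int[lambda]_x f_ n x)%E @ \oo --> (\int[lambda]_x (f x)%:E)%E.
  have H1 : {ae lambda, forall x, setT x -> f_ ^~ x @ \oo --> (EFin \o f) x}.
    by apply: aeW => x _; exact: f_f.
  have H2 : {ae lambda, forall x n, setT x -> (`|f_ n x| <= `|f x|%:E)%E}.
    apply: aeW => x n _; rewrite /f_ lee_fin normrM ler_piMr// indicE.
    by case: (_ \in _); rewrite ?normr1 ?normr0.
  have iF' := integrable_norm iF.
  have mf' := (measurable_int lambda iF).
  by have [] := @dominated_convergence _ (measurableTypeR R) R lambda setT
    (@measurableT _ (measurableTypeR R)) f_ _ _ mf_ mf' H1 iF' H2.
have cF x : F @ x --> F x.
  by apply/differentiable_continuous/derivable1_diffP; have [] := dF x.
have hn n : (0 < n)%N -> (\int[lambda]_x f_ n x = (F n%:R - F (- n%:R))%:E)%E.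
  move=> n0; transitivity (\int[lambda]_(x in D n) (f x)%:E)%E.
    rewrite [RHS]integral_mkcond; apply: eq_integral => x _.
    rewrite /f_ patchE indicE; case: ifPn => xD; rewrite ?mulr1 ?mulr0//.
  rewrite /D (@continuous_FTC2 _ f F)//.
  - by rewrite gtrN// ltr0n.
  - exact: continuous_subspaceT.
  - split.
    + by move=> x _; have [] := dF x.
    + exact/cvg_at_right_filter/cF.
    + exact/cvg_at_left_filter/cF.
  - by move=> x _; rewrite derive1E; have [_ ->] := dF x.
have h0 : (fun n => (F n%:R - F (- n%:R))%:E) @ \oo --> 0%:E.
  by apply: cvg_EFin; [exact: nearW|rewrite -(subr0 0); exact: cvgB].
have h1 : (fun n => \int[lambda]_x f_ n x)%E @ \oo --> 0%E.
  move: h0; apply: cvg_trans; apply: near_eq_cvg; exists 1%N => // n /= n0.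
  by rewrite hn.
exact: (cvg_unique _ h h1).
Qed.

End vanishing_integral.

Section normal_moments.
Context {R : realType}.
Local Notation lambda := (@lebesgue_measure R).
Variable s : R.
Hypothesis s0 : 0 < s.

Let g (x : R) := normal_fun 0 s x.

Let gE x : g x = expR (- x ^+ 2 / (s ^+ 2 *+ 2)).
Proof. by rewrite /g /normal_fun subr0. Qed.

Let measurable_monomial k : measurable_fun setT (fun x : R => x ^+ k * normal_pdf 0 s x).
Proof. by apply: measurable_funM; [exact: measurable_funX|exact: measurable_normal_pdf]. Qed.

(* A power of [x] costs part of the exponent: the deviation is doubled. *)
Let power_le k : exists2 K, 0 <= K & forall x : R, `|x| ^+ k * g x <= K * normal_fun 0 (2 * s) x.
Proof.
(* [expR (x ^+ 2 / q)] is exactly the quotient of the two densities. *)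
pose q : R := 8 * s ^+ 2 / 3.
have q0 : 0 < q by rewrite divr_gt0// mulr_gt0// exprn_gt0.
exists (1 + q ^+ k * (k`!)%:R) => [|x].
  by rewrite addr_ge0// mulr_ge0// exprn_ge0// ltW.
pose t : R := x ^+ 2 / q.
have t0 : 0 <= t by rewrite divr_ge0 ?sqr_ge0// ltW.
have e1 : 1 <= expR t by rewrite -expR0 ler_expR.
have tk : t ^+ k / (k`!)%:R <= expR t.
  case: (k) => [|k']; first by rewrite expr0 fact0 divr1.
  by apply: (le_trans _ (expR_ge1Dxn k' t0)); rewrite lerDr.
have xt : x ^+ 2 = q * t by rewrite /t mulrC divfK// lt0r_neq0.
have xk : `|x| ^+ k <= (1 + q ^+ k * (k`!)%:R) * expR t.
  have h2 : `|x| ^+ k <= 1 + (q * t) ^+ k.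
    have -> : (q * t) ^+ k = (`|x| ^+ k) ^+ 2.
      by rewrite -xt -(real_normK (num_real x)) -!exprM mulnC.
    have : 0 <= `|x| ^+ k by rewrite exprn_ge0.
    by set a := _ ^+ k => a0; nra.
  apply: (le_trans h2); rewrite mulrDl mul1r lerD// exprMn -mulrA.
  rewrite ler_wpM2l ?exprn_ge0 ?(ltW q0)//.
  by move: tk; rewrite ler_pdivrMr ?ltr0n ?fact_gt0// mulrC.
have -> : normal_fun 0 (2 * s) x = expR t * g x.
  rewrite gE -expRD /normal_fun subr0; congr expR; rewrite /t /q; field.
  exact: lt0r_neq0.
by rewrite mulrA ler_wpM2r// normal_fun_ge0.
Qed.

Let s20 : 2 * s != 0. Proof. by rewrite mulf_neq0// lt0r_neq0. Qed.

Lemma integrable_normal_moment k :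
  lambda.-integrable setT (fun x => (x ^+ k * normal_pdf 0 s x)%:E).
Proof.
have [K K0 hK] := power_le k.
pose c := normal_peak s * (K * (normal_peak (2 * s))^-1).
apply: (@le_integrable _ _ _ lambda setT _ _ (fun x => (c * normal_pdf 0 (2 * s) x)%:E)) => //.
- by apply/measurable_EFinP; exact: measurable_monomial.
- move=> x _; rewrite lee_fin (ger0_norm (_ : 0 <= c * _)); last first.
    by rewrite !mulr_ge0 ?normal_peak_ge0 ?invr_ge0 ?normal_pdf_ge0.
  rewrite !normal_pdf_neq0 ?s20 ?(lt0r_neq0 s0)//.
  rewrite normrM normrX [X in _ * X]ger0_norm; last first.
    by rewrite mulr_ge0 ?normal_peak_ge0 ?normal_fun_ge0.
  rewrite mulrCA /c -!mulrA ler_wpM2l ?normal_peak_ge0// mulKf//.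
  by rewrite lt0r_neq0// normal_peak_gt0.
- exact: (@integrableZl _ _ _ lambda setT (@measurableT _ (measurableTypeR R)) c _
    (integrable_normal_pdf 0 (2 * s))).
Qed.

Definition normal_moment (k : nat) : R :=
  fine (\int[lambda]_x (x ^+ k * normal_pdf 0 s x)%:E)%E.

Let momentE k :
  (\int[lambda]_x (x ^+ k * normal_pdf 0 s x)%:E)%E = (normal_moment k)%:E.
Proof.
rewrite /normal_moment fineK//; apply: integrable_fin_num => //.
exact: integrable_normal_moment.
Qed.

Let pdfE x : normal_pdf 0 s x = normal_peak s * g x.
Proof. by rewrite normal_pdf_neq0// lt0r_neq0. Qed.

Let is_derive_pdf (x : R) :
  is_derive x 1 (normal_pdf 0 s) (- x / s ^+ 2 * normal_pdf 0 s x).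
Proof.
have -> : normal_pdf 0 s = (fun y => normal_peak s * expR (- y ^+ 2 / (s ^+ 2 *+ 2))).
  by apply/funext => y; rewrite pdfE gE.
apply: is_derive_eq.
rewrite /GRing.scale/=; field.
exact: lt0r_neq0.
Qed.

Let F k (x : R) := x ^+ k * normal_pdf 0 s x.

Let is_derive_F k (x : R) :
  is_derive x 1 (F k) (k%:R * F k.-1 x - (s ^+ 2)^-1 * F k.+1 x).
Proof.
have dX : is_derive x 1 (fun y : R => y ^+ k) (k%:R * x ^+ k.-1).
  apply: DeriveDef; first exact: exprn_derivable.
  by rewrite exp_derive /GRing.scale/= mulr1.
have dp := is_derive_pdf x.
have -> : F k = (fun y : R => y ^+ k) * normal_pdf 0 s by [].
apply: is_derive_eq; rewrite /GRing.scale/= /F.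
by rewrite (exprS x k); field; exact: lt0r_neq0.
Qed.

Let F_tail k (c : nat -> R) : (forall n, `|c n| = n%:R) ->
  (fun n => F k (c n)) @ \oo --> 0.
Proof.
move=> cn; have [K K0 hK] := power_le k.+1.
pose C := normal_peak s * K.
have C0 : 0 <= C by rewrite mulr_ge0 ?normal_peak_ge0.
have FC n : n%:R * `|F k (c n)| <= C.
  have -> : n%:R * `|F k (c n)| = normal_peak s * (`|c n| ^+ k.+1 * g (c n)).
    rewrite -(cn n) /F pdfE !normrM normrX (ger0_norm (normal_peak_ge0 _)).
    by rewrite (ger0_norm (normal_fun_ge0 _ _ _)) -!/(g _) (exprS `|c n| k); ring.
  rewrite ler_wpM2l ?normal_peak_ge0//.
  apply: (le_trans (hK _)); rewrite ler_piMr// /normal_fun -expR0 ler_expR.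
  by rewrite mulNr oppr_le0 divr_ge0// ?mulrn_wge0// sqr_ge0.
apply/cvgrPdist_lt => e e0; near=> n; rewrite sub0r normrN.
have n0 : (0 : R) < n%:R by near: n; exact: nbhs_infty_gtr.
rewrite -(ltr_pM2l n0); apply: (le_lt_trans (FC n)).
by rewrite -ltr_pdivrMr//; near: n; exact: nbhs_infty_gtr.
Unshelve. all: by end_near. Qed.

Let F_recursion k : k%:R * normal_moment k.-1 = (s ^+ 2)^-1 * normal_moment k.+1.
Proof.
pose f (x : R) := k%:R * F k.-1 x - (s ^+ 2)^-1 * F k.+1 x.
have iF j : lambda.-integrable setT (EFin \o F j) by exact: integrable_normal_moment.
have iZ a j : lambda.-integrable setT (fun x => (a * F j x)%:E).
  exact: (@integrableZl _ _ _ lambda setT (@measurableT _ (measurableTypeR R)) a _ (iF j)).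
have eZ a j : (\int[lambda]_x (a * F j x)%:E)%E = (a * normal_moment j)%:E.
  transitivity (a%:E * \int[lambda]_x (F j x)%:E)%E.
    exact: (@integralZl _ _ _ lambda setT (@measurableT _ (measurableTypeR R)) _ (iF j) a).
  by rewrite (momentE j).
have cF j : continuous (F j).
  by move=> x; apply/differentiable_continuous/derivable1_diffP; have [] := is_derive_F j x.
have cf : continuous f.
  by move=> x; apply: cvgB; apply: cvgM; [exact: cvg_cst|exact: cF|exact: cvg_cst|exact: cF].
have if_ : lambda.-integrable setT (EFin \o f).
  exact: (@integrableB _ _ _ lambda setT (@measurableT _ (measurableTypeR R)) _ _ (iZ _ _) (iZ _ _)).
have := integral_derivative_eq0 cf (is_derive_F k) if_ (@F_tail k (fun n => n%:R) (fun n => normr_nat R n))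
  (@F_tail k (fun n => - n%:R) (fun n => etrans (normrN n%:R) (normr_nat R n))).
have -> : (\int[lambda]_x (f x)%:E)%E =
    (k%:R * normal_moment k.-1 - (s ^+ 2)^-1 * normal_moment k.+1)%:E.
  transitivity (\int[lambda]_x (k%:R * F k.-1 x)%:E -
                \int[lambda]_x ((s ^+ 2)^-1 * F k.+1 x)%:E)%E.
    exact: (@integralB _ _ _ lambda setT (@measurableT _ (measurableTypeR R)) _ _
      (iZ _ _) (iZ _ _)).
  by rewrite !eZ.
by move=> [] /eqP; rewrite subr_eq0 => /eqP.
Qed.

(** Integration by parts: the derivative of [x ^+ k * normal_pdf 0 s x] integrates
    to [0], which is the recursion of [gaussian_moment]. *)
Lemma normal_momentE k : normal_moment k = gaussian_moment (s ^+ 2) k.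
Proof.
have s2 : s ^+ 2 != 0 by rewrite expf_neq0// lt0r_neq0.
elim/ltn_ind: k => -[|[|k]] IH /=.
- apply: EFin_inj; rewrite -momentE -(integral_normal_pdf 0 s).
  by apply: eq_integral => x _; rewrite expr0 mul1r.
- have := F_recursion 0; rewrite mul0r => /esym/eqP.
  by rewrite mulf_eq0 invr_eq0 (negbTE s2) => /eqP.
- have /= := F_recursion k.+1; rewrite IH// => h.
  by rewrite mulrAC h mulrAC mulVf// mul1r.
Qed.

End normal_moments.

(** * Quantile functions *)

Section quantile.
Context {R : realType}.
Variable P : probability R R.

Let S (x : R) : R := fine (P `]x, +oo[%classic).

Let PE (A : set R) : measurable A -> P A = (fine (P A))%:E.
Proof. by move=> mA; rewrite fineK// fin_num_measure. Qed.

Let S_ge0 x : 0 <= S x. Proof. exact: fine_ge0. Qed.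

Let S_le1 x : S x <= 1.
Proof. by rewrite -lee_fin /S -PE// probability_le1. Qed.

Let S_ni x y : x <= y -> S y <= S x.
Proof.
move=> xy; rewrite -lee_fin /S -!PE//; apply: le_measure; rewrite ?inE//.
by move=> z /=; rewrite !in_itv/= !andbT; exact: le_lt_trans.
Qed.

Let fine_cvg_mu (F : nat -> set R) : (forall n, measurable (F n)) ->
  nondecreasing_seq F -> (fun n => fine (P (F n))) @ \oo --> fine (P (\bigcup_n F n)).
Proof.
move=> mF ndF; apply: fine_cvg; rewrite -PE; last exact: bigcupT_measurable.
by apply: nondecreasing_cvg_mu => //; exact: bigcupT_measurable.
Qed.

Let cvg_gt (u : nat -> R) l a : u @ \oo --> l -> a < l -> exists n, a < u n.
Proof.
move=> ul al; have /cvgrPdist_lt/(_ (l - a)) := ul; rewrite subr_gt0 => /(_ al)[n _ /(_ n (leqnn n))].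
by rewrite /= => h; exists n; have := ler_norm (l - u n); lra.
Qed.

Let S_rc x a : a < S x -> exists2 y, x < y & a < S y.
Proof.
pose F n := `](x + n.+1%:R^-1), +oo[%classic.
have FU : \bigcup_n F n = `]x, +oo[%classic.
  apply/seteqP; split=> z /=.
    move=> [n _]; rewrite /F/= !in_itv/= !andbT; apply: lt_trans.
    by rewrite ltrDl invr_gt0.
  rewrite in_itv/= andbT => xz; exists (Num.truncn (z - x)^-1) => //.
  rewrite /F/= in_itv/= andbT -ltrBrDl invf_plt ?posrE ?subr_gt0//.
  exact: truncnS_gt.
have h : (fun n => S (x + n.+1%:R^-1)) @ \oo --> S x.
  rewrite /S -FU; apply: fine_cvg_mu => [n|m n mn]; first exact: measurable_itv.
  apply/subsetPset => z; rewrite /F/= !in_itv/= !andbT; apply: le_lt_trans.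
  by rewrite lerD2l lef_pV2 ?posrE// ler_nat.
by move=> /(cvg_gt h)[n an]; exists (x + n.+1%:R^-1) => //; rewrite ltrDl invr_gt0.
Qed.

Let cover_rays (F : nat -> set R) : (forall n x, `|x| < n%:R -> F n x) ->
  \bigcup_n F n = setT.
Proof.
move=> hF; rewrite -subTset => x _; exists (Num.truncn `|x|).+1 => //.
by apply: hF; exact: truncnS_gt.
Qed.

Let S_gt a : a < 1 -> exists x, a < S x.
Proof.
move=> a1; pose F n := `](- n%:R : R), +oo[%classic.
have h : (fun n => S (- n%:R)) @ \oo --> (1 : R).
  have e : fine (P (\bigcup_n F n)) = 1.
    rewrite cover_rays ?probability_setT// => n x.
    by rewrite /F/= in_itv/= andbT ltr_norml => /andP[].
  rewrite -[X in _ --> X]e; apply: fine_cvg_mu => [n|m n mn]; first exact: measurable_itv.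
  apply/subsetPset => z; rewrite /F/= !in_itv/= !andbT; apply: le_lt_trans.
  by rewrite lerN2 ler_nat.
by have [n an] := cvg_gt h a1; exists (- n%:R).
Qed.

Let S_lt a : 0 < a -> exists x, S x < a.
Proof.
move=> a0; pose F n := `]-oo, n%:R : R]%classic.
have SE n : S n%:R = 1 - fine (P (F n)).
  have : P (F n) = (1 - P `]n%:R, +oo[%classic)%E.
    by rewrite -probability_setC//; congr (P _); rewrite setCitvr.
  by move=> ->; rewrite (@PE `]n%:R, +oo[%classic)//= -/(S n%:R); lra.
have h : (fun n => fine (P (F n))) @ \oo --> (1 : R).
  have e : fine (P (\bigcup_n F n)) = 1.
    rewrite cover_rays ?probability_setT// => n x.
    by rewrite /F/= in_itv/= ltr_norml => /andP[_ /ltW].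
  rewrite -[X in _ --> X]e; apply: fine_cvg_mu => [n|m n mn]; first exact: measurable_itv.
  apply/subsetPset => z; rewrite /F/= !in_itv/=.
  by move=> /le_trans; apply; rewrite ler_nat.
have [n hn] : exists n, 1 - a < fine (P (F n)) by apply: (cvg_gt h); lra.
by exists n%:R; rewrite SE; lra.
Qed.

(** The left-continuous generalized inverse of the distribution function, written
    with the survival function [S] because rays to the right generate the Borel
    sets here. *)
Definition quantile (u : R) : R :=
  if 0 < u < 1 then sup [set x | 1 - u < S x] else 0.

(** The Galois connection of the generalized inverse, from the right continuity
    of [S]. *)
Lemma quantile_gt u x : 0 < u < 1 -> (x < quantile u) <-> (1 - u < S x).
Proof.
move=> /[dup] u01 /andP[u0 u1]; rewrite /quantile u01.
have ub : has_ubound [set x | 1 - u < S x].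
  have [z hz] : exists z, S z < 1 - u by apply: S_lt; lra.
  exists z => y /= hy; rewrite leNgt; apply/negP => /ltW/S_ni; lra.
have ne : [set x | 1 - u < S x] !=set0.
  by have [z hz] : exists z, 1 - u < S z; [apply: S_gt; lra|exists z].
split=> [/(sup_gt ne)[y /= hy /ltW/S_ni]|/S_rc[y xy hy]]; first lra.
by apply: (lt_le_trans xy); exact: ub_le_sup.
Qed.

Let ray_quantile x : [set u | x < quantile u] =
  (`](1 - S x), +oo[%classic `&` `]0, 1[%classic) `|`
  (if x < 0 then ~` `]0, 1[%classic else set0).
Proof.
apply/seteqP; split=> u /=; have [u01|u01] := boolP (0 < u < 1).
- move=> /(quantile_gt x u01) h; left; rewrite !in_itv/= andbT u01; split=> //; lra.
- by rewrite /quantile (negbTE u01) => ->; right; rewrite /= in_itv/= (negbTE u01).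
- move=> h; apply/quantile_gt => //; case: h.
    by rewrite in_itv/= andbT => -[h _]; lra.
  by case: ifP => //= _; rewrite in_itv/= u01.
- case; first by rewrite !in_itv/= (negbTE u01) => -[].
  by rewrite /quantile (negbTE u01); case: ltP.
Qed.

Lemma quantile_measurable : measurable_fun setT quantile.
Proof.
move=> mD; apply: (measurability _ (RGenOInfty.measurableE R)) => //.
move=> _ [_ [x ->] <-]; rewrite setTI.
rewrite (_ : _ @^-1` _ = [set u | x < quantile u]); last first.
  by apply/seteqP; split=> u; rewrite /= in_itv/= andbT.
rewrite ray_quantile; apply: measurableU.
  by apply: measurableI; exact: measurable_itv.
by case: ifP => // _; apply: measurableC; exact: measurable_itv.
Qed.

Let unit_law_oo : unit_law (R := R) `]0, 1[%classic = 1%E.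
Proof.
transitivity (uniform_prob (@ltr01 R) `]0, 1[%classic) => //.
rewrite /uniform_prob integral_uniform_pdf (eq_integral (cst 1%:E)); last first.
  move=> x; rewrite inE/= => -[_]; rewrite /= in_itv/= /uniform_pdf => ->.
  by rewrite subr0 invr1.
rewrite setIidl; last by apply: subset_itvW.
by rewrite integral_cst//= mul1e lebesgue_measure_itv/= lte01 oppr0 adde0.
Qed.

Let unit_lawI_oo (A : set R) : measurable A -> unit_law A = unit_law (A `&` `]0, 1[%classic).
Proof.
move=> mA; have C0 : unit_law (~` `]0, 1[%classic : set R) = 0%E.
  by rewrite probability_setC// unit_law_oo subee.
rewrite -{1}(setIT A) -(setUv `]0, 1[%classic) setIUr measureU//.
- rewrite [X in (_ + X)%E](_ : _ = 0%E) ?adde0//.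
  apply/eqP; rewrite eq_le measure_ge0 andbT -[leRHS]C0; apply: le_measure.
  - by rewrite inE; apply: measurableI => //; exact: measurableC.
  - by rewrite inE; exact: measurableC.
  - exact: subIsetr.
- exact: measurableI.
- by apply: measurableI => //; exact: measurableC.
- by rewrite setIACA setICr setI0.
Qed.

Lemma quantile_law (A : set R) : measurable A ->
  unit_law (quantile @^-1` A) = P A.
Proof.
pose Q : {RV (unit_law (R := R)) >-> R} := mfun_Sub (mem_set quantile_measurable).
move=> mA; apply: (@measure_rays_unique R (distribution unit_law Q) P) => // [|x].
  by rewrite -ge0_fin_numE// fin_num_measure.
transitivity (unit_law [set u | x < quantile u]).
  by congr (unit_law _); apply/seteqP; split=> u; rewrite /= in_itv/= andbT.
rewrite ray_quantile unit_lawI_oo; last first.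
  apply: measurableU; first by apply: measurableI; exact: measurable_itv.
  by case: ifP => // _; apply: measurableC; exact: measurable_itv.
rewrite setIUl -setIA setIid [X in _ `|` X](_ : _ = set0) ?setU0; last first.
  by case: ifP => _; rewrite ?set0I// setICl.
rewrite -unit_lawI_oo// unit_law_ray.
transitivity (S x)%:E; last by rewrite /S -PE.
congr (_%:E); rewrite min_l ?max_r; have := S_le1 x; have := S_ge0 x; lra.
Qed.

End quantile.

(** * Independent standard normal variables on the unit interval *)

Section normal_law_moments.
Context {R : realType}.
Local Notation lambda := (@lebesgue_measure R).
Variable s : R.
Hypothesis s0 : 0 < s.

Let integrable_abs_moment k :
  lambda.-integrable setT (fun x => (`|x| ^+ k * normal_pdf 0 s x)%:E).
Proof.
have := integrable_norm (integrable_normal_moment s0 k).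
apply: eq_integrable => // x _; rewrite /= normrM normrX.
by rewrite (ger0_norm (normal_pdf_ge0 _ _ _)).
Qed.

Let mX k : measurable_fun setT (fun x : R => (x ^+ k)%:E).
Proof. by apply/measurable_EFinP; exact: measurable_funX. Qed.

Let mnX k : measurable_fun setT (fun x : R => (`|x| ^+ k)%:E).
Proof.
by apply/measurable_EFinP; apply: measurable_funX; exact: normr_measurable.
Qed.

Lemma normal_prob_abs_moment k :
  (\int[normal_prob 0 s]_x (`|x| ^+ k)%:E < +oo)%E.
Proof.
rewrite (ge0_integral_normal_prob 0 s (mnX k)); last first.
  by move=> x; rewrite lee_fin exprn_ge0.
have /integrableP[_] := integrable_abs_moment k.
congr (_ < _)%E; apply: eq_integral => x _.
by rewrite -EFinM gee0_abs// lee_fin mulr_ge0 ?exprn_ge0 ?normal_pdf_ge0.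
Qed.

Let normal_prob_abs_momentE k : (\int[normal_prob 0 s]_x (`|x| ^+ k)%:E =
  \int[lambda]_x (`|x| ^+ k * normal_pdf 0 s x)%:E)%E.
Proof.
rewrite (ge0_integral_normal_prob 0 s (mnX k))//.
Qed.

Let inX k : (normal_prob 0 s).-integrable setT (fun x => (`|x| ^+ k)%:E).
Proof.
apply/integrableP; split; first exact: mnX.
have := normal_prob_abs_moment k; congr (_ < _)%E; apply: eq_integral => x _.
by rewrite gee0_abs// lee_fin exprn_ge0.
Qed.

Lemma integrable_normal_prob_moment k : (normal_prob 0 s).-integrable setT (fun x => (x ^+ k)%:E).
Proof.
apply/integrableP; split; first exact: mX.
have := normal_prob_abs_moment k; congr (_ < _)%E; apply: eq_integral => x _.
by rewrite abse_EFin normrX.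
Qed.

(* The density formula is available for nonnegative integrands; [x ^+ k] is a
   difference of two of them. *)
Lemma normal_prob_moment k :
  (\int[normal_prob 0 s]_x (x ^+ k)%:E = (gaussian_moment (s ^+ 2) k)%:E)%E.
Proof.
have iXl := integrable_normal_moment s0 k.
have inXl := integrable_abs_moment k.
pose mT := @measurableT _ (measurableTypeR R).
have mS : measurable_fun setT (fun x : R => (x ^+ k + `|x| ^+ k)%:E).
  exact: emeasurable_funD (mX k) (mnX k).
have eS : (\int[normal_prob 0 s]_x (x ^+ k + `|x| ^+ k)%:E =
  \int[normal_prob 0 s]_x (x ^+ k)%:E + \int[normal_prob 0 s]_x (`|x| ^+ k)%:E)%E.
  exact: (@integralD _ _ _ (normal_prob 0 s) setT mT _ _ (integrable_normal_prob_moment k) (inX k)).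
have eS' : (\int[normal_prob 0 s]_x (x ^+ k + `|x| ^+ k)%:E =
  \int[lambda]_x (x ^+ k * normal_pdf 0 s x)%:E +
  \int[lambda]_x (`|x| ^+ k * normal_pdf 0 s x)%:E)%E.
  rewrite (ge0_integral_normal_prob 0 s mS); last first.
    by move=> x; rewrite lee_fin -normrX -lerBlDr sub0r lerNl; exact: (le_trans (ler_norm _) (eq_ind_r (fun z => z <= _) (lexx _) (normrN _))).
  rewrite -(@integralD _ _ _ lambda setT mT _ _ iXl inXl).
  by apply: eq_integral => x _; rewrite -EFinM -EFinD mulrDl.
have fin : (\int[lambda]_x (`|x| ^+ k * normal_pdf 0 s x)%:E \is a fin_num)%E.
  exact: integrable_fin_num inXl.
have := eS; rewrite eS' normal_prob_abs_momentE => /(congr1 (fun z => z -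
  \int[lambda]_x (`|x| ^+ k * normal_pdf 0 s x)%:E)%E).
rewrite !addeK// => <-.
rewrite -normal_momentE// /normal_moment fineK//.
exact: integrable_fin_num iXl.
Qed.

End normal_law_moments.

Section normal_sequence.
Context {R : realType}.
Local Notation mu := (@unit_law R).
Local Notation N01 := (on_R (normal_prob (0 : R) 1)).

(** Independent standard normal variables on the unit interval: the digits at
    even places feed [normal_seq 0], the others feed the rest of the sequence. *)
Fixpoint normal_seq (k : nat) (x : R) : R :=
  if k is k'.+1 then normal_seq k' (digits1 x) else quantile N01 (digits0 x).

Definition normal_comb (c : nat -> R) (K : nat) (x : R) : R :=
  \sum_(k < K) c k * normal_seq k x.

Lemma normal_seq_measurable k : measurable_fun setT (normal_seq k).
Proof.
elim: k => [|k IH].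
  by apply: measurableT_comp; [exact: quantile_measurable|exact: measurable_funPT].
by apply: measurableT_comp => //; exact: measurable_funPT.
Qed.

Lemma normal_comb_measurable c K : measurable_fun setT (normal_comb c K).
Proof.
apply: measurable_sum => k; apply: measurable_funM => //.
exact: normal_seq_measurable.
Qed.

Lemma normal_combS c K x : normal_comb c K.+1 x =
  c 0%N * quantile N01 (digits0 x) + normal_comb (fun k => c k.+1) K (digits1 x).
Proof. by rewrite /normal_comb big_ord_recl. Qed.

(** By induction on the number of variables, with [normal_sum]. The degenerate
    combination is kept apart because [normal_prob 0 0] is not a point mass. *)
Lemma normal_comb_law (c : nat -> R) K : let v := \sum_(k < K) c k ^+ 2 in
  (v = 0 /\ forall x, normal_comb c K x = 0) \/
  (0 < v /\ forall A, measurable A ->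
    mu (normal_comb c K @^-1` A) = normal_prob 0 (Num.sqrt v) A).
Proof.
elim: K c => [|K IH] c /=.
  by left; rewrite big_ord0; split=> // x; rewrite /normal_comb big_ord0.
have mpre (f : R -> R) A : measurable_fun setT f -> measurable A -> measurable (f @^-1` A).
  by move=> mf mA; rewrite -[X in measurable X]setTI; exact: mf.
have mq := @quantile_measurable R N01.
have mU : measurable_fun setT (fun x => quantile N01 (digits0 x)).
  exact: (normal_seq_measurable 0).
pose U : {RV mu >-> R} := mfun_Sub (mem_set mU).
have lawU A : measurable A -> mu (U @^-1` A) = normal_prob 0 1 A.
  move=> mA; transitivity (mu (quantile N01 @^-1` A)); last exact: quantile_law.
  by rewrite -(digits0_law (mpre _ _ mq mA)).
rewrite big_ord_recl.
have {IH} := IH (fun k => c k.+1); set v := \sum_(k < K) _ => -[[v0 L0]|[v0 lawL]].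
  have E : normal_comb c K.+1 = fun x => c 0%N * U x.
    by apply/funext => x; rewrite normal_combS L0 addr0.
  have [c0|c0] := eqVneq (c 0%N) 0.
    by left; rewrite c0 v0 expr0n addr0; split=> // x; rewrite E c0 mul0r.
  right; rewrite v0 addr0 exprn_even_gt0//; split=> // A mA.
  rewrite E sqrtr_sqr -normal_prob_scale//.
  rewrite -lawU //; apply: (mpre (fun x => c 0%N * x)) => //.
  exact: measurable_funM.
right; split; first by rewrite ltr_wpDl// sqr_ge0.
move=> A mA; pose L := normal_comb (fun k => c k.+1) K.
have mL : measurable_fun setT L by exact: normal_comb_measurable.
have mV : measurable_fun setT (fun x => L (digits1 x)).
  by apply: measurableT_comp => //; exact: measurable_funPT.
pose V : {RV mu >-> R} := mfun_Sub (mem_set mV).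
have E : normal_comb c K.+1 = fun x => c 0%N * U x + V x.
  by apply/funext => x; rewrite normal_combS.
rewrite E addrC -[in X in normal_prob _ X](sqr_sqrtr (ltW v0)).
apply: (@normal_sum R _ _ mu U V (c 0%N)) => //.
- by rewrite sqrtr_gt0.
- move=> B C mB mC; exact: (digits_indep (mpre _ _ mq mB) (mpre _ _ mL mC)).
- move=> B mB; rewrite -lawL// -(digits1_law (mpre _ _ mL mB)).
  by [].
Qed.

Lemma all_moments_normal_comb c K : all_moments mu (normal_comb c K).
Proof.
have mc := normal_comb_measurable c K.
split=> [_ //|k].
have [[_ L0]|[v0 law]] := normal_comb_law c K.
  exists (0 ^+ k) => _; rewrite (eq_integral (cst (0 ^+ k)%:E)); last first.
    by move=> x _; rewrite L0 normr0.
  by rewrite integral_cst//= probability_setT mule1.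
have s0 : 0 < Num.sqrt (\sum_(k < K) c k ^+ 2) by rewrite sqrtr_gt0.
have := normal_prob_abs_moment s0 k; set s := Num.sqrt _ in s0 law * => lt.
pose X : {RV mu >-> R} := mfun_Sub (mem_set mc).
have mk : measurable_fun setT (fun x : R => (`|x| ^+ k)%:E : \bar R).
  by apply/measurable_EFinP; apply: measurable_funX; exact: normr_measurable.
have k0 (x : R) : (0 <= (`|x| ^+ k)%:E :> \bar R)%E by rewrite lee_fin exprn_ge0.
have e : (\int[mu]_x (`|normal_comb c K x| ^+ k)%:E = \int[normal_prob 0 s]_x (`|x| ^+ k)%:E)%E.
  rewrite -(ge0_integral_distribution X mk k0).
  rewrite (eq_measure_integral (on_R (normal_prob 0 s))); last first.
    by move=> A mA _; exact: law.
  by rewrite ge0_integral_distribution.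
exists (fine (\int[normal_prob 0 s]_x (`|x| ^+ k)%:E)) => _.
rewrite e fineK// ge0_fin_numE//; apply: integral_ge0 => x _; exact: k0.
Qed.

Lemma Ex_normal_comb (c : nat -> R) K k : Ex mu (fun x => normal_comb c K x ^+ k) =
  gaussian_moment (\sum_(k < K) c k ^+ 2) k.
Proof.
have mc := normal_comb_measurable c K.
have [[v0 L0]|[v0 law]] := normal_comb_law c K.
  rewrite v0 (eq_Ex _ (Y := fun=> 0 ^+ k)); last by move=> x; rewrite L0.
  rewrite Ex_cst; elim/ltn_ind: k => -[|[|k]] IH /=; rewrite ?expr0// ?mulr0 ?mul0r//.
  by rewrite expr0n.
have s0 : 0 < Num.sqrt (\sum_(k < K) c k ^+ 2) by rewrite sqrtr_gt0.
rewrite -[X in gaussian_moment X](sqr_sqrtr (ltW v0)).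
set s := Num.sqrt _ in s0 law *.
pose X : {RV mu >-> R} := mfun_Sub (mem_set mc).
have mk : measurable_fun setT (fun x : R => (x ^+ k)%:E : \bar R).
  by apply/measurable_EFinP; exact: measurable_funX.
apply: EFin_inj; rewrite -(normal_prob_moment s0) /Ex /Rintegral fineK; last first.
  apply: integrable_fin_num => //.
  exact: am_integrable (amX k (all_moments_normal_comb c K)).
rewrite -(integral_distribution (X := X) mk); last first.
  exact: am_integrable (amX k (all_moments_normal_comb c K)).
rewrite (eq_measure_integral (on_R (normal_prob 0 s))); last first.
  by move=> A mA _; exact: law.
rewrite integral_distribution//.
exact: integrable_normal_prob_moment.
Qed.

End normal_sequence.

(** * Gaussian families with a given covariance *)

Section kernels.
Context {R : rcfType} {I : Type}.
Implicit Types (K : I -> I -> R) (t : seq (R * I)).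

Definition qform K t : R := \sum_(p <- t) \sum_(q <- t) p.1 * q.1 * K p.2 q.2.

(** The index type may be infinite, so a test vector is a finite list of weighted
    points, with repetitions. *)
Definition psd K := (forall i j, K i j = K j i) /\ forall t, 0 <= qform K t.

Definition pivot K (p i j : I) : R := K i j - K i p * K p j / K p p.

Let cross K p t : R := \sum_(q <- t) q.1 * K q.2 p.

Lemma qform_cons K x p t : (forall i j, K i j = K j i) ->
  qform K ((x, p) :: t) = x ^+ 2 * K p p + 2 * x * cross K p t + qform K t.
Proof.
move=> sK; rewrite /qform big_cons big_cons /=.
under [X in _ + X = _]eq_bigr do rewrite big_cons.
rewrite big_split/= addrA; congr (_ + _).
rewrite -[LHS]addrA expr2; congr (_ + _).
rewrite /cross mulr_sumr -big_split/=; apply: eq_bigr => q _.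
by rewrite (sK p q.2); ring.
Qed.

Lemma psd_diag_ge0 K p : psd K -> 0 <= K p p.
Proof.
move=> [sK /(_ [:: (1, p)])]; rewrite qform_cons// /cross /qform !big_nil.
by rewrite mulr0 !addr0 expr1n mul1r.
Qed.

(** If [K p p = 0] the quadratic form of [x p + j] is affine in [x], and nonnegative. *)
Lemma psd_diag0 K p j : psd K -> K p p = 0 -> K p j = 0.
Proof.
move=> [sK K0] pp; apply/eqP/negPn/negP => pj.
have := K0 [:: (- (K j j + 1) / (2 * K p j), p); (1, j)].
rewrite !qform_cons// /cross /qform big_seq1 big_nil /= pp mulr0 add0r !mul1r big_nil.
rewrite !mulr0 expr1n mul1r !addr0 (sK j p).
have -> : 2 * (- (K j j + 1) / (2 * K p j)) * K p j = - (K j j + 1) by field.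
lra.
Qed.

(** The quadratic form of the pivoted kernel is the minimum over [x] of the form
    of the vector with [x p] added. *)
Lemma psd_pivot K p : psd K -> psd (pivot K p).
Proof.
move=> hK; have [sK K0] := hK; split=> [i j|t].
  by rewrite /pivot (sK i j) (sK i p) (sK p j) mulrC [K p i * _]mulrC mulrC.
have [pp|pp] := eqVneq (K p p) 0.
  rewrite (_ : qform _ t = qform K t)//; apply: eq_bigr => q _; apply: eq_bigr => q' _.
  by rewrite /pivot pp invr0 mulr0 subr0.
have -> : qform (pivot K p) t = qform K t - cross K p t ^+ 2 / K p p.
  rewrite expr2 -mulrA [X in _ - X * _]/cross mulr_suml /qform -sumrB.
  apply: eq_bigr => q _; rewrite /cross mulr_suml mulr_sumr -sumrB.
  by apply: eq_bigr => q' _; rewrite /pivot (sK p q'.2); ring.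
have := K0 ((- cross K p t / K p p, p) :: t); rewrite qform_cons//.
congr (_ <= _); field.
exact: pp.
Qed.

Lemma pivot_pp K p j : psd K -> pivot K p p j = 0.
Proof.
move=> hK; rewrite /pivot; have [pp|pp] := eqVneq (K p p) 0.
  by rewrite pp invr0 mulr0 subr0 psd_diag0.
by rewrite mulrAC divff// mul1r subrr.
Qed.

Lemma pivot_row0 K p i j : K i p = 0 -> K i j = 0 -> pivot K p i j = 0.
Proof. by rewrite /pivot => -> ->; rewrite mul0r mul0r subr0. Qed.

Lemma pivotE K p i j : psd K -> pivot K p i j =
  K i j - (K i p / Num.sqrt (K p p)) * (K j p / Num.sqrt (K p p)).
Proof.
move=> hK; have [sK _] := hK; rewrite /pivot mulrACA -invfM -expr2 sqr_sqrtr ?psd_diag_ge0//.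
by rewrite (sK p j).
Qed.

End kernels.

Section cholesky.
Context {R : rcfType} {I : countType} (K : I -> I -> R).
Hypothesis psdK : psd K.

(** Kernel left after the first [n] pivots, in the order of the enumeration. *)
Fixpoint residual (n : nat) : I -> I -> R :=
  if n is n'.+1 then
    if unpickle n' is Some p then pivot (residual n') p else residual n'
  else K.

Definition loading (i : I) (n : nat) : R :=
  if unpickle n is Some p
  then residual n i p / Num.sqrt (residual n p p) else 0.

Lemma psd_residual n : psd (residual n).
Proof.
by elim: n => [//|n IH] /=; case: unpickle => [p|//]; exact: psd_pivot.
Qed.

(** A row becomes zero when its index is the pivot and stays zero afterwards. *)
Lemma residual_eq0 n i j : (pickle i < n)%N -> residual n i j = 0.
Proof.
elim: n j => [//|n IH] j; rewrite ltnS leq_eqVlt => /orP[/eqP<-|lt_in] /=.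
  by rewrite pickleK; apply: pivot_pp; exact: psd_residual.
by case: unpickle => [p|]; [apply: pivot_row0|]; exact: IH.
Qed.

Lemma loading_eq0 i n : (pickle i < n)%N -> loading i n = 0.
Proof.
by move=> lt_in; rewrite /loading; case: unpickle => // p; rewrite residual_eq0// mul0r.
Qed.

Lemma residualE n i j :
  K i j = \sum_(k < n) loading i k * loading j k + residual n i j.
Proof.
elim: n => [|n IH]; first by rewrite big_ord0 add0r.
rewrite big_ord_recr/= IH -addrA; congr (_ + _).
rewrite /loading; case: unpickle => [p|]; last by rewrite mul0r add0r.
by rewrite pivotE; [rewrite addrCA subrr addr0|exact: psd_residual].
Qed.

Lemma choleskyE n i j : (pickle i < n)%N ->
  K i j = \sum_(k < n) loading i k * loading j k.
Proof. by move=> lt_in; rewrite (residualE n) residual_eq0 ?addr0. Qed.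

End cholesky.

Section gaussian_family.
Context {R : realType} {I : countType} (K : I -> I -> R).
Hypothesis psdK : psd K.
Local Notation mu := (@unit_law R).

(** The pivots after the index of [i] do not contribute to [i], so finitely many
    normal variables suffice. *)
Definition gaussian_family (i : I) : {RV mu >-> R} :=
  mfun_Sub (mem_set (normal_comb_measurable (loading K i) (pickle i).+1)).

Lemma gaussian_familyE i n x : (pickle i < n)%N ->
  gaussian_family i x = normal_comb (loading K i) n x.
Proof.
move=> lt_in; rewrite /gaussian_family /= /normal_comb.
rewrite -!(big_mkord predT (fun k => loading K i k * normal_seq k x)).
rewrite [RHS](big_cat_nat (n := (pickle i).+1))//=.
rewrite [X in _ + X]big_nat_cond [X in _ + X]big1 ?addr0// => k.
by rewrite andbT => /andP[ik _]; rewrite loading_eq0// mul0r.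
Qed.

(** Every linear combination is a combination of a common finite list of
    independent normal variables, whose variance is given by the kernel. *)
Lemma gaussian_family_sum (s : seq (R * I)) : exists c n,
  (forall x, \sum_(p <- s) p.1 * gaussian_family p.2 x = normal_comb c n x) /\
  \sum_(k < n) c k ^+ 2 = qform K s.
Proof.
pose n := \max_(p <- s) (pickle p.2).+1.
have sn p : p \in s -> (pickle p.2 < n)%N.
  by move=> ps; rewrite /n (big_rem p)//= leq_maxl.
exists (fun k => \sum_(p <- s) p.1 * loading K p.2 k), n; split=> [x|].
  rewrite /normal_comb; under [RHS]eq_bigr do rewrite mulr_suml.
  rewrite exchange_big/= big_seq [RHS]big_seq; apply: eq_bigr => p ps.
  rewrite -[normal_comb _ _ x]/(gaussian_family p.2 x)
    (gaussian_familyE x (sn p ps)) /normal_comb mulr_sumr.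
  by apply: eq_bigr => k _; rewrite mulrA.
rewrite /qform; under eq_bigr do rewrite expr2 mulr_suml.
rewrite exchange_big/= big_seq [RHS]big_seq; apply: eq_bigr => p ps.
under eq_bigr do rewrite mulr_sumr.
rewrite exchange_big/=; apply: eq_bigr => q _.
rewrite (choleskyE psdK q.2 (sn p ps)) mulr_sumr; apply: eq_bigr => k _.
ring.
Qed.

Lemma jointly_gaussian_family : jointly_gaussian gaussian_family.
Proof.
move=> s a.
have [c [n [E _]]] := gaussian_family_sum [seq (a i, i) | i <- s].
have {E} -> : (fun w => \sum_(i <- s) a i * gaussian_family i w) = normal_comb c n.
  by apply/funext => w; rewrite -E big_map.
have [[_ L0]|[v0 law]] := normal_comb_law c n.
  left; exists 0 => A mA; rewrite /pushforward.
  rewrite (_ : normal_comb c n = cst 0); last by apply/funext.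
  rewrite diracE; case: (boolP (0 \in A)) => [/[!inE] A0|/negP A0].
    by rewrite preimage_cst mem_set// probability_setT.
  rewrite preimage_cst (_ : 0 \in A = false); last exact/negP.
  by rewrite measure0.
right; exists 0, (Num.sqrt (\sum_(k < n) c k ^+ 2)); split; first by rewrite sqrtr_gt0.
exact: law.
Qed.

Lemma all_moments_gaussian_family i : all_moments mu (gaussian_family i).
Proof. exact: all_moments_normal_comb. Qed.

Lemma Ex_gaussian_family (s : seq I) k :
  Ex mu (fun w => (\sum_(i <- s) gaussian_family i w) ^+ k) =
  gaussian_moment (\sum_(i <- s) \sum_(j <- s) K i j) k.
Proof.
have [c [n [E V]]] := gaussian_family_sum [seq (1, i) | i <- s].
rewrite (eq_Ex _ (Y := fun w => normal_comb c n w ^+ k)).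
  rewrite Ex_normal_comb V /qform big_map; congr gaussian_moment.
  by apply: eq_bigr => i _; rewrite big_map; apply: eq_bigr => j _; rewrite !mul1r.
by move=> w; rewrite -E big_map; congr (_ ^+ _); apply: eq_bigr => i _; rewrite mul1r.
Qed.

End gaussian_family.

(** * Polarization *)

(** Expand the powers: a map [f] of ['I_n] to itself contributes the signed
    number of sets [A] that contain its range, which is [0] unless [f] is onto.
    The onto maps are the permutations, and each of them gives the full product;
    [N] is their number. *)
Lemma polarization (R : comNzRingType) (n : nat) : exists2 N : nat, (0 < N)%N &
  forall x : 'I_n -> R,
    \sum_(A : {ffun 'I_n -> bool})
      (\prod_i (if A i then 1 else -1)) * (\sum_(i | A i) x i) ^+ n =
    N%:R * \prod_i x i.
Proof.
pose onto (f : {ffun 'I_n -> 'I_n}) := [forall i, exists j, f j == i].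
exists #|[pred f | onto f]|.
  apply/card_gt0P; exists [ffun i => i]; rewrite inE.
  by apply/forallP => i; apply/existsP; exists i; rewrite ffunE.
move=> x.
have expand (A : {ffun 'I_n -> bool}) : (\sum_(i | A i) x i) ^+ n =
    \sum_(f : {ffun 'I_n -> 'I_n}) (\prod_j (A (f j))%:R) * \prod_j x (f j).
  rewrite -[n in _ ^+ n]card_ord -prodr_const.
  transitivity (\prod_(j < n) \sum_i (A i)%:R * x i).
    apply: eq_bigr => j _; rewrite big_mkcond; apply: eq_bigr => i _.
    by case: (A i); rewrite ?mul1r ?mul0r.
  by rewrite bigA_distr_bigA/=; apply: eq_bigr => f _; rewrite big_split.
transitivity (\sum_(A : {ffun 'I_n -> bool}) \sum_(f : {ffun 'I_n -> 'I_n})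
    (\prod_i (if A i then 1 else -1)) * ((\prod_j (A (f j))%:R) * \prod_j x (f j))).
  by apply: eq_bigr => A _; rewrite expand mulr_sumr.
rewrite exchange_big/=.
(* the sum over [A] factors over the coordinates; the factor of a coordinate
   [i] is 1 or 0 according as [i] is a value of [f] or not *)
have sign_sum (f : {ffun 'I_n -> 'I_n}) :
    \sum_(A : {ffun 'I_n -> bool}) (\prod_i (if A i then 1 else -1)) *
      ((\prod_j (A (f j))%:R) * \prod_j x (f j)) = (onto f)%:R * \prod_j x (f j).
  rewrite (eq_bigr _ (fun A _ => mulrA _ _ _)) -mulr_suml; congr (_ * _).
  pose g i (b : bool) : R := (if b then 1 else -1) * \prod_(j | f j == i) b%:R.
  transitivity (\sum_(A : {ffun 'I_n -> bool}) \prod_i g i (A i)).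
    apply: eq_bigr => A _; rewrite big_split/=; congr (_ * _).
    rewrite (partition_big f xpredT)//=; apply: eq_bigr => i _.
    by apply: eq_bigr => j /eqP ->.
  rewrite -bigA_distr_bigA/=.
  transitivity (\prod_i ([exists j, f j == i])%:R : R).
    apply: eq_bigr => i _; rewrite big_bool /g /= !mul1r.
    rewrite big1// mulN1r; case: (boolP [exists j, _]) => [/existsP[j fj]|].
      by rewrite (bigD1 j)//= mul0r subr0.
    rewrite negb_exists => /forallP nf; rewrite big_pred0 ?subrr// => j.
    exact/negbTE/nf.
  case: (boolP (onto f)) => [/forallP fo|]; first by rewrite big1// => i _; rewrite fo.
  by rewrite negb_forall => /existsP[i /negbTE fi]; rewrite (bigD1 i)//= fi mul0r.
rewrite (eq_bigr _ (fun f _ => sign_sum f)).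
rewrite (bigID (fun f => onto f))/= [X in _ + X]big1 ?addr0 => [|f /negbTE ->]; last first.
  by rewrite mul0r.
rewrite -sum1_card natr_sum mulr_suml; apply: eq_big => [f|f fo]; first by rewrite inE.
have injf : injective f.
  apply/injectiveP/card_uniqP; rewrite size_map -cardE; apply: eq_card => i.
  have /existsP[j /eqP <-] := forallP fo i.
  by rewrite inE; exact: codom_f.
by rewrite fo !mul1r -(reindex_inj injf (P := predT) (F := x)).
Qed.

(** * Means of arrays with power-like profile *)

Section power_sums.
Context {R : realType}.
Implicit Types (x y q : R).

(** Young's inequality for the exponents [q + 1] and [(q + 1) / q]: the convex
    function [y `^ (q + 1)] lies above its tangent at [x]. *)
Lemma powR_tangent q x y : 0 <= q -> 0 <= x -> 0 <= y ->
  (q + 1) * x `^ q * y <= y `^ (q + 1) + q * x `^ (q + 1).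
Proof.
move=> q0 x0 y0.
have [->|qn0] := eqVneq q 0.
  by rewrite !powRr0 add0r mul0r addr0 powRr1// !mul1r.
have qp : 0 < q by rewrite lt_neqAle eq_sym qn0.
have := @conjugate_powR _ y (x `^ q) (q + 1) ((q + 1) / q) y0 (powR_ge0 _ _).
have -> : 0 < q + 1 by lra.
have -> : 0 < (q + 1) / q by rewrite divr_gt0//; lra.
move=> /(_ isT isT); rewrite -powRrM.
have -> : q * ((q + 1) / q) = q + 1 by field.
have -> : (q + 1)^-1 + ((q + 1) / q)^-1 = 1 by field; rewrite qn0; lra.
move=> /(_ erefl) h.
have q1 : 0 < q + 1 by lra.
rewrite -(ler_pM2l q1) in h; move: h.
rewrite (mulrC y) mulrA => /le_trans; apply; rewrite le_eqVlt; apply/orP; left.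
by apply/eqP; field; rewrite qn0; lra.
Qed.

Lemma powR_div (s t : nat) q : (s%:R / t%:R : R) `^ q = s%:R `^ q / t%:R `^ q.
Proof. by rewrite powRM ?invr_ge0// -powR_inv1// -powRrM mulN1r powRN. Qed.

Lemma powR_cvg1 q (u : nat -> R) : u @ \oo --> (1 : R) ->
  (fun n => u n `^ q) @ \oo --> (1 : R).
Proof.
move=> u1; have c : {for (1 : R), continuous (fun x : R => x `^ q)}.
  apply/differentiable_continuous/derivable1_diffP.
  by apply: derivable_powR; rewrite in_itv/= andbT.
have := cvg_comp _ _ u1 c; by rewrite powR1.
Qed.

Lemma inv_nat_cvg0 : (fun n => n%:R^-1 : R) @ \oo --> 0.
Proof.
rewrite -cvg_shiftS; exact: cvg_harmonic.
Qed.

Lemma cvg_sumr (J : Type) (s : seq J) (p : pred J) (u : J -> nat -> R) (l : J -> R) :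
  (forall j, p j -> u j @ \oo --> l j) ->
  (fun n => \sum_(j <- s | p j) u j n) @ \oo --> \sum_(j <- s | p j) l j.
Proof.
move=> ul; elim: s => [|j s IH].
  rewrite big_nil (_ : (fun _ => _) = fun=> 0); first exact: cvg_cst.
  by apply/funext => n; rewrite big_nil.
rewrite big_cons; case: ifPn => pj.
  rewrite (_ : (fun _ => _) = fun n => u j n + \sum_(j <- s | p j) u j n).
    by apply: cvgD => //; exact: ul.
  by apply/funext => n; rewrite big_cons pj.
rewrite (_ : (fun _ => _) = fun n => \sum_(j <- s | p j) u j n)//.
by apply/funext => n; rewrite big_cons (negbTE pj).
Qed.

Definition mean (u : nat -> R) (n : nat) : R := n%:R^-1 * \sum_(i < n) u i.

Lemma cesaro_mean (u : nat -> R) (l : R) :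
  u @ \oo --> l -> (fun n => mean u n) @ \oo --> l.
Proof.
move=> ul; rewrite -cvg_shiftS.
suff -> : (fun n => mean u n.+1) = arithmetic_mean u :> (nat -> R) by exact: cesaro.
by apply/funext => n; rewrite /arithmetic_mean/= /mean seriesEnat/= big_mkord.
Qed.

(** By [powR_tangent] the summand [(q + 1) * i `^ q] lies between two consecutive
    increments of [i `^ (q + 1)], so that the sum telescopes up to one term. *)
Lemma power_mean_cvg q : 0 <= q ->
  (fun n => mean (fun i => (i%:R / n%:R) `^ q) n) @ \oo --> (q + 1)^-1.
Proof.
move=> q0; have q1 : 0 < q + 1 by lra.
have q1n : q + 1 != 0 by lra.
(* [p] is the power whose increments frame the summands *)
pose p (i : nat) : R := i%:R `^ (q + 1).
have p0 : p 0%N = 0 by rewrite /p powR0.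
have pM (i : nat) : p i = i%:R `^ q * i%:R.
  case: i => [|i]; first by rewrite p0 mulr0.
  by rewrite /p powRD ?powRr1// (negbTE q1n).
have up (i : nat) : (q + 1) * i%:R `^ q <= p i.+1 - p i.
  have := @powR_tangent q i%:R i.+1%:R q0 (ler0n _ _) (ler0n _ _).
  by rewrite -/(p i.+1) -/(p i) -natr1 !pM; nra.
have down (i : nat) : p i.+1 - p i <= (q + 1) * i.+1%:R `^ q.
  have := @powR_tangent q i.+1%:R i%:R q0 (ler0n _ _) (ler0n _ _).
  by rewrite -/(p i.+1) -/(p i) -natr1 !pM -natr1; nra.
have pE (n : nat) : p n = \sum_(i < n) (p i.+1 - p i).
  by rewrite -(big_mkord predT (fun i => p i.+1 - p i)) telescope_sumr// p0 subr0.
pose S (n : nat) : R := \sum_(i < n) i%:R `^ q.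
have SU n : (q + 1) * S n <= p n.
  by rewrite pE mulr_sumr; apply: ler_sum => i _; exact: up.
have SD n : p n - (q + 1) * n%:R `^ q <= (q + 1) * S n.
  have : p n <= (q + 1) * \sum_(i < n) i.+1%:R `^ q.
    by rewrite pE mulr_sumr; apply: ler_sum => i _; exact: down.
  have : \sum_(i < n) i.+1%:R `^ q <= S n + n%:R `^ q :> R.
    have -> : S n + n%:R `^ q = \sum_(i < n.+1) (i : nat)%:R `^ q.
      by rewrite /S big_ord_recr.
    by rewrite big_ord_recl/= lerDr powR_ge0.
  nra.
have E n : (0 < n)%N -> mean (fun i => (i%:R / n%:R) `^ q) n = S n / p n.
  move=> n0; rewrite /mean pM mulr_sumr /S mulr_suml; apply: eq_bigr => i _.
  by rewrite powR_div invfM; ring.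
apply: (@squeeze_cvgr _ _ _ _ (fun n => (q + 1)^-1 - n%:R^-1) (fun=> (q + 1)^-1)).
- exists 1%N => // n /= n0; rewrite E//.
  have nR : 0 < n%:R :> R by rewrite ltr0n.
  have pn : 0 < p n by rewrite powR_gt0.
  apply/andP; split.
    rewrite ler_pdivlMr// -(ler_pM2l q1) (le_trans _ (SD n))// pM.
    rewrite le_eqVlt; apply/orP; left; apply/eqP; field.
    by rewrite q1n lt0r_neq0.
  by rewrite ler_pdivrMr// mulrC ler_pdivlMr// mulrC.
- rewrite -[X in _ --> X]subr0; apply: cvgB; [exact: cvg_cst|exact: inv_nat_cvg0].
- exact: cvg_cst.
Qed.


(** The shape of a moment of the entries at level [t] of a matrix of size [n].
    Levels near both ends of the range are left free: they do not affect means,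
    and formulas with shifted levels fail there. *)
Definition regular (c : nat -> nat -> R) :=
  exists (F : finType) (q : F -> R) (g : F -> nat -> R) (K : nat),
    [/\ (0 < K)%N, forall i, 0 <= q i, forall i, cvgn (g i) &
        forall n t, (K <= t)%N -> (t + K <= n)%N ->
          c n t = \sum_i (t%:R / n%:R) `^ (q i) * g i t].

Lemma eq_regular K (c c' : nat -> nat -> R) :
  (forall n t, (K <= t)%N -> (t + K <= n)%N -> c n t = c' n t) ->
  regular c -> regular c'.
Proof.
move=> cc' [F [q [g [K' [K0 q0 gc e]]]]]; exists F, q, g, (K + K')%N; split=> //.
  by rewrite addn_gt0 K0 orbT.
move=> n t Kt Kn; rewrite -cc' ?e//; lia.
Qed.

Lemma regular_monomial K q (g : nat -> R) (c : nat -> nat -> R) :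
  0 <= q -> cvgn g ->
  (forall n t, (K <= t)%N -> (t + K <= n)%N -> c n t = (t%:R / n%:R) `^ q * g t) ->
  regular c.
Proof.
move=> q0 gc cE; exists unit, (fun=> q), (fun=> g), K.+1; split => // n t Kt tn.
by rewrite cE; [rewrite (bigD1 tt)//= big1 ?addr0// => -[]| lia | lia].
Qed.

Lemma regular_cst x : regular (fun _ _ => x).
Proof.
apply: (@regular_monomial 0 0 (fun=> x)) => //; first exact: is_cvg_cst.
by move=> n t _ _; rewrite powRr0 mul1r.
Qed.

Lemma regularD c c' : regular c -> regular c' ->
  regular (fun n t => c n t + c' n t).
Proof.
move=> [F [q [g [K [K0 q0 gc e]]]]] [F' [q' [g' [K' [K0' q0' gc' e']]]]].
exists (F + F')%type,
  (fun x : F + F' => match x with inl i => q i | inr i => q' i end),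
  (fun x : F + F' => match x with inl i => g i | inr i => g' i end),
  (K + K')%N; split.
- by rewrite addn_gt0 K0.
- by case.
- by case.
- by move=> n t Kt Kn; rewrite e ?e' ?big_sumType//; lia.
Qed.

Lemma regularM c c' : regular c -> regular c' ->
  regular (fun n t => c n t * c' n t).
Proof.
move=> [F [q [g [K [K0 q0 gc e]]]]] [F' [q' [g' [K' [K0' q0' gc' e']]]]].
exists (F * F')%type, (fun x : F * F' => q x.1 + q' x.2),
  (fun (x : F * F') t => g x.1 t * g' x.2 t), (K + K')%N; split.
- by rewrite addn_gt0 K0.
- by move=> x; rewrite addr_ge0.
- by move=> x; apply: is_cvgM.
- move=> n t Kt Kn; rewrite e ?e'; [|lia..].
  rewrite big_distrlr/= pair_bigA; apply: eq_bigr => -[i j] _ /=.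
  rewrite powRD; first by ring.
  apply/implyP => _; rewrite mulf_neq0 ?invr_eq0// pnatr_eq0; lia.
Qed.

Lemma regular_sum (J : Type) (s : seq J) (c : J -> nat -> nat -> R) :
  (forall j, regular (c j)) -> regular (fun n t => \sum_(j <- s) c j n t).
Proof.
move=> rc; elim: s => [|j s IH].
  by apply: (@eq_regular 0 _ _ _ (regular_cst 0)) => n t _ _; rewrite big_nil.
by apply: (@eq_regular 0 _ _ _ (regularD (rc j) IH)) => n t _ _; rewrite big_cons.
Qed.

Lemma regular_prod (J : Type) (s : seq J) (c : J -> nat -> nat -> R) :
  (forall j, regular (c j)) -> regular (fun n t => \prod_(j <- s) c j n t).
Proof.
move=> rc; elim: s => [|j s IH].
  by apply: (@eq_regular 0 _ _ _ (regular_cst 1)) => n t _ _; rewrite big_nil.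
by apply: (@eq_regular 0 _ _ _ (regularM (rc j) IH)) => n t _ _; rewrite big_cons.
Qed.

Lemma shift_ratio_cvg1 a b :
  (fun t : nat => (t + a - b)%N%:R / t%:R : R) @ \oo --> (1 : R).
Proof.
have h : (fun t : nat => 1 + (a%:R - b%:R) * t%:R^-1 : R) @ \oo --> (1 : R).
  rewrite -[X in _ --> X]addr0; apply: cvgD; first exact: cvg_cst.
  rewrite -[X in _ --> X](mulr0 (a%:R - b%:R)).
  by apply: cvgM; [exact: cvg_cst|exact: inv_nat_cvg0].
move: h; apply: cvg_trans; apply: near_eq_cvg; exists b.+1 => // t /= bt.
rewrite natrB ?natrD; last lia.
by field; rewrite pnatr_eq0; lia.
Qed.

(** The ratio [((t + a - b) / t) `^ q] tends to [1] and joins the convergent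
    factor. *)
Lemma regular_shift c a b : regular c -> regular (fun n t => c n (t + a - b)%N).
Proof.
move=> [F [q [g [K [K0 q0 gc e]]]]].
exists F, q, (fun i t => ((t + a - b)%N%:R / t%:R) `^ q i * g i (t + a - b)%N),
  (K + a + b)%N; split => //.
- by rewrite !addn_gt0 K0.
- move=> i; apply: is_cvgM.
    by apply/cvg_ex; exists 1; apply: powR_cvg1; exact: shift_ratio_cvg1.
  have /cvg_ex[l gl] := gc i; apply/cvg_ex; exists l.
  apply: (cvg_comp (fun t => t + a - b)%N (g i) _ gl).
  move=> A [N _ AN]; exists (N + b)%N => // t /= Nt; apply: AN => /=; lia.
- move=> n t Kt Kn; rewrite e; [|lia..]; apply: eq_bigr => i _.
  rewrite mulrA -powRM ?divr_ge0//; congr (_ `^ _ * _).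
  by field; rewrite !pnatr_eq0; lia.
Qed.

(** A difference of products is a sum of products with one factor replaced by a
    difference, which takes the rate [z]. *)
Lemma regular_telescope (J : Type) (s : seq J) (z : nat -> R)
    (A B : J -> nat -> nat -> R) :
  (forall j, regular (A j)) -> (forall j, regular (B j)) ->
  (forall j, regular (fun n t => z n * (A j n t - B j n t))) ->
  regular (fun n t => z n * (\prod_(j <- s) A j n t - \prod_(j <- s) B j n t)).
Proof.
move=> rA rB rAB; elim: s => [|j s IH].
  by apply: (@eq_regular 0 _ _ _ (regular_cst 0)) => n t _ _; rewrite !big_nil subrr mulr0.
apply: (@eq_regular 0 _ _ _
  (regularD (regularM (rAB j) (regular_prod s rA)) (regularM (rB j) IH))) => n t _ _.
by rewrite !big_cons; ring.
Qed.

Lemma ratio_powR_le1 n t q : 0 <= q -> (t < n)%N -> (t%:R / n%:R : R) `^ q <= 1.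
Proof.
move=> q0 tn; have n0 : 0 < n%:R :> R by rewrite ltr0n; lia.
apply: (@le_trans _ _ (1 `^ q)); last by rewrite powR1.
rewrite ge0_ler_powR ?nnegrE ?divr_ge0//.
by rewrite ler_pdivrMr// mul1r ler_nat ltnW.
Qed.

Lemma norm_mean_le n (u v : nat -> R) :
  (forall i, (i < n)%N -> `|u i| <= v i) -> `|mean u n| <= mean v n.
Proof.
move=> uv; rewrite /mean normrM ger0_norm ?invr_ge0// ler_wpM2l ?invr_ge0//.
by rewrite (le_trans (ler_norm_sum _ _ _))// ler_sum// => i _; exact: uv.
Qed.

(** Replacing [g] by its limit costs a Cesaro mean of [`|g t - l|]. *)
Lemma weighted_mean_cvg q (g : nat -> R) (l : R) : 0 <= q -> g @ \oo --> l ->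
  (fun n => mean (fun t => (t%:R / n%:R) `^ q * g t) n) @ \oo -->
  (q + 1)^-1 * l.
Proof.
move=> q0 gl.
have E n : mean (fun t => (t%:R / n%:R) `^ q * g t) n =
    mean (fun t => (t%:R / n%:R) `^ q) n * l +
    mean (fun t => (t%:R / n%:R) `^ q * (g t - l)) n.
  rewrite /mean -mulrA mulr_suml -mulrDr -big_split/=.
  by congr (_ * _); apply: eq_bigr => i _; ring.
suff d0 : (fun n => mean (fun t => (t%:R / n%:R) `^ q * (g t - l)) n) @ \oo --> (0 : R).
  have h : (fun n => mean (fun t => (t%:R / n%:R) `^ q) n * l) @ \oo -->
      (q + 1)^-1 * l.
    by apply: cvgM; [exact: power_mean_cvg|exact: cvg_cst].
  rewrite (_ : (fun n => _) = (fun n => mean (fun t => (t%:R / n%:R) `^ q) n * l +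
    mean (fun t => (t%:R / n%:R) `^ q * (g t - l)) n)); last exact/funext.
  by rewrite -[X in _ --> X]addr0; exact: cvgD.
apply/norm_cvg0P.
apply: (@squeeze_cvgr _ _ _ _ (fun=> 0) (fun n => mean (fun t => `|g t - l|) n)).
- apply: nearW => n; rewrite normr_ge0/=; apply: norm_mean_le => i ni.
  by rewrite normrM ger0_norm ?powR_ge0// ler_piMl// ratio_powR_le1.
- exact: cvg_cst.
- apply: cesaro_mean; apply/norm_cvg0P; rewrite -[X in _ --> X](subrr l).
  by apply: cvgB => //; exact: cvg_cst.
Qed.

Lemma boundary_count K n :
  (\sum_(i < n) (~~ ((K <= i) && (i + K <= n)) : nat) <= K + K)%N.
Proof.
have lo m : (\sum_(i < m) (i < K : nat) = minn m K)%N.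
  elim: m => [|m IH]; first by rewrite big_ord0 min0n.
  by rewrite big_ord_recr/= IH; case: ltnP; lia.
have hi m : (\sum_(i < m) (n < i + K : nat) = m - minn m (n.+1 - K))%N.
  elim: m => [|m IH]; first by rewrite big_ord0 min0n.
  by rewrite big_ord_recr/= IH; case: ltnP; lia.
apply: (@leq_trans (\sum_(i < n) ((i < K) + (n < i + K)))).
  by apply: leq_sum => i _; case: (leqP K i); case: (leqP (i + K) n).
by rewrite big_split/= lo hi; lia.
Qed.

(** Away from at most [2 * K] levels the array is given by the formula of
    [regular]; the other levels are negligible because the array is bounded. *)
Lemma mean_regular_cvg c B : regular c ->
  (forall n i, (i < n)%N -> `|c n i| <= B) -> cvgn (fun n => mean (c n) n).
Proof.
move=> [F [q [g [K [K0 q0 gc e]]]]] cB.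
pose c' n t : R := \sum_i (t%:R / n%:R) `^ (q i) * g i t.
have gB i : exists B, forall t, `|g i t| <= B.
  have [B' hB] := cvg_has_ub (gc i); exists B' => t; apply: hB; by exists t.
have {gB} [b gB] := choice gB.
have c'B n i : (i < n)%N -> `|c' n i| <= \sum_j b j.
  move=> ni; rewrite (le_trans (ler_norm_sum _ _ _))// ler_sum// => j _.
  by rewrite normrM ger0_norm ?powR_ge0// (le_trans (ler_piMl _ _))// ratio_powR_le1.
pose l := \sum_i (q i + 1)^-1 * limn (g i).
have c'l : (fun n => mean (c' n) n) @ \oo --> l.
  have -> : (fun n => mean (c' n) n) =
      (fun n => \sum_i mean (fun t => (t%:R / n%:R) `^ (q i) * g i t) n).
    by apply/funext => n; rewrite /mean -mulr_sumr exchange_big.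
  apply: cvg_sumr => i _; apply: weighted_mean_cvg => //; exact: gc.
have d0 : (fun n => mean (fun i => c n i - c' n i) n) @ \oo --> (0 : R).
  apply/norm_cvg0P.
  apply: (@squeeze_cvgr _ _ _ _ (fun=> 0)
     (fun n => n%:R^-1 * ((B + \sum_j b j) * (K + K)%:R))).
  - apply: nearW => n; rewrite normr_ge0/=.
    apply: (@le_trans _ _ (mean (fun i => (B + \sum_j b j) *
        (~~ ((K <= i) && (i + K <= n))%N)%:R) n)).
      apply: norm_mean_le => i ni; case: (boolP ((K <= i) && (i + K <= n))%N) => /=.
        by move=> /andP[Ki Kn]; rewrite /c' e// subrr normr0 mulr0.
      by rewrite mulr1 => _; rewrite (le_trans (ler_normB _ _))// lerD ?cB ?c'B.
    rewrite /mean; have [->|n0] := eqVneq n 0%N; first by rewrite invr0 !mul0r.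
    rewrite ler_wpM2l ?invr_ge0// -mulr_sumr ler_wpM2l//.
      have n1 : (0 < n)%N by lia.
      exact: addr_ge0 (le_trans (normr_ge0 _) (cB _ _ n1))
        (le_trans (normr_ge0 _) (c'B _ _ n1)).
    by rewrite -natr_sum ler_nat boundary_count.
  - exact: cvg_cst.
  - rewrite -[X in _ --> X](mul0r ((B + \sum_j b j) * (K + K)%:R)).
    by apply: cvgM; [exact: inv_nat_cvg0|exact: cvg_cst].
apply/cvg_ex; exists (0 + l).
rewrite (_ : (fun n => _) = (fun n => mean (fun i => c n i - c' n i) n + mean (c' n) n)).
  exact: cvgD.
apply/funext => n; rewrite /mean -mulrDr -big_split/=; congr (_ * _); apply: eq_bigr => i _; ring.
Qed.

End power_sums.

(** * Products of tridiagonal matrices and lattice walks *)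

Section lattice_walks.
Variable U : Type.

(** The matrix entries: [inl] for the diagonal, [inr] for the off-diagonal, with a
    letter and a level. The off-diagonal entry of level [q] joins the levels
    [q] and [q.+1]. *)
Definition site := (U * nat + U * nat)%type.

Definition on_site (f : nat -> nat) (v : site) : site :=
  match v with inl (u, q) => inl (u, f q) | inr (u, q) => inr (u, f q) end.

Definition level (v : site) : nat :=
  match v with inl (_, q) | inr (_, q) => q end.

(** The walks from level [a] to level [c] that read the word, as lists of entries.
    A step up from [a] uses the off-diagonal entry [a], a step down the entry
    [a.-1]. At [a = 0] the last branch is spurious: it is avoided by starting at a
    level at least as large as the length of the word. *)
Fixpoint walk (w : seq U) (a c : nat) : seq (seq site) :=
  match w with
  | [::] => if a == c then [:: [::]] else [::]
  | u :: w' => [seq inl (u, a) :: m | m <- walk w' a c] ++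
               [seq inr (u, a) :: m | m <- walk w' a.+1 c] ++
               [seq inr (u, a.-1) :: m | m <- walk w' a.-1 c]
  end.

Fixpoint levels_within (lo hi : nat) (m : seq site) : bool :=
  if m is v :: m' then (lo <= level v <= hi)%N && levels_within lo hi m' else true.

Lemma levels_withinW lo hi lo' hi' m : (lo' <= lo)%N -> (hi <= hi')%N ->
  levels_within lo hi m -> levels_within lo' hi' m.
Proof.
move=> hl hh; elim: m => //= v m IH /andP[/andP[h1 h2] /IH ->].
by rewrite andbT; lia.
Qed.

Lemma walk_levels w a c : all (levels_within (a - size w) (a + size w)) (walk w a c).
Proof.
elim: w a => [|u w IH] a /=; first by case: eqP.
rewrite !all_cat !all_map; apply/and3P; split.
- apply: sub_all (IH a) => m /= /(levels_withinW _ _) ->; lia.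
- apply: sub_all (IH a.+1) => m /= /(levels_withinW _ _) ->; lia.
- apply: sub_all (IH a.-1) => m /= /(levels_withinW _ _) ->; lia.
Qed.

Context {R : realType}.

Definition truncated (n : nat) (b : nat -> R) (q : nat) : R :=
  if (0 < q < n)%N then b q else 0.

(** Entries outside of the matrix are [0]: a walk that leaves the matrix then has
    weight [0], and the same walks serve all rows. *)
Definition entry_value (n : nat) (d b : U -> nat -> R) (v : site) : R :=
  match v with
  | inl (u, q) => if (0 < q <= n)%N then d u q else 0
  | inr (u, q) => truncated n (b u) q
  end.

(** In terms of the level [n - i] of the row, the only sums that survive are those
    over the level itself and its two neighbours. *)
Lemma tridiagonal_sum n (d b : nat -> R) (i : 'I_n) (g : nat -> R) :
  \sum_k tridiagonal n d b i k * g (n - k)%N =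
  d (n - i)%N * g (n - i)%N + truncated n b (n - i) * g (n - i).+1 +
  truncated n b (n - i).-1 * g (n - i).-1.
Proof.
have E (k : 'I_n) : tridiagonal n d b i k * g (n - k)%N =
    (if k == i :> nat then d (n - i)%N * g (n - i)%N else 0) +
    (if k == i.-1 :> nat then truncated n b (n - i) * g (n - i).+1 else 0) +
    (if k == i.+1 :> nat then truncated n b (n - i).-1 * g (n - i).-1 else 0).
  rewrite mxE /truncated; have := ltn_ord i; have := ltn_ord k.
  move: (nat_of_ord i) (nat_of_ord k) => {}i {}k kn ni.
  case: (eqVneq i k) => [iE|ik]; first subst i.
    have -> : (k == k.+1) = false by lia.
    rewrite /= addr0; case: eqP => [k0|_]; last by rewrite addr0.
    by rewrite [(_ < _ < _)%N](_ : _ = false) ?mul0r ?addr0//; lia.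
  rewrite add0r.
  case: (eqVneq k i.+1) => [kE|ki]; first subst k.
    have -> : (i.+1 == i.-1) = false by lia.
    rewrite /= add0r (_ : (0 < (n - i).-1 < n)%N = true); last lia.
    by have -> : (n - i.+1 = (n - i).-1)%N by lia.
  rewrite addr0; case: (eqVneq i k.+1) => [iE|ik1]; first subst i.
    rewrite /= eqxx (_ : (0 < n - k.+1 < n)%N = true); last lia.
    by have -> : ((n - k.+1).+1 = n - k)%N by lia.
  have -> : (k == i.-1) = false by lia.
  by rewrite mul0r.
under eq_bigr do rewrite E.
rewrite !big_split/= -!big_mkcond/=.
rewrite !(big_ord1_eq _ (fun=> _)) ltn_ord (leq_ltn_trans (leq_pred i) (ltn_ord i)).
congr (_ + _); rewrite /truncated; case: ifPn => // ni.
by rewrite [(_ < _ < _)%N](_ : _ = false) ?mul0r//; lia.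
Qed.

(** Levels of walks are relative: the relative level [M] is the level [p0] of the
    matrix. The condition [size w <= a] keeps relative levels nonnegative. *)
Lemma big_mulmx_walk n (d b : U -> nat -> R) p0 M c (j : 'I_n) :
  (n - j = p0 + c - M)%N ->
  forall w a (i : 'I_n), (n - i = p0 + a - M)%N -> (size w <= a)%N ->
  (\big[mulmx/1%:M]_(u <- w) tridiagonal n (d u) (b u)) i j =
  \sum_(m <- walk w a c) \prod_(v <- m)
    entry_value n d b (on_site (fun q => p0 + q - M)%N v).
Proof.
move=> jE; elim=> [|u w IH] a i iE wa /=.
  rewrite big_nil mxE; have := ltn_ord i; have := ltn_ord j => hi hj.
  have -> : (i == j) = (a == c) by apply/eqP/eqP => [/(congr1 val)/=|ac]; [lia|apply: val_inj => /=; lia].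
  by case: eqP => _; rewrite ?big_seq1 ?big_nil.
rewrite /= in wa; rewrite big_cons mxE; set Y := \big[mulmx/1%:M]_(_ <- w) _.
(* the rows as a function of the level; the value [0] outside of the range is
   multiplied by an entry that is [0] as well *)
pose g q : R := if insub (n - q)%N is Some k then Y k j else 0.
have gE (k : 'I_n) : g (n - k)%N = Y k j.
  rewrite /g subKn; last exact: ltnW.
  by rewrite valK.
under [LHS]eq_bigr do rewrite -gE.
rewrite tridiagonal_sum !big_cat/= !big_map addrA; have ni := ltn_ord i.
congr (_ + _ + _).
- rewrite gE (IH a)//; last exact: ltnW.
  rewrite mulr_sumr; apply: eq_bigr => m _; rewrite big_cons/= -iE.
  by rewrite (_ : (0 < n - i <= n)%N = true)//; lia.
- under [RHS]eq_bigr do rewrite big_cons/= -iE.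
  rewrite -mulr_sumr.
  have [pn|pn] := boolP (0 < n - i < n)%N; last by rewrite /truncated (negbTE pn) !mul0r.
  have kn : (n - (n - i).+1 < n)%N by lia.
  have -> : (n - i).+1 = (n - Ordinal kn)%N by rewrite /=; lia.
  by rewrite gE (IH a.+1)//=; lia.
- have qE : (p0 + a.-1 - M = (n - i).-1)%N by rewrite iE; lia.
  under [RHS]eq_bigr do rewrite big_cons/= qE.
  rewrite -mulr_sumr.
  have [pn|pn] := boolP (0 < (n - i).-1 < n)%N; last by rewrite /truncated (negbTE pn) !mul0r.
  have kn : (n - (n - i).-1 < n)%N by lia.
  have -> : (n - i).-1 = (n - Ordinal kn)%N by rewrite /=; lia.
  by rewrite gE (IH a.-1)//=; lia.
Qed.

End lattice_walks.

(** * Moments and covariances of the scaled entries *)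

Section tame.
Context {disp : measure_display} {T : measurableType disp} {R : realType}.
Variables (P : probability T R) (J : Type) (size_of : J -> nat) (e : R).
Implicit Types X Y : J -> T -> R.

(** Bounded moments at the scale [1], and fluctuations of order [size_of j ^ - e]. *)
Definition tame X := bounded_moments P X /\
  bounded_moments P (fun j w => (size_of j)%:R `^ e * (X j w - Ex P (X j))).

Lemma eq_tame X Y : (forall j, X j =1 Y j) -> tame X -> tame Y.
Proof.
by move=> XY; have -> : X = Y by apply/funext => j; apply/funext.
Qed.

Lemma tame_cst c : tame (fun _ _ => c).
Proof.
split; first exact: bm_const.
by apply: (bm_ext _ (bm_const P 0)) => j w; rewrite Ex_cst subrr mulr0.
Qed.

Lemma tameD X Y : tame X -> tame Y -> tame (fun j w => X j w + Y j w).
Proof.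
move=> [bX cX] [bY cY]; split; first exact: bmD.
apply: (bm_ext _ (bmD cX cY)) => j w.
by rewrite ExD; [ring|exact: bm_all_moments bX|exact: bm_all_moments bY].
Qed.

(** The fluctuation of a product is that of [(X - Ex X) * Y + Ex X * (Y - Ex Y)],
    centered. *)
Lemma tameM X Y : tame X -> tame Y -> tame (fun j w => X j w * Y j w).
Proof.
move=> [bX cX] [bY cY]; split; first exact: bmM.
have [K _ EK] := bm_Ex bX.
(* [Z] centered is the rescaled fluctuation of the product *)
pose Z j w := (size_of j)%:R `^ e * (X j w - Ex P (X j)) * Y j w +
  Ex P (X j) * ((size_of j)%:R `^ e * (Y j w - Ex P (Y j))).
have bZ : bounded_moments P Z by exact: bmD (bmM cX bY) (bmZ EK cY).
apply: (bm_ext _ (bm_center bZ)) => j w.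
have aX : all_moments P (X j) := bm_all_moments j bX.
have aY : all_moments P (Y j) := bm_all_moments j bY.
set s := (size_of j)%:R `^ e in Z bZ *.
have -> : Ex P (Z j) = s * Ex P (fun w => X j w * Y j w) - s * (Ex P (X j) * Ex P (Y j)).
  rewrite (eq_Ex P (Y := fun w => s * (X j w * Y j w) - s * Ex P (X j) * Ex P (Y j))); last first.
    by move=> w'; rewrite /Z -/s; ring.
  rewrite ExB; [|exact/amZ/amM|exact: am_cst].
  by rewrite ExZ ?Ex_cst ?mulrA//; exact: amM.
by rewrite /Z -/s; ring.
Qed.

Lemma tame_sum (I : Type) (s : seq I) (X : I -> J -> T -> R) :
  (forall i, tame (X i)) -> tame (fun j w => \sum_(i <- s) X i j w).
Proof.
move=> tX; elim: s => [|i s IH].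
  by apply: (eq_tame _ (tame_cst 0)) => j w; rewrite big_nil.
by apply: (eq_tame _ (tameD (tX i) IH)) => j w; rewrite big_cons.
Qed.

Lemma tame_prod (I : Type) (s : seq I) (X : I -> J -> T -> R) :
  (forall i, tame (X i)) -> tame (fun j w => \prod_(i <- s) X i j w).
Proof.
move=> tX; elim: s => [|i s IH].
  by apply: (eq_tame _ (tame_cst 1)) => j w; rewrite big_nil.
by apply: (eq_tame _ (tameM (tX i) IH)) => j w; rewrite big_cons.
Qed.

(** The entries depend on the size [n] and on the level [q]: [f] is the rate at which
    the fluctuations are known to be bounded at level [q], and [c] the
    deterministic normalization. *)
Lemma tame_scaled (p : J -> bool) (c c' f : J -> R) Y :
  bounded_moments P Y ->
  bounded_moments P (fun j w => f j * (Y j w - Ex P (Y j))) ->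
  (forall j, p j -> `|c j| <= 1 /\ `|c' j| <= 1) ->
  (forall j, p j -> (size_of j)%:R `^ e * c j = c' j * f j) ->
  tame (fun j w => if p j then c j * Y j w else 0).
Proof.
move=> bY cY c1 cE; split.
  have h : bounded_moments P (fun j w => (if p j then c j else 0) * Y j w).
    apply: (bmZ (K := 1)) => // j; case: ifPn => [/c1[]//|_]; by rewrite normr0.
  by apply: (bm_ext _ h) => j w; case: ifP => _; rewrite ?mul0r.
have h : bounded_moments P (fun j w => (if p j then c' j else 0) * (f j * (Y j w - Ex P (Y j)))).
  apply: (bmZ (K := 1)) => // j; case: ifPn => [/c1[]//|_]; by rewrite normr0.
apply: (bm_ext _ h) => j w; case: ifPn => pj; last by rewrite Ex_cst subrr mulr0 mul0r.
rewrite ExZ; last exact: bm_all_moments bY.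
by rewrite mulrA -cE//; ring.
Qed.

End tame.

Section null_sequences.
Context {R : realType}.

Lemma natr_powRN_cvg0 (q : R) : 0 < q -> (fun n => n%:R `^ (- q) : R) @ \oo --> (0 : R).
Proof.
move=> q0; apply/cvgr0Pnorm_le => eta eta0.
have : \forall n \near \oo, eta `^ (- q^-1) <= n%:R by exact: nbhs_infty_ger.
apply: filterS => n; rewrite ger0_norm ?powR_ge0// => hn.
have e0 : 0 < eta `^ (- q^-1) by rewrite powR_gt0.
have n0 : 0 < n%:R :> R := lt_le_trans e0 hn.
rewrite powRN -[leRHS]invrK lef_pV2 ?posrE ?invr_gt0 ?powR_gt0//.
apply: (@le_trans _ _ ((eta `^ (- q^-1)) `^ q)).
  by rewrite -powRrM mulNr mulVf ?gt_eqF// powR_inv1// ltW.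
by rewrite ge0_ler_powR ?nnegrE// ltW.
Qed.

Lemma bounded_mul_cvg0 (u v : nat -> R) B : u @ \oo --> (0 : R) ->
  (forall n, (0 < n)%N -> `|v n| <= B) -> (fun n => u n * v n) @ \oo --> (0 : R).
Proof.
move=> u0 vB; apply/norm_cvg0P.
apply: (@squeeze_cvgr _ _ _ _ (fun=> 0) (fun n => `|u n| * B)).
- exists 1%N => // n /= n1; rewrite normr_ge0/= normrM ler_wpM2l ?vB//.
- exact: cvg_cst.
- rewrite -[X in _ --> X](mul0r B); apply: cvgM; last exact: cvg_cst.
  exact/norm_cvg0P.
Qed.

End null_sequences.

(** Repeated factors are collected, so that the factors become independent. *)
Lemma prod_count_mem {K : eqType} {R : comNzRingType} (U l : seq K) (y : K -> R) :
  uniq U -> {subset l <= U} ->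
  \prod_(v <- l) y v = \prod_(v <- U) y v ^+ count_mem v l.
Proof.
move=> uU; elim: l => [|v l IH] lU.
  by rewrite big_nil big1// => i _; rewrite expr0.
rewrite big_cons IH => [|i il]; last by apply: lU; rewrite inE il orbT.
under [RHS]eq_bigr do rewrite /= exprD.
rewrite big_split/=; congr (_ * _).
rewrite (bigD1_seq v)//= ?eqxx ?expr1 ?big1 ?mulr1//; last by apply: lU; rewrite mem_head.
by move=> i iv; rewrite eq_sym (negbTE iv) expr0.
Qed.

Lemma powR_natM {R : realType} (y q : R) k : (y `^ q) ^+ k = y `^ (q * k%:R).
Proof. by rewrite -powR_mulrn ?powR_ge0// -powRrM. Qed.

Section scaled_entries.
Context {disp : measure_display} {T : measurableType disp} {R : realType}.
Variables (P : probability T R) (r : nat) (d b : 'I_r -> nat -> {RV P >-> R}).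
Variables (alpha eps : 'I_r -> R) (e : R).
Local Notation site := (site 'I_r).

Definition scaled_entry (n : nat) (v : site) (w : T) : R :=
  entry_value n (fun u q => n%:R `^ (- alpha u) * d u q w)
                (fun u q => n%:R `^ (- alpha u) * b u q w) v.

Let x u q w := b u q w / q%:R `^ alpha u.

Hypothesis alpha_gt0 : forall u, 0 < alpha u.
Hypothesis e_ge0 : 0 <= e.
Hypothesis e_eps : forall u, e <= eps u.
Hypothesis eps_alpha : forall u, eps u <= alpha u.
Hypothesis bm_d : forall u, bounded_moments P (fun q => d u q.+1 : T -> R).
Hypothesis bm_b : forall u, bounded_moments P (fun q => x u q.+1).
Hypothesis bm_center_b : forall u, bounded_moments P
  (fun q w => q.+1%:R `^ e * (x u q.+1 w - Ex P (x u q.+1))).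
Hypothesis indep : mutually_independent (@entry_index r) (entries d b).

Let e_alpha u : e <= alpha u.
Proof. exact: le_trans (e_eps u) (eps_alpha u). Qed.

Lemma scaled_d n u q w : scaled_entry n (inl (u, q)) w =
  if (0 < q <= n)%N then n%:R `^ (- alpha u) * d u q.-1.+1 w else 0.
Proof. by rewrite /scaled_entry/=; case: q. Qed.

(** The off-diagonal entry is normalized by its own level in the hypotheses and by
    the size of the matrix in the model. *)
Lemma scaled_b n u q w : scaled_entry n (inr (u, q)) w =
  if (0 < q < n)%N then (q%:R / n%:R) `^ alpha u * x u q.-1.+1 w else 0.
Proof.
rewrite /scaled_entry/= /truncated /x; case: q => //= q; case: ifPn => // qn.
rewrite powR_div powRN; field.
by rewrite !powR_eq0 !pnatr_eq0/=; lia.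
Qed.

Lemma natr_powRN_le1 n q : q <= 0 -> (n%:R : R) `^ q <= 1.
Proof.
move=> q0; case: n => [|n]; first by rewrite /powR eqxx lern1 leq_b1.
rewrite -(opprK q) powRN invf_le1 ?powR_gt0//.
apply: (@le_trans _ _ (1 `^ (- q))); first by rewrite powR1.
by rewrite ge0_ler_powR ?nnegrE ?oppr_ge0// ler1n.
Qed.

(** For the diagonal entries [e <= alpha u] makes the normalization dominate the rate;
    for the off-diagonal ones the rate [q ^ e] of the level is compared to [n ^ e]
    through [(q / n) ^ (alpha u - e) <= 1]. *)
Lemma tame_scaled_entry (g : nat * nat -> site) :
  (exists u, (forall j, exists q, g j = inl (u, q)) \/
             (forall j, exists q, g j = inr (u, q))) ->
  tame P fst e (fun j => scaled_entry j.1 (g j)).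
Proof.
move=> [u [gE|gE]]; have {gE}[h gE] := choice gE.
- have := @tame_scaled _ _ _ P (nat * nat)%type fst e (fun j => 0 < h j <= j.1)%N
    (fun j => j.1%:R `^ (- alpha u)) (fun j => j.1%:R `^ (e - alpha u)) (fun=> 1)
    (fun j => d u (h j).-1.+1).
  move=> H; apply: eq_tame; last apply: H => //.
  + by move=> j w; rewrite gE scaled_d.
  + exact: (bm_comp (fun j => (h j).-1) (bm_d u)).
  + have := bm_center (bm_comp (fun j => (h j).-1) (bm_d u)).
    by apply: bm_ext => j w /=; rewrite mul1r.
  + move=> j _; rewrite !ger0_norm ?powR_ge0//; split; apply: natr_powRN_le1.
      by rewrite oppr_le0 ltW.
    by rewrite subr_le0.
  + move=> j hj; rewrite mulr1 -powRD//; apply/implyP => _.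
    by rewrite pnatr_eq0; lia.
- have := @tame_scaled _ _ _ P (nat * nat)%type fst e (fun j => 0 < h j < j.1)%N
    (fun j => ((h j)%:R / j.1%:R) `^ alpha u)
    (fun j => ((h j)%:R / j.1%:R) `^ (alpha u - e)) (fun j => (h j).-1.+1%:R `^ e)
    (fun j => x u (h j).-1.+1).
  move=> H; apply: eq_tame; last apply: H => //.
  + by move=> j w; rewrite gE scaled_b.
  + exact: (bm_comp (fun j => (h j).-1) (bm_b u)).
  + exact: (bm_comp (fun j => (h j).-1) (bm_center_b u)).
  + move=> j /andP[_ hj]; rewrite !ger0_norm ?powR_ge0//; split; apply: ratio_powR_le1 => //.
      by rewrite ltW.
    by rewrite subr_ge0.
  + move=> j /andP[h0 hj]; rewrite prednK// !powR_div.
    have hn : (h j)%:R != 0 :> R by rewrite pnatr_eq0; lia.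
    have jn : j.1%:R != 0 :> R by rewrite pnatr_eq0; lia.
    rewrite !powRB ?hn ?jn ?implybT//; field.
    by rewrite !powR_eq0 !negb_and hn jn.
Qed.

Lemma all_moments_scaled n v : all_moments P (scaled_entry n v).
Proof.
have [] : tame P fst e (fun j : nat * nat => scaled_entry j.1 v).
  by apply: tame_scaled_entry; case: v => -[u q]; exists u; [left|right]; exists q.
by move=> /(bm_all_moments (n, 0%N)).
Qed.

Lemma block_measurable_scaled (D : set site) n v : (@entry_index r v -> D v) ->
  block_measurable (entries d b) D (scaled_entry n v).
Proof.
case: v => -[u q] Dv.
  rewrite (_ : scaled_entry _ _ = if (0 < q <= n)%N
    then fun w => n%:R `^ (- alpha u) * d u q w else fun=> 0); last first.
    by apply/funext => w; rewrite /scaled_entry/=; case: ifP.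
  case: ifPn => [/andP[q0 _]|_]; last exact: block_measurable_cst.
  apply: block_measurableM; first exact: block_measurable_cst.
  exact: (@block_measurable_RV _ _ _ P _ (entries d b) D (inl (u, q)) (Dv q0)).
rewrite (_ : scaled_entry _ _ = if (0 < q < n)%N
  then fun w => n%:R `^ (- alpha u) * b u q w else fun=> 0); last first.
  by apply/funext => w; rewrite /scaled_entry/= /truncated; case: ifP.
case: ifPn => [/andP[q0 _]|_]; last exact: block_measurable_cst.
apply: block_measurableM; first exact: block_measurable_cst.
exact: (@block_measurable_RV _ _ _ P _ (entries d b) D (inr (u, q)) (Dv q0)).
Qed.

Lemma Ex_prod_scaled n (K : eqType) (U : seq K) (f : K -> site) (k : K -> nat) :
  uniq (map f U) ->
  Ex P (fun w => \prod_(v <- U) scaled_entry n (f v) w ^+ k v) =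
  \prod_(v <- U) Ex P (fun w => scaled_entry n (f v) w ^+ k v).
Proof.
elim: U => [_|v U IH /= /andP[vU uU]].
  by rewrite big_nil (eq_Ex P (Y := fun=> 1)) ?Ex_cst// => w; rewrite big_nil.
rewrite big_cons -IH//.
have av : all_moments P (fun w => scaled_entry n (f v) w ^+ k v).
  by apply: amX; exact: all_moments_scaled.
have aU : all_moments P (fun w => \prod_(v <- U) scaled_entry n (f v) w ^+ k v).
  by apply: am_prod => i; apply: amX; exact: all_moments_scaled.
rewrite -(@ExM_blocks _ _ _ P _ _ _ indep
  [set y | @entry_index r y /\ y = f v] [set y | @entry_index r y /\ y \in map f U]).
- by apply: eq_Ex => w; rewrite big_cons.
- by move=> y [].
- by move=> y [].
- by move=> y [_ ->] [_ h]; move: vU; rewrite h.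
- by apply: block_measurableX; exact: block_measurable_scaled.
- apply: block_measurable_prod => i iU; apply: block_measurableX.
  by apply: block_measurable_scaled => ? /=; split=> //; exact: map_f.
- exact: am_integrable av.
- exact: am_integrable aU.
- exact: am_integrable (amM av aU).
Qed.

(** The weight of a walk with all its levels raised by [t]. *)
Definition monomial (n t : nat) (l : seq site) (w : T) : R :=
  \prod_(v <- l) scaled_entry n (on_site (addn t) v) w.

Definition site_moment (v : site) (k n t : nat) : R :=
  Ex P (fun w => scaled_entry n (on_site (addn t) v) w ^+ k).

Lemma Ex_monomial n t (U l : seq site) : uniq U -> {subset l <= U} ->
  Ex P (monomial n t l) = \prod_(v <- U) site_moment v (count_mem v l) n t.
Proof.
move=> uU lU; rewrite -(Ex_prod_scaled _ (f := on_site (addn t))).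
  by apply: eq_Ex => w; rewrite /monomial (prod_count_mem _ uU lU).
rewrite map_inj_uniq// => -[[u q]|[u q]] [[u' q']|[u' q']] //= [-> /eqP].
  by rewrite eqn_add2l => /eqP ->.
by rewrite eqn_add2l => /eqP ->.
Qed.

Variables (m : 'I_r -> nat -> R) (C : 'I_r -> nat -> nat -> R) (v : 'I_r -> R).
Hypothesis b_moment_cvg : forall u k,
  (fun n => Ex P (fun w => x u n w ^+ k)) @ \oo --> m u k.
Hypothesis b_cov_cvg : forall u k l, (0 < k)%N -> (0 < l)%N ->
  (fun n => n%:R `^ (2 * eps u) * (Ex P (fun w => x u n w ^+ (k + l)) -
     Ex P (fun w => x u n w ^+ k) * Ex P (fun w => x u n w ^+ l))) @ \oo --> C u k l.
Hypothesis d_var_cvg : forall u,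
  (fun n => Ex P (fun w => d u n w ^+ 2) - Ex P (d u n) ^+ 2) @ \oo --> v u.

Let am_d u n : (0 < n)%N -> all_moments P (d u n).
Proof. by case: n => // n _; exact: bm_all_moments (bm_d u). Qed.

Let am_x u n : (0 < n)%N -> all_moments P (x u n).
Proof. by case: n => // n _; exact: bm_all_moments (bm_b u). Qed.

Let shift_regular (c : nat -> nat -> R) a : regular c -> regular (fun n t => c n (t + a)%N).
Proof.
move=> /(regular_shift a 0); apply: (eq_regular (K := 0)) => n t _ _.
by rewrite subn0.
Qed.

Lemma Ex_scaled_d u k n t : (0 < t)%N -> (t + 1 <= n)%N ->
  Ex P (fun w => scaled_entry n (inl (u, t)) w ^+ k) =
  n%:R `^ (- (alpha u * k%:R)) * Ex P (fun w => d u t w ^+ k).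
Proof.
move=> t0 tn; rewrite -ExZ; last by apply: amX; exact: am_d.
apply: eq_Ex => w; rewrite scaled_d (_ : (0 < t <= n)%N = true) ?prednK//; last lia.
by rewrite exprMn powR_natM mulNr.
Qed.

Lemma Ex_scaled_b u k n t : (0 < t)%N -> (t + 1 <= n)%N ->
  Ex P (fun w => scaled_entry n (inr (u, t)) w ^+ k) =
  (t%:R / n%:R) `^ (alpha u * k%:R) * Ex P (fun w => x u t w ^+ k).
Proof.
move=> t0 tn; rewrite -ExZ; last by apply: amX; exact: am_x.
apply: eq_Ex => w; rewrite scaled_b (_ : (0 < t < n)%N = true) ?prednK//; last lia.
by rewrite exprMn powR_natM.
Qed.

Lemma d_moment_bounded u k : exists B, forall n, (0 < n)%N ->
  `|Ex P (fun w => d u n w ^+ k)| <= B.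
Proof.
have [B _ hB] := bm_Ex (bmX k (bm_d u)); exists B => -[//|n] _; exact: hB.
Qed.

Let ratio_powRN (q : R) n t : (0 < t)%N -> (0 < n)%N ->
  n%:R `^ (- q) = (t%:R / n%:R) `^ q * t%:R `^ (- q).
Proof.
move=> t0 n0; rewrite powR_div !powRN; field.
by rewrite !powR_eq0 !pnatr_eq0 !negb_and; lia.
Qed.

(** A diagonal moment of positive order tends to [0] like [n ^ - (alpha * k)]; an
    off-diagonal one is [(t / n) ^ (alpha * k)] times a convergent moment. *)
Lemma regular_site_moment y k : regular (site_moment y k).
Proof.
case: y => -[u a].
- pose c n t := Ex P (fun w => scaled_entry n (inl (u, t)) w ^+ k).
  suff rc : regular c.
    by apply: (eq_regular (K := 0)) (shift_regular a rc) => n t _ _; rewrite /c.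
  apply: (@regular_monomial _ 1 (alpha u * k%:R)
     (fun t => t%:R `^ (- (alpha u * k%:R)) * Ex P (fun w => d u t w ^+ k))).
  + by rewrite mulr_ge0// ltW.
  + case: k @c => [|k] _.
      rewrite (_ : (fun _ => _) = fun=> 1); first exact: is_cvg_cst.
      by apply/funext => t; rewrite mulr0 oppr0 powRr0 (eq_Ex P (Y := fun=> 1)) ?Ex_cst ?mul1r.
    have [B hB] := d_moment_bounded u k.+1.
    apply/cvg_ex; exists 0; apply: bounded_mul_cvg0 hB.
    by apply: natr_powRN_cvg0; rewrite mulr_gt0.
  + move=> n t t0 tn; rewrite /c Ex_scaled_d// mulrA -ratio_powRN//; lia.
- pose c n t := Ex P (fun w => scaled_entry n (inr (u, t)) w ^+ k).
  suff rc : regular c.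
    by apply: (eq_regular (K := 0)) (shift_regular a rc) => n t _ _; rewrite /c.
  apply: (@regular_monomial _ 1 (alpha u * k%:R) (fun t => Ex P (fun w => x u t w ^+ k))).
  + by rewrite mulr_ge0// ltW.
  + by apply/cvg_ex; exists (m u k); exact: b_moment_cvg.
  + by move=> n t t0 tn; rewrite /c Ex_scaled_b.
Qed.

Definition site_cov (y : site) (k l n t : nat) : R :=
  site_moment y (k + l) n t - site_moment y k n t * site_moment y l n t.

(** For positive [k] and [l] the exponent of [t / n] is [alpha * (k + l) - 2 * e],
    nonnegative because [e <= alpha] and [k + l >= 2]. For a diagonal entry it
    vanishes only if [k = l = 1] and [e = alpha], where the factor is the variance; otherwise
    the factor tends to [0]. For an off-diagonal entry the factor is
    [t ^ (2 * e)] times the covariance, whose natural rate is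
    [t ^ (2 * eps u)]: it tends to [C] if [e = eps u] and to [0] otherwise. *)
Lemma regular_site_cov y k l :
  regular (fun n t => n%:R `^ (2 * e) * site_cov y k l n t).
Proof.
have [->|k0] := posnP k.
  apply: (eq_regular (K := 0)) (regular_cst 0) => n t _ _; rewrite /site_cov.
  rewrite [site_moment y 0 n t](_ : _ = 1) ?mul1r ?subrr ?mulr0//.
  by rewrite /site_moment (eq_Ex P (Y := fun=> 1)) ?Ex_cst.
have [->|l0] := posnP l.
  apply: (eq_regular (K := 0)) (regular_cst 0) => n t _ _; rewrite /site_cov addn0.
  rewrite [site_moment y 0 n t](_ : _ = 1) ?mulr1 ?subrr ?mulr0//.
  by rewrite /site_moment (eq_Ex P (Y := fun=> 1)) ?Ex_cst.
have kl2 : 2 <= (k + l)%:R :> R by rewrite ler_nat; lia.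
case: y => -[u a].
- pose M k t := Ex P (fun w => d u t w ^+ k).
  pose q := alpha u * (k + l)%:R - 2 * e.
  have q0 : 0 <= q by have := e_alpha u; have := alpha_gt0 u; rewrite /q; nra.
  pose cv t := M (k + l)%N t - M k t * M l t.
  pose c n t := n%:R `^ (- q) * cv t.
  suff rc : regular c.
    apply: (eq_regular (K := a.+1)) (shift_regular a rc) => n t t0 tn.
    have nn : n%:R != 0 :> R by rewrite pnatr_eq0; lia.
    rewrite /c /site_cov /site_moment/= !Ex_scaled_d; [|lia..].
    have -> : - q = 2 * e + - (alpha u * k%:R) + - (alpha u * l%:R).
      by rewrite /q natrD; ring.
    have -> : - (alpha u * (k + l)%:R) = - (alpha u * k%:R) + - (alpha u * l%:R).
      by rewrite natrD; ring.
    by rewrite !powRD ?nn ?implybT// /cv /M; ring.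
  apply: (@regular_monomial _ 1 q (fun t => t%:R `^ (- q) * cv t)) => //; last first.
    by move=> n t t0 tn; rewrite /c mulrA -ratio_powRN//; lia.
  (* [q = 0] forces [k = l = 1] and the limit is the variance *)
  have [q_gt0|] := ltP 0 q; last first.
    move=> q_le0; have -> : q = 0 by apply/eqP; rewrite eq_le q_le0.
    have : (k + l)%:R <= 2 :> R.
      by have := e_alpha u; have := alpha_gt0 u; rewrite /q in q_le0; nra.
    rewrite ler_nat => kl; have [k1 l1] : k = 1%N /\ l = 1%N by lia.
    apply/cvg_ex; exists (v u); rewrite (_ : (fun _ => _) =
      (fun n => Ex P (fun w => d u n w ^+ 2) - Ex P (d u n) ^+ 2))//.
    by apply/funext => t; rewrite oppr0 powRr0 mul1r /cv /M k1 l1 expr2.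
  have [B1 h1] := d_moment_bounded u (k + l).
  have [B2 h2] := d_moment_bounded u k; have [B3 h3] := d_moment_bounded u l.
  apply/cvg_ex; exists 0.
  apply: (@bounded_mul_cvg0 _ _ _ (B1 + B2 * B3)); first exact: natr_powRN_cvg0.
  move=> t t0; rewrite (le_trans (ler_normB _ _))// lerD ?h1// normrM.
  by rewrite ler_pM ?h2 ?h3.
- pose M k t := Ex P (fun w => x u t w ^+ k).
  pose q := alpha u * (k + l)%:R - 2 * e.
  have q0 : 0 <= q by have := e_alpha u; have := alpha_gt0 u; rewrite /q; nra.
  pose cv t := M (k + l)%N t - M k t * M l t.
  pose c n t := (t%:R / n%:R) `^ q * (t%:R `^ (2 * e) * cv t).
  suff rc : regular c.
    apply: (eq_regular (K := a.+1)) (shift_regular a rc) => n t t0 tn.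
    have nn : n%:R != 0 :> R by rewrite pnatr_eq0; lia.
    rewrite /c /site_cov /site_moment/= !Ex_scaled_b; [|lia..].
    have tn0 : (t + a)%:R / n%:R != 0 :> R.
      by rewrite mulf_neq0 ?invr_eq0// pnatr_eq0; lia.
    have -> : (t + a)%:R `^ (2 * e) =
        n%:R `^ (2 * e) * ((t + a)%:R / n%:R) `^ (2 * e) :> R.
      by rewrite powR_div; field; rewrite powR_eq0 (negbTE nn).
    have kE : alpha u * k%:R = q + 2 * e - alpha u * l%:R by rewrite /q natrD; ring.
    have -> : alpha u * (k + l)%:R = q + 2 * e by rewrite /q natrD; ring.
    have E1 : ((t + a)%:R / n%:R) `^ (alpha u * k%:R) *
              ((t + a)%:R / n%:R) `^ (alpha u * l%:R) =
        ((t + a)%:R / n%:R) `^ q * ((t + a)%:R / n%:R) `^ (2 * e) :> R.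
      by rewrite -!powRD ?tn0 ?implybT// kE subrK.
    rewrite (@powRD _ _ q (2 * e)) ?tn0 ?implybT// /cv /M [X in _ = _ * (_ - X)]mulrACA E1; ring.
  apply: (@regular_monomial _ 1 q (fun t => t%:R `^ (2 * e) * cv t)) => //.
  (* if [e < eps u] there is a spare negative power of [t] *)
  have [eE|eneq] := eqVneq e (eps u).
    by apply/cvg_ex; exists (C u k l); rewrite eE; exact: b_cov_cvg.
  apply/cvg_ex; exists 0; rewrite -(mul0r (C u k l)).
  pose z t := t%:R `^ (- (2 * (eps u - e))) * (t%:R `^ (2 * eps u) * cv t).
  have z0 : z @ \oo --> 0 * C u k l.
    apply: cvgM; last exact: b_cov_cvg.
    apply: natr_powRN_cvg0; rewrite mulr_gt0// subr_gt0.
    by rewrite lt_neqAle eneq e_eps.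
  move: z0; apply: cvg_trans; apply: near_eq_cvg; exists 1%N => // t /= t0.
  have tn : t%:R != 0 :> R by rewrite pnatr_eq0; lia.
  by rewrite /z mulrA -powRD ?tn ?implybT//; congr (_ `^ _ * _); ring.
Qed.

(** Both expectations factor over the distinct entries; the difference of the two
    products telescopes into single-entry covariances. *)
Lemma regular_cov_monomial (l l' : seq site) :
  regular (fun n t => n%:R `^ (2 * e) *
    (Ex P (monomial n t (l ++ l')) - Ex P (monomial n t l) * Ex P (monomial n t l'))).
Proof.
pose U := undup (l ++ l'); have uU : uniq U by exact: undup_uniq.
have lU : {subset l <= U} by move=> y yl; rewrite mem_undup mem_cat yl.
have lU' : {subset l' <= U} by move=> y yl; rewrite mem_undup mem_cat yl orbT.
have llU : {subset l ++ l' <= U} by move=> y; rewrite mem_undup.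
pose A y n t := site_moment y (count_mem y l + count_mem y l') n t.
pose B y n t := site_moment y (count_mem y l) n t * site_moment y (count_mem y l') n t.
apply: (@eq_regular _ 0 _ _ _ (@regular_telescope _ _ U (fun n => n%:R `^ (2 * e)) A B _ _ _)).
- move=> n t _ _; rewrite !(Ex_monomial n t uU)// -big_split/=.
  congr (_ * (_ - _)); apply: eq_bigr => y _; rewrite /A count_cat//.
- by move=> y; exact: regular_site_moment.
- by move=> y; apply: regularM; exact: regular_site_moment.
- by move=> y; exact: regular_site_cov.
Qed.

End scaled_entries.

(** * Central limit theorem for sums of traces *)

Section fluctuations.
Context {disp : measure_display} {T : measurableType disp} {R : realType}.
Variables (P : probability T R) (r : nat) (d b : 'I_r -> nat -> {RV P >-> R}).
Variables (alpha : 'I_r -> R) (e : R).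
Local Notation site := (site 'I_r).
Local Notation scaled := (scaled_entry d b alpha).
Local Notation cov_monomial := (fun l l' n t => n%:R `^ (2 * e) *
    (Ex P (monomial d b alpha n t (l ++ l')) -
     Ex P (monomial d b alpha n t l) * Ex P (monomial d b alpha n t l'))).

Hypothesis all_moments_entry : forall n v, all_moments P (scaled n v).
Hypothesis tame_entry : forall v (f : nat * nat -> nat -> nat),
  tame P fst e (fun j => scaled j.1 (on_site (f j) v)).
Hypothesis indep : mutually_independent (@entry_index r) (entries d b).
Hypothesis regular_cov : forall l l' : seq site, regular (cov_monomial l l').

Variables (M : nat) (s : seq (seq 'I_r)).
Hypothesis sM : forall w, w \in s -> (size w <= M)%N.

Definition closed_walks : seq (seq site) := flatten [seq walk w M M | w <- s].

(** The diagonal entry at level [i.+1] of the products along the words, summed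
    over the words. *)
Definition diagonal_sum (n i : nat) (w : T) : R :=
  \sum_(l <- closed_walks) \prod_(v <- l)
    scaled n (on_site (fun q => i.+1 + q - M)%N v) w.

(** Extended by [0] out of range, so that the family is indexed by all pairs. *)
Definition fluctuation (x : nat * nat) : T -> R :=
  if (x.2 < x.1)%N then
    fun w => x.1%:R `^ e * (diagonal_sum x.1 x.2 w - Ex P (diagonal_sum x.1 x.2))
  else fun=> 0.
Local Notation V := fluctuation.

Definition within_distance (c i j : nat) : bool := (i <= j + c)%N && (j <= i + c)%N.

(** The entries that walks of length at most [M] from level [i.+1] can meet. *)
Definition block (i : nat) : set site :=
  [set y | @entry_index r y /\ within_distance M i.+1 (level y)].

Lemma closed_walks_levels l : l \in closed_walks -> levels_within 0 (M + M) l.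
Proof.
move=> /flattenP[_ /mapP[w ws ->] lw].
have /allP/(_ _ lw) := walk_levels w M M.
apply: levels_withinW => //; by rewrite leq_add2l sM.
Qed.

Lemma block_measurable_diagonal n i :
  block_measurable (entries d b) (block i) (diagonal_sum n i).
Proof.
apply: (@eq_block_measurable _ _ _ P _ _ _ (fun w => \sum_(l <- closed_walks | l \in closed_walks)
    \prod_(v <- l) scaled n (on_site (fun q => i.+1 + q - M)%N v) w)).
  by move=> w; rewrite /diagonal_sum [RHS]big_seq.
apply: block_measurable_sum => l /closed_walks_levels hl.
apply: block_measurable_prod => v vl; apply: block_measurable_scaled => ev; split=> //.
have : (level v <= M + M)%N.
  elim: l hl vl => // y l IH /= /andP[yM hl]; rewrite inE => /orP[/eqP -> //|vl].
  exact: IH.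
by rewrite /within_distance; case: v {vl ev} => -[u q] /=; lia.
Qed.

Lemma within_card c n i : (\sum_(j < n | within_distance c i j) 1 <= (c + c).+1)%N.
Proof.
suff -> : (\sum_(j < n | within_distance c i j) 1 = minn n (i + c).+1 - (i - c))%N by lia.
elim: n => [|n IH]; first by rewrite big_ord0 min0n.
by rewrite big_mkcond big_ord_recr/= -big_mkcond/= IH /within_distance; case: ifP; lia.
Qed.

Lemma sum_within (F : nat -> R) c n i : (c <= i)%N -> (i + c < n)%N ->
  \sum_(j < n | within_distance c i j) F j = \sum_(k < (c + c).+1) F (i + k - c)%N.
Proof.
move=> ci cn; rewrite -(big_mkord (within_distance c i)) -(big_mkord predT (fun k => F (i + k - c)%N)).
have -> : \sum_(0 <= k < (c + c).+1) F (i + k - c)%N =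
    \sum_(i - c <= j < (i + c).+1) F j.
  rewrite -{1}[(i - c)%N]add0n big_addn.
  have -> : ((i + c).+1 - (i - c) = (c + c).+1)%N by lia.
  by apply: eq_bigr => k _; congr F; lia.
rewrite [RHS](big_nat_widenl _ 0)// [RHS](big_nat_widen _ _ n)//.
by apply: eq_bigl => j; rewrite /within_distance/=; lia.
Qed.

Lemma tame_diagonal_sum : tame P fst e (fun x => diagonal_sum x.1 x.2).
Proof. by apply: tame_sum => l; apply: tame_prod => v; exact: tame_entry. Qed.

Lemma bm_fluctuation : bounded_moments P V.
Proof.
have [_ h] := tame_diagonal_sum.
apply: (bm_ext _ (bm_if (fun x => x.2 < x.1)%N h (bm_const P 0))) => x w.
by rewrite /V; case: ifP.
Qed.

Lemma all_moments_fluctuation x : all_moments P (V x).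
Proof. exact: bm_all_moments bm_fluctuation. Qed.

Lemma Ex_fluctuation x : Ex P (V x) = 0.
Proof.
rewrite /V; case: ifP => _; last exact: Ex_cst.
have a : all_moments P (diagonal_sum x.1 x.2) := bm_all_moments x tame_diagonal_sum.1.
by rewrite ExZ ?ExB ?Ex_cst ?subrr ?mulr0//; [exact: am_cst|exact/amB/am_cst].
Qed.

Lemma block_measurable_fluctuation n i :
  block_measurable (entries d b) (block i) (V (n, i)).
Proof.
rewrite /V; case: ifP => _ /=; last exact: block_measurable_cst.
apply: block_measurableM; first exact: block_measurable_cst.
apply: (block_measurableD (g := fun=> - Ex P (diagonal_sum n i))); last exact: block_measurable_cst.
exact: block_measurable_diagonal.
Qed.

Definition far_block (near : rel nat) (i : nat) : set site :=
  [set y | exists2 j, ~~ near i j & block j y].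

Lemma block_measurable_far (near : rel nat) n i k :
  block_measurable (entries d b) (far_block near i)
    (fun w => far V near (n, i) w ^+ k).
Proof.
apply: block_measurableX; apply: block_measurable_sum => j ij.
have h : block j `<=` far_block near i by move=> y jy; exists (val j).
exact: (block_measurable_sub h (@block_measurable_fluctuation n j)).
Qed.

Local Notation near1 := (within_distance (M + M)).
Local Notation near2 := (within_distance (M + M + (M + M))).

Let am_far near n i k : all_moments P (fun w => far V near (n, i) w ^+ k).
Proof. by apply: amX; apply: am_sum => j; exact: all_moments_fluctuation. Qed.

Lemma fluctuation_far1 n i k : (i < n)%N ->
  Ex P (fun w => V (n, i) w * far V near1 (n, i) w ^+ k) = 0.
Proof.
move=> ni; have aV := all_moments_fluctuation (n, i).
rewrite (ExM_blocks indep (D := block i) (D' := far_block near1 i)).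
- by rewrite Ex_fluctuation mul0r.
- by move=> y [].
- by move=> y [j _ []].
- by move=> y [_ iy] [j ij [_ jy]]; move: ij iy jy; rewrite /within_distance; lia.
- exact: block_measurable_fluctuation.
- exact: block_measurable_far.
- exact: am_integrable aV.
- exact: am_integrable (am_far _ _ _ _).
- exact: am_integrable (amM aV (am_far _ _ _ _)).
Qed.

Lemma fluctuation_far2 n i j k : (i < n)%N -> (j < n)%N -> near1 i j ->
  Ex P (fun w => V (n, i) w * V (n, j) w * far V near2 (n, i) w ^+ k) =
  Ex P (fun w => V (n, i) w * V (n, j) w) * Ex P (fun w => far V near2 (n, i) w ^+ k).
Proof.
move=> ni nj ij.
have aV := amM (all_moments_fluctuation (n, i)) (all_moments_fluctuation (n, j)).
rewrite (ExM_blocks indep (D := block i `|` block j) (D' := far_block near2 i))//.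
- by move=> y [[]|[]].
- by move=> y [l _ []].
- move=> y iy [l il [_ ly]]; move: ij il ly; rewrite /within_distance.
  by case: iy => -[_]; rewrite /within_distance; lia.
- have hi : block i `<=` block i `|` block j by move=> y; left.
  have hj : block j `<=` block i `|` block j by move=> y; right.
  apply: block_measurableM.
    exact: (block_measurable_sub hi (@block_measurable_fluctuation n i)).
  exact: (block_measurable_sub hj (@block_measurable_fluctuation n j)).
- exact: block_measurable_far.
- exact: am_integrable aV.
- exact: am_integrable (am_far _ _ _ _).
- exact: am_integrable (amM aV (am_far _ _ _ _)).
Qed.

Definition raise (a : nat) (l : seq site) := [seq on_site (addn a) v | v <- l].

(** Away from the ends of the range all levels are shifts of the common level
    [i + 1 - 3 * M], chosen so that no truncated subtraction occurs. *)
Lemma Ex_fluctuationM n i k : (3 * M <= i)%N -> (i + 3 * M < n)%N ->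
  (k < (M + M + (M + M)).+1)%N ->
  Ex P (fun w => V (n, i) w * V (n, i + k - (M + M))%N w) =
  \sum_(l <- closed_walks) \sum_(l' <- closed_walks)
    cov_monomial (raise (M + M) l) (raise k l') n (i + 1 - 3 * M)%N.
Proof.
move=> Mi iM kM; set t := (i + 1 - 3 * M)%N.
have E j c : (j + 1 + M + M = i + 1 + c)%N -> diagonal_sum n j =
    fun w => \sum_(l <- closed_walks) monomial d b alpha n t (raise c l) w.
  move=> jc; apply/funext => w; apply: eq_bigr => l _.
  rewrite /monomial big_map; apply: eq_bigr => v _.
  have qE q : (j.+1 + q - M = t + (c + q))%N by rewrite /t; lia.
  by case: v => -[u q] /=; rewrite qE.
have am_mono c l : all_moments P (monomial d b alpha n t (raise c l)).
  by apply: am_prod => v; exact: all_moments_entry.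
rewrite /V /= (_ : (i < n)%N = true); last lia.
rewrite (_ : (i + k - (M + M) < n)%N = true); last lia.
rewrite (E i (M + M)%N); last lia.
rewrite (E (i + k - (M + M))%N k); last lia.
set Q := (fun w => \sum_(l <- closed_walks) monomial d b alpha n t (raise (M + M) l) w).
set Q' := (fun w => \sum_(l <- closed_walks) monomial d b alpha n t (raise k l) w).
have aQ : all_moments P Q by rewrite /Q; apply: am_sum => l; exact: am_mono.
have aQ' : all_moments P Q' by rewrite /Q'; apply: am_sum => l; exact: am_mono.
have -> : Ex P (fun w => n%:R `^ e * (Q w - Ex P Q) * (n%:R `^ e * (Q' w - Ex P Q'))) =
    n%:R `^ (2 * e) * (Ex P (fun w => Q w * Q' w) - Ex P Q * Ex P Q').
  have -> : n%:R `^ (2 * e) = n%:R `^ e * n%:R `^ e :> R.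
    by rewrite -expr2 powR_natM mulrC.
  set z := n%:R `^ e.
  rewrite (eq_Ex P (Y := fun w => z * z * (Q w * Q' w) -
     z * z * (Ex P Q' * Q w + Ex P Q * Q' w - Ex P Q * Ex P Q'))); last first.
    by move=> w; ring.
  rewrite ExB ?ExZ ?ExB ?ExD ?ExZ ?Ex_cst//; first by ring.
  all: repeat first [exact: aQ | exact: aQ' | exact: am_cst | apply: amB | apply: amD | apply: amM].
have EQ : Ex P Q = \sum_(l <- closed_walks) Ex P (monomial d b alpha n t (raise (M + M) l)).
  by rewrite /Q Ex_sum.
have EQ' : Ex P Q' = \sum_(l <- closed_walks) Ex P (monomial d b alpha n t (raise k l)).
  by rewrite /Q' Ex_sum.
have EQQ : Ex P (fun w => Q w * Q' w) = \sum_(l <- closed_walks) \sum_(l' <- closed_walks)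
    Ex P (monomial d b alpha n t (raise (M + M) l ++ raise k l')).
  rewrite (eq_Ex P (Y := fun w => \sum_(l <- closed_walks) \sum_(l' <- closed_walks)
      monomial d b alpha n t (raise (M + M) l ++ raise k l') w)); last first.
    move=> w; rewrite /Q /Q' mulr_suml; apply: eq_bigr => l _.
    rewrite mulr_sumr; apply: eq_bigr => l' _.
    by rewrite /monomial big_cat.
  have am_cat l l' : all_moments P (monomial d b alpha n t (l ++ l')).
    by apply: am_prod => v; exact: all_moments_entry.
  rewrite Ex_sum; last by move=> l; apply: am_sum => l'; exact: am_cat.
  by apply: eq_bigr => l _; rewrite Ex_sum// => l'; exact: am_cat.
rewrite EQQ EQ EQ' mulr_suml -sumrB mulr_sumr; apply: eq_bigr => l _.
rewrite mulr_sumr -sumrB mulr_sumr; apply: eq_bigr => l' _; by [].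
Qed.

Definition window_cov n i : R := Ex P (fun w => V (n, i) w * window V near1 (n, i) w).

(** The window is a sum over [4 * M + 1] relative positions, each of which
    contributes finitely many covariances of monomials. *)
Lemma regular_window_cov : regular window_cov.
Proof.
have rc : regular (fun n t => \sum_(k < (M + M + (M + M)).+1)
    \sum_(l <- closed_walks) \sum_(l' <- closed_walks)
      cov_monomial (raise (M + M) l) (raise k l') n (t + 1 - 3 * M)%N).
  apply: regular_sum => k; apply: regular_sum => l; apply: regular_sum => l'.
  exact: (regular_shift 1 (3 * M) (regular_cov _ _)).
apply: (eq_regular (K := 3 * M + 1)) rc => n i Ki iK; rewrite /window_cov.
rewrite (eq_Ex P (Y := fun w => \sum_(k < (M + M + (M + M)).+1)
    V (n, i) w * V (n, i + k - (M + M))%N w)); last first.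
  move=> w; rewrite -mulr_sumr; congr (_ * _).
  by rewrite -(@sum_within (fun j => V (n, j) w) _ n)//; lia.
rewrite Ex_sum; last by move=> k; apply: amM; exact: all_moments_fluctuation.
by apply: eq_bigr => k _; rewrite Ex_fluctuationM//; lia.
Qed.

Lemma near_card c n i : (c <= M + M + (M + M))%N ->
  (\sum_(j < n | within_distance c i j) 1 <= (8 * M).+1)%N.
Proof. by move=> cM; apply: leq_trans (within_card _ _ _) _; lia. Qed.

Let near1K n i : (\sum_(j < n | near1 i j) 1 <= (8 * M).+1)%N.
Proof. by apply: near_card; lia. Qed.

Let near2K n i : (\sum_(j < n | near2 i j) 1 <= (8 * M).+1)%N.
Proof. exact: near_card. Qed.

(** Convergence of the variance is the only input of [moment_clt] that depends on
    the entries. *)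
Theorem fluctuation_clt : exists v : R,
  (fun n => Ex P (fun w => normalized_sum V n w ^+ 2)) @ \oo --> v /\
  forall k, (fun n => Ex P (fun w => normalized_sum V n w ^+ k)) @ \oo -->
    gaussian_moment v k.
Proof.
have [B _ cB] := bm_Ex (bmM bm_fluctuation (bm_window bm_fluctuation near1K)).
have c : cvgn (fun n => mean (window_cov n) n).
  by apply: (mean_regular_cvg (B := B) regular_window_cov) => n i _; exact: (cB (n, i)).
exists (limn (fun n => mean (window_cov n) n)).
have vc : (fun n => Ex P (fun w => normalized_sum V n w ^+ 2)) @ \oo -->
    limn (fun n => mean (window_cov n) n).
  move: c; apply: cvg_trans; apply: near_eq_cvg; apply: nearW => n /=.
  rewrite (variance_normalized_sum bm_fluctuation near1K fluctuation_far1) /mean mulr_sumr.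
  apply: eq_bigr => i _; congr (_ * _).
  by rewrite /scale exprVn sqr_sqrtr.
split=> //.
exact: (moment_clt bm_fluctuation near1K near2K fluctuation_far1 fluctuation_far2 vc).
Qed.

End fluctuations.

(** * From sums to joint moments *)

Section expectation.
Context {disp : measure_display} {T : measurableType disp} {R : realType}.
Variable P : probability T R.

Lemma expectation_Ex (X : T -> R) : all_moments P X -> 'E_P[X]%E = (Ex P X)%:E.
Proof.
move=> aX; rewrite unlock /Ex /Rintegral fineK//.
exact: integrable_fin_num (am_integrable aX).
Qed.

(** Under the expectation, polarization leaves only powers of partial sums. *)
Lemma mixed_moment (n N : nat) :
  (forall x : 'I_n -> R,
    \sum_(A : {ffun 'I_n -> bool})
      (\prod_i (if A i then 1 else -1)) * (\sum_(i | A i) x i) ^+ n =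
    N%:R * \prod_i x i) ->
  forall x : 'I_n -> T -> R, (forall i, all_moments P (x i)) ->
    N%:R * Ex P (fun w => \prod_i x i w) =
    \sum_(A : {ffun 'I_n -> bool}) (\prod_i (if A i then 1 else -1)) *
       Ex P (fun w => (\sum_(i | A i) x i w) ^+ n).
Proof.
move=> HN x ax.
have aA (A : {ffun 'I_n -> bool}) :
    all_moments P (fun w => (\sum_(i | A i) x i w) ^+ n).
  by apply: amX; exact: am_sum.
under eq_bigr do rewrite -ExZ//.
rewrite -Ex_sum; last by move=> A; exact: amZ.
rewrite -ExZ; last exact: am_prod.
by apply: eq_Ex => w; rewrite -HN.
Qed.

End expectation.

Section gaussian_limit.
Context {disp : measure_display} {T : measurableType disp} {R : realType}.
Variables (P : probability T R) (I : countType) (S : nat -> I -> T -> R).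
Hypothesis all_moments_S : forall n i, all_moments P (S n i).
Hypothesis sum_clt : forall s : seq I, exists v : R,
  (fun n => Ex P (fun w => (\sum_(i <- s) S n i w) ^+ 2)) @ \oo --> v /\
  forall k, (fun n => Ex P (fun w => (\sum_(i <- s) S n i w) ^+ k)) @ \oo -->
    gaussian_moment v k.

Let am_sumS n (s : seq I) : all_moments P (fun w => \sum_(i <- s) S n i w).
Proof. exact: am_sum. Qed.

(** The covariance is a combination of second moments of sums, which converge. *)
Lemma limit_covariance : exists K : I -> I -> R, forall i j,
  (fun n => Ex P (fun w => S n i w * S n j w)) @ \oo --> K i j.
Proof.
suff h (p : I * I) : exists k : R,
    (fun n => Ex P (fun w => S n p.1 w * S n p.2 w)) @ \oo --> k.
  by have [K hK] := choice h; exists (fun i j => K (i, j)) => i j; exact: (hK (i, j)).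
case: p => i j /=.
have [v [hv _]] := sum_clt [:: i; j].
have [v1 [hv1 _]] := sum_clt [:: i]; have [v2 [hv2 _]] := sum_clt [:: j].
exists (2^-1 * (v - v1 - v2)).
have h : (fun n => 2^-1 * (Ex P (fun w => (\sum_(i <- [:: i; j]) S n i w) ^+ 2) -
    Ex P (fun w => (\sum_(i <- [:: i]) S n i w) ^+ 2) -
    Ex P (fun w => (\sum_(i <- [:: j]) S n i w) ^+ 2))) @ \oo -->
    2^-1 * (v - v1 - v2).
  by apply: cvgM; [exact: cvg_cst|apply: cvgB => //; exact: cvgB].
move: h; apply: cvg_trans; apply: near_eq_cvg; apply: nearW => n.
rewrite -!ExB -?ExZ; first by apply: eq_Ex => w; rewrite !big_cons !big_nil; field.
all: repeat first [apply: amB | apply: amX | exact: am_sumS].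
Qed.

(** It suffices to treat all powers of finite sums, where an index may be repeated:
    the limits identify the covariance kernel, and polarization gives the joint
    moments. *)
Lemma cvg_moments_gaussian : cvg_moments_to_gaussian_family P S.
Proof.
have [K hK] := limit_covariance.
have comb_cvg (t : seq (R * I)) :
    (fun n => Ex P (fun w => (\sum_(p <- t) p.1 * S n p.2 w) ^+ 2)) @ \oo --> qform K t.
  have h : (fun n => \sum_(p <- t) \sum_(q <- t)
      p.1 * q.1 * Ex P (fun w => S n p.2 w * S n q.2 w)) @ \oo --> qform K t.
    apply: cvg_sumr => p _; apply: cvg_sumr => q _.
    by apply: cvgM; [exact: cvg_cst|exact: hK].
  move: h; apply: cvg_trans; apply: near_eq_cvg; apply: nearW => n.
  have aM p q : all_moments P (fun w => p.1 * q.1 * (S n p.2 w * S n q.2 w)).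
    by apply: amZ; exact: amM.
  have EM p q : p.1 * q.1 * Ex P (fun w => S n p.2 w * S n q.2 w) =
      Ex P (fun w => p.1 * q.1 * (S n p.2 w * S n q.2 w)).
    by rewrite ExZ//; exact: amM.
  have ES p : \sum_(q <- t) p.1 * q.1 * Ex P (fun w => S n p.2 w * S n q.2 w) =
      Ex P (fun w => \sum_(q <- t) p.1 * q.1 * (S n p.2 w * S n q.2 w)).
    by rewrite Ex_sum//; apply: eq_bigr => q _; exact: EM.
  rewrite (eq_bigr _ (fun p _ => ES p)).
  rewrite -Ex_sum; last by move=> p; apply: am_sum => q; exact: aM.
  apply: eq_Ex => w; rewrite expr2 mulr_suml; apply: eq_bigr => p _.
  by rewrite mulr_sumr; apply: eq_bigr => q _; ring.
(* positivity passes to the limit of the second moments *)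
have psdK : psd K.
  split=> [i j|t].
    apply: (@cvg_unique _ _ (fmap (fun n => Ex P (fun w => S n i w * S n j w)) \oo)).
    - exact: norm_hausdorff.
    - exact: hK.
    - move: (hK j i); apply: cvg_trans; apply: near_eq_cvg; apply: nearW => n.
      by apply: eq_Ex => w; rewrite mulrC.
  have c := comb_cvg t; rewrite -(cvg_lim _ c)//.
  apply: limr_ge; first by apply/cvg_ex; exists (qform K t).
  by apply: nearW => n; apply: Ex_ge0 => w; exact: sqr_ge0.
exists _, _, (@unit_law R), (gaussian_family K); split.
  exact: jointly_gaussian_family.
have aG : forall i, all_moments unit_law (gaussian_family K i).
  by move=> i; exact: all_moments_gaussian_family.
move=> s; rewrite expectation_Ex; last exact: am_prod.
rewrite (_ : (fun n => _) = (fun n => (Ex P (fun w => \prod_(i <- s) S n i w))%:E)); last first.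
  by apply/funext => n; rewrite expectation_Ex//; exact: am_prod.
apply: cvg_EFin; first exact: nearW.
rewrite (_ : _ \o _ = (fun n => Ex P (fun w => \prod_(i <- s) S n i w)))//.
have sum_cvg (u : seq I) k :
    (fun n => Ex P (fun w => (\sum_(i <- u) S n i w) ^+ k)) @ \oo -->
    Ex unit_law (fun w => (\sum_(i <- u) gaussian_family K i w) ^+ k).
  have [v [hv /(_ k)]] := sum_clt u; rewrite (Ex_gaussian_family psdK).
  suff -> : v = \sum_(i <- u) \sum_(j <- u) K i j by [].
  apply: (@cvg_unique _ _ (fmap (fun n => Ex P (fun w => (\sum_(i <- u) S n i w) ^+ 2)) \oo)).
  - exact: norm_hausdorff.
  - exact: hv.
  - have := comb_cvg [seq (1, i) | i <- u].
    have -> : qform K [seq (1, i) | i <- u] = \sum_(i <- u) \sum_(j <- u) K i j.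
      rewrite /qform big_map; apply: eq_bigr => i _; rewrite big_map.
      by apply: eq_bigr => j _; rewrite !mul1r.
    apply: cvg_trans; apply: near_eq_cvg; apply: nearW => n.
    apply: eq_Ex => w; congr (_ ^+ _); rewrite big_map.
    by apply: eq_bigr => i _; rewrite mul1r.
pose k := size s.
have [N N0 HN] := polarization R k.
have prodE (U : Type) (z : I -> U -> R) w :
    \prod_(i <- s) z i w = \prod_(j < k) z (tnth (in_tuple s) j) w.
  by rewrite -(big_tnth _ _ s predT (fun i => z i w)).
have sumE (U : Type) (z : I -> U -> R) (A : {ffun 'I_k -> bool}) w :
    \sum_(j < k | A j) z (tnth (in_tuple s) j) w =
    \sum_(i <- [seq tnth (in_tuple s) j | j <- enum 'I_k & A j]) z i w.
  by rewrite big_map big_filter big_enum_cond.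
have NR : N%:R != 0 :> R by rewrite pnatr_eq0 -lt0n.
rewrite (eq_Ex _ (prodE _ _)) -[X in _ --> X](mulKf NR).
rewrite (mixed_moment HN (fun j => aG (tnth (in_tuple s) j))).
have h : (fun n => N%:R^-1 * \sum_(A : {ffun 'I_k -> bool}) (\prod_i (if A i then 1 else -1)) *
       Ex P (fun w => (\sum_(i | A i) S n (tnth (in_tuple s) i) w) ^+ k)) @ \oo -->
   N%:R^-1 * \sum_(A : {ffun 'I_k -> bool}) (\prod_i (if A i then 1 else -1)) *
       Ex unit_law (fun w => (\sum_(i | A i) gaussian_family K (tnth (in_tuple s) i) w) ^+ k).
  apply: cvgM; [exact: cvg_cst|apply: cvg_sumr => A _].
  apply: cvgM; first exact: cvg_cst.
  rewrite (@eq_Ex _ _ _ unit_law (fun w => (\sum_(i | A i) gaussian_family K (tnth (in_tuple s) i) w) ^+ k)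
    (fun w => (\sum_(i <- [seq tnth (in_tuple s) j | j <- enum 'I_k & A j]) gaussian_family K i w) ^+ k)); last first.
    by move=> w; rewrite (sumE _ (fun i w => gaussian_family K i w)).
  move: (sum_cvg [seq tnth (in_tuple s) j | j <- enum 'I_k & A j] k).
  apply: cvg_trans; apply: near_eq_cvg; apply: nearW => n.
  by apply: eq_Ex => w; rewrite sumE.
move: h; apply: cvg_trans; apply: near_eq_cvg; apply: nearW => n.
rewrite -(mixed_moment HN (fun j => all_moments_S n (tnth (in_tuple s) j))) mulKf//.
by apply: eq_Ex => w; rewrite prodE.
Qed.

End gaussian_limit.

(** * The trace statistics as normalized sums *)

Section matrix_words.
Context {disp : measure_display} {T : measurableType disp} {R : realType}.
Variables (P : probability T R) (r : nat) (d b : 'I_r -> nat -> {RV P >-> R}).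
Variables (alpha : 'I_r -> R) (e : R).

Lemma X_mx_tridiagonal u n (w : T) : X_mx alpha d b u n w =
  tridiagonal n (fun q => n%:R `^ (- alpha u) * d u q w)
                (fun q => n%:R `^ (- alpha u) * b u q w).
Proof.
apply/matrixP => i j; rewrite !mxE; case: ifP => // _; case: ifP => // _.
by case: ifP => // _; rewrite mulr0.
Qed.

(** Rows are summed in the reverse order, so that the level is [i.+1]. *)
Lemma tr_word_walks (M : nat) (u : seq 'I_r) n w : (size u <= M)%N ->
  tr_word alpha d b n u w = n%:R^-1 * \sum_(i < n) \sum_(l <- walk u M M)
    \prod_(v <- l) scaled_entry d b alpha n (on_site (fun q => i.+1 + q - M)%N v) w.
Proof.
move=> uM; rewrite /tr_word /ntrace /mxtrace; congr (_ * _).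
(* row [i] has level [n - i] *)
rewrite [RHS](reindex_inj rev_ord_inj)/=; apply: eq_bigr => i _.
under eq_bigr do rewrite X_mx_tridiagonal.
have ni := ltn_ord i.
rewrite (@big_mulmx_walk _ _ n _ _ (n - i)%N M M i _ u M i)//; try lia.
apply: eq_bigr => l _; apply: eq_bigr => v _.
rewrite /scaled_entry; congr (entry_value _ _ _ (on_site _ v)).
by apply/funext => q; lia.
Qed.

Hypothesis all_moments_entry : forall n v, all_moments P (scaled_entry d b alpha n v).

Lemma all_moments_tr_word u n : all_moments P (tr_word alpha d b n u).
Proof.
rewrite (funext (fun w => tr_word_walks n w (leqnn (size u)))).
by apply: amZ; apply: am_sum => i; apply: am_sum => l; apply: am_prod.
Qed.

Lemma all_moments_S_stat n u : all_moments P (S_stat P alpha d b e n u).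
Proof. by apply: amZ; apply: amB; [exact: all_moments_tr_word|exact: am_cst]. Qed.

(** The exponents match as [n ^ (e + 1/2) / n = n ^ e * n ^ (- 1/2)]. *)
Lemma sum_S_stat (M : nat) (s : seq (word r)) n w :
  (forall u, u \in map val s -> (size u <= M)%N) ->
  \sum_(u <- s) S_stat P alpha d b e n u w =
  normalized_sum (fluctuation d b alpha e M (map val s)) n w.
Proof.
move=> sM.
pose Q i w := diagonal_sum d b alpha M (map val s) n i w.
have aQ i : all_moments P (Q i) by apply: am_sum => l; apply: am_prod.
have trE w' : \sum_(u <- s) tr_word alpha d b n (val u) w' = n%:R^-1 * \sum_(i < n) Q i w'.
  have -> : \sum_(i < n) Q i w' = \sum_(u <- s) \sum_(i < n) \sum_(l <- walk (val u) M M)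
      \prod_(v <- l) scaled_entry d b alpha n (on_site (fun q => i.+1 + q - M)%N v) w'.
    rewrite [RHS]exchange_big/=; apply: eq_bigr => i _.
    by rewrite /Q /diagonal_sum /closed_walks big_flatten !big_map.
  rewrite [RHS]mulr_sumr [LHS]big_seq [RHS]big_seq.
  by apply: eq_bigr => u us; rewrite (@tr_word_walks M)// sM// map_f.
have -> : \sum_(u <- s) S_stat P alpha d b e n u w = n%:R `^ (e + 2^-1) *
    (\sum_(u <- s) tr_word alpha d b n (val u) w -
     Ex P (fun w => \sum_(u <- s) tr_word alpha d b n (val u) w)).
  rewrite Ex_sum => [|u]; last exact: all_moments_tr_word.
  rewrite -sumrB mulr_sumr; apply: eq_bigr => u _.
  rewrite /S_stat /centered expectation_Ex//; exact: all_moments_tr_word.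
rewrite (eq_Ex P trE) trE ExZ; last exact: am_sum.
rewrite Ex_sum// -mulrBr -sumrB mulrA /normalized_sum.
have -> : \sum_(j < n) fluctuation d b alpha e M [seq val i | i <- s] (n, val j) w =
    n%:R `^ e * \sum_(j < n) (Q j w - Ex P (Q j)).
  rewrite mulr_sumr; apply: eq_bigr => j _.
  by rewrite /fluctuation /= ltn_ord.
rewrite mulrA; have [->|n0] := eqVneq n 0%N; first by rewrite !big_ord0 !mulr0.
congr (_ * _); have nR : n%:R != 0 :> R by rewrite pnatr_eq0.
rewrite powRD ?nR ?implybT// powR12_sqrt// /scale.
have sn : Num.sqrt n%:R != 0 :> R by rewrite sqrtr_eq0 -ltNge ltr0n lt0n.
have -> : n%:R^-1 = (Num.sqrt n%:R)^-1 * (Num.sqrt n%:R)^-1 :> R.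
  by rewrite -invfM -expr2 sqr_sqrtr.
by field.
Qed.

End matrix_words.

(** * The limit theorem *)

Section real_hypotheses.
Context {disp : measure_display} {T : measurableType disp} {R : realType}.
Variable P : probability T R.

Lemma fine_expectation (X : T -> R) : fine 'E_P[X]%E = Ex P X.
Proof. by rewrite unlock. Qed.

Lemma Ex_cvg (X : nat -> T -> R) (l : R) : 'E_P[X n]%E @[n --> \oo] --> l%:E ->
  (fun n => Ex P (X n)) @ \oo --> l.
Proof.
move=> /fine_cvg; apply: cvg_trans; apply: near_eq_cvg; apply: nearW => n /=.
by rewrite fine_expectation.
Qed.

Lemma fine_covariance (X Y : T -> R) : all_moments P X -> all_moments P Y ->
  covariance P X Y = (Ex P (fun w => X w * Y w) - Ex P X * Ex P Y)%:E.
Proof.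
move=> aX aY; rewrite covariance.unlock !fine_expectation expectation_Ex; last first.
  by apply: amM; apply: amB => //; exact: am_cst.
congr (_%:E).
rewrite (eq_Ex P (Y := fun w => X w * Y w - (Ex P Y * X w + Ex P X * Y w - Ex P X * Ex P Y))); last first.
  by move=> w; rewrite !fctE /=; ring.
rewrite ExB ?ExB ?ExD ?ExZ ?ExZ ?Ex_cst//; first by ring.
all: repeat first [exact: aX | exact: aY | exact: am_cst | apply: amB | apply: amD | apply: amM].
Qed.

Lemma bounded_moments_sup (X : nat -> T -> R) :
  (forall n, (0 < n)%N -> measurable_fun setT (X n)) ->
  (forall k, (0 < k)%N ->
    (ereal_sup [set 'E_P[fun w => (`|X n w| ^+ k)%R] | n in [set n | (1 <= n)%N]] < +oo)%E) ->
  bounded_moments P (fun n => X n.+1).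
Proof.
move=> mX bX; split=> [n|[|k]]; first exact: mX.
  exists 1 => n; under eq_integral do rewrite expr0.
  by rewrite integral_cst//= probability_setT mule1.
move: (bX k.+1 isT); set s := ereal_sup _ => sy.
have hS n : (\int[P]_w (`|X n.+1 w| ^+ k.+1)%:E <= s)%E.
  by apply: ereal_sup_ubound; exists n.+1 => //; rewrite unlock.
exists (fine s) => n.
by rewrite fineK// ge0_fin_numE// (le_trans _ (hS 0%N))// integral_ge0.
Qed.

Lemma all_moments_finite (X : T -> R) : finite_moments P X -> all_moments P X.
Proof.
move=> fX; apply: bm_of_Ex => [_ k|k]; first exact: fX.
by exists (Ex P (fun w => X w ^+ (k * 2))).
Qed.

(** Convergent moments of even order are bounded. The index starts at [1] because
    nothing is known of the variable of index [0]. *)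
Lemma bounded_moments_cvg (X : nat -> T -> R) :
  (forall n, (0 < n)%N -> all_moments P (X n)) ->
  (forall k, cvgn (fun n => Ex P (fun w => X n w ^+ k))) ->
  bounded_moments P (fun n => X n.+1).
Proof.
move=> aX cX; apply: bm_of_Ex => [n k|k].
  by apply: (am_integrable (X := fun w => X n.+1 w ^+ k)); apply: amX; exact: aX.
have [B hB] := cvg_has_ub (cX (k * 2)%N); exists B => n.
by apply: (le_trans (ler_norm _)); apply: hB; exists n.+1.
Qed.

End real_hypotheses.

Unset Implicit Arguments.
Set Strict Implicit.
Set Printing Implicit Defensive.

Theorem theorem5
  (R : realType) (disp : measure_display) (T : measurableType disp)
  (P : probability T R)
  (r : nat) (hr : (0 < r)%N)
  (d b : 'I_r -> nat -> {RV P >-> R})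
  (d_moments : forall u n, (1 <= n)%N -> finite_moments P (d u n))
  (b_moments : forall u n, (1 <= n)%N -> finite_moments P (b u n))
  (alpha : 'I_r -> R) (alpha_gt0 : forall u, 0 < alpha u)
  (m : 'I_r -> nat -> R) (m0 : forall u, m u 0%N = 1)
  (b_cvg : forall u (k : nat),
     'E_P[fun w => (normalized (alpha u) (b u) n w ^+ k)%R]%E @[n --> \oo] -->
     (m u k)%:E)
  (d_bounded : forall u (k : nat),
     (ereal_sup [set 'E_P[fun w => (`|d u n w| ^+ k)%R] | n in
                 [set n | (1 <= n)%N]] < +oo)%E)
  (indep : mutually_independent (@entry_index r) (entries d b))
  (eps : 'I_r -> R) (eps_bounds : forall u, 0 <= eps u <= alpha u)
  (C : 'I_r -> nat -> nat -> R)
  (b_cov : forall u (k l : nat), (1 <= k)%N -> (1 <= l)%N ->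
     ((n%:R `^ (2 * eps u))%R%:E *
      covariance P (fun w => (normalized (alpha u) (b u) n w ^+ k)%R)
                   (fun w => (normalized (alpha u) (b u) n w ^+ l)%R))%E
     @[n --> \oo] --> (C u k l)%:E)
  (b_bounded : forall u (k p : nat), (1 <= k)%N -> (1 <= p)%N ->
     (ereal_sup
        [set 'E_P[fun w => (`|n%:R `^ min_over hr eps *
            centered P (fun w' => normalized (alpha u) (b u) n w' ^+ k) w|
          ^+ p)%R] | n in [set n | (1 <= n)%N]] < +oo)%E)
  (sigma : 'I_r -> R)
  (d_var : forall u, 'V_P[d u n]%E @[n --> \oo] --> (sigma u ^+ 2)%:E) :
  cvg_moments_to_gaussian_family P
    (S_stat P alpha d b (min_over hr eps)).
Proof.
set e := min_over hr eps.
pose x u n := normalized (alpha u) (b u) n.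
have eps0 u : 0 <= eps u by case/andP: (eps_bounds u).
have e0 : 0 <= e by exact: le_bigmin.
have e_eps u : e <= eps u by exact: bigmin_le.
have eps_alpha u : eps u <= alpha u by case/andP: (eps_bounds u).
have am_d u n : (0 < n)%N -> all_moments P (d u n).
  by move=> n0; apply: all_moments_finite; exact: d_moments.
have am_x u n : (0 < n)%N -> all_moments P (x u n).
  move=> n0; have := all_moments_finite (b_moments u n n0) => /(amZ (n%:R `^ alpha u)^-1).
  by apply: bm_ext => _ w; rewrite /x /normalized mulrC.
have x_cvg u k : (fun n => Ex P (fun w => x u n w ^+ k)) @ \oo --> m u k.
  exact: Ex_cvg (b_cvg u k).
have bm_d u : bounded_moments P (fun n => d u n.+1 : T -> R).
  by apply: (@bounded_moments_sup _ _ _ P (fun n => d u n : T -> R)) => [n _|k _]; [exact: measurable_funPT|exact: d_bounded].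
have bm_x u : bounded_moments P (fun n => x u n.+1).
  apply: bounded_moments_cvg => [n|k]; first exact: am_x.
  by apply/cvg_ex; exists (m u k).
have bm_center_x u : bounded_moments P
    (fun n w => n.+1%:R `^ e * (x u n.+1 w - Ex P (x u n.+1))).
  apply: (@bounded_moments_sup _ _ _ P (fun n w => n%:R `^ e * (x u n w - Ex P (x u n)))).
    move=> n n0.
    have a : all_moments P (fun w => n%:R `^ e * (x u n w - Ex P (x u n))).
      by apply: amZ; apply: amB; [exact: am_x|exact: am_cst].
    exact: (a.1 tt).
  move=> k k0; have := b_bounded u 1%N k isT k0; set S := [set _ | _ in _].
  set S' := [set _ | _ in _]; suff -> : S = S' by [].
  apply: eq_imagel => n _; congr 'E_P[_]%E; apply/funext => w.
  by rewrite /centered fine_expectation.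
have x_cov u k l : (0 < k)%N -> (0 < l)%N ->
    (fun n => n%:R `^ (2 * eps u) * (Ex P (fun w => x u n w ^+ (k + l)) -
     Ex P (fun w => x u n w ^+ k) * Ex P (fun w => x u n w ^+ l))) @ \oo --> C u k l.
  move=> k0 l0; move: (b_cov u k l k0 l0) => /fine_cvg.
  apply: cvg_trans; apply: near_eq_cvg; exists 1%N => // n /= n0.
  rewrite fine_covariance; [|by apply: amX; exact: am_x..].
  rewrite -EFinM /=; congr (_ * (_ - _)); apply: eq_Ex => w.
  by rewrite exprD.
have d_var' u : (fun n => Ex P (fun w => d u n w ^+ 2) - Ex P (d u n) ^+ 2) @ \oo -->
    sigma u ^+ 2.
  move: (d_var u) => /fine_cvg.
  apply: cvg_trans; apply: near_eq_cvg; exists 1%N => // n /= n0.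
  rewrite /variance fine_covariance; [|exact: am_d..].
  by rewrite /= expr2; congr (_ - _); apply: eq_Ex => w; rewrite expr2.
have am_entry n v : all_moments P (scaled_entry d b alpha n v).
  exact: (all_moments_scaled alpha_gt0 e0 e_eps eps_alpha bm_d bm_x bm_center_x).
apply: cvg_moments_gaussian => [n u|s]; first exact: all_moments_S_stat.
pose M := \max_(u <- map val s) size u.
have sM u : u \in map val s -> (size u <= M)%N by move=> us; exact: leq_bigmax_seq.
have tame_entry v (f : nat * nat -> nat -> nat) :
    tame P fst e (fun j => scaled_entry d b alpha j.1 (on_site (f j) v)).
  apply: (tame_scaled_entry alpha_gt0 e0 e_eps eps_alpha bm_d bm_x bm_center_x).
  by case: v => -[u q]; exists u; [left|right] => j; eexists.
have reg := regular_cov_monomial alpha_gt0 e0 e_eps eps_alpha bm_d bm_x bm_center_x indep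
  x_cvg x_cov d_var'.
have [v [v2 vk]] := fluctuation_clt am_entry tame_entry indep reg sM.
have SE n k : Ex P (fun w => (\sum_(u <- s) S_stat P alpha d b e n u w) ^+ k) =
    Ex P (fun w => normalized_sum (fluctuation d b alpha e M (map val s)) n w ^+ k).
  by apply: eq_Ex => w; rewrite (sum_S_stat _ am_entry _ _ sM).
exists v; split=> [|k].
  by rewrite (funext (fun n => SE n 2%N)).
by rewrite (funext (fun n => SE n k)).
Qed.
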